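(* Let $1\le r\le\min\{p_1,p_2\}$, $U\in\mathrm{St}(r,p_1)$, $B\in\mathbb{S}_+(r)$, $V\in\mathrm{St}(r,p_2)$ and $X=UBV^\top$. Write $\overline{\operatorname{grad}_U},\overline{\operatorname{grad}_B},\overline{\operatorname{grad}_V}$ for the $U$-, $B$-, $V$-components of $\overline{\operatorname{grad}h_r([U,B,V])}$. Then $$\operatorname{grad}f(X)=P_{U_\perp}\overline{\operatorname{grad}_Uh_r([U,B,V])}B^{-1}V^\top+U\Delta_1V^\top+\big(P_{V_\perp}\overline{\operatorname{grad}_Vh_r([U,B,V])}B^{-1}U^\top\big)^\top,$$ where $\Delta_1\in\mathbb{R}^{r\times r}$ is uniquely determined by $$B\,\mathrm{skew}(\Delta_1)^\top+\mathrm{skew}(\Delta_1)^\top B=2\,\overline{\operatorname{grad}_Uh_r([U,B,V])}^\top U,\qquad\mathrm{sym}(\Delta_1)=B^{-1}\overline{\operatorname{grad}_Bh_r([U,B,V])}B^{-1};$$ and $$\overline{\operatorname{grad}h_r([U,B,V])}=\begin{bmatrix}P_{U_\perp}\operatorname{grad}f(X)VB+U(\mathrm{skew}(\Delta_2)B+B\,\mathrm{skew}(\Delta_2))/2\\ B\,\mathrm{sym}(\Delta_2)B\\ (BU^\top\operatorname{grad}f(X)P_{V_\perp})^\top-V(\mathrm{skew}(\Delta_2)B+B\,\mathrm{skew}(\Delta_2))/2\end{bmatrix},\qquad\Delta_2=U^\top\operatorname{grad}f(X)V.$$ Furthermore, if $[U,B,V]$ is a Riemannian first-order stationary point of $h_r$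 on $\mathcal{M}^{q_2}_r$, then for all $\theta_{(U,B,V)}\in\mathcal{H}_{(U,B,V)}\overline{\mathcal{M}}^{q_2}_r$, $$\overline{\operatorname{Hess}h_r([U,B,V])}[\theta_{(U,B,V)},\theta_{(U,B,V)}]=\operatorname{Hess}f(X)\big[\mathcal{L}^r_{U,B,V}(\theta_{(U,B,V)}),\mathcal{L}^r_{U,B,V}(\theta_{(U,B,V)})\big].$$ Finally (at such a point), $\overline{\operatorname{Hess}h_r([U,B,V])}$ has $(p_1+p_2-r)r$ eigenvalues, and for $i=1,\dots,(p_1+p_2-r)r$, $\lambda_i(\overline{\operatorname{Hess}h_r([U,B,V])})$ is sandwiched between $\sigma_r^2(X)\lambda_i(\operatorname{Hess}f(X))$ and $2\sigma_1^2(X)\lambda_i(\operatorname{Hess}f(X))$.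
   Context: Notation: $\mathrm{St}(r,p)$ = $p\times r$ matrices with orthonormal columns; $\mathbb{O}_r$ = $r\times r$ orthogonal matrices; $\mathbb{S}^{r\times r}$, $\mathbb{S}_+(r)$ = symmetric, resp. symmetric positive definite, $r\times r$ matrices; $U_\perp$ = orthonormal complement of $U$, $P_{U_\perp}=U_\perp U_\perp^\top$; $\mathrm{sym}(A)=(A+A^\top)/2$, $\mathrm{skew}(A)=(A-A^\top)/2$; $\sigma_i,\lambda_i$ = $i$-th largest singular value/eigenvalue. ''$a$ is sandwiched between $b$ and $c$'' means $\min\{b,c\}\le a\le\max\{b,c\}$. Objective: $f:\mathbb{R}^{p_1\times p_2}\to\mathbb{R}$ is twice continuously differentiable. Embedded geometry: $\mathcal{M}^e_r=\{X\in\mathbb{R}^{p_1\times p_2}:\operatorname{rank}X=r\}$, an embedded submanifold of dimension $(p_1+p_2-r)r$ with the metric induced by the Euclidean inner product. $\operatorname{grad}f(X)$, $\operatorname{Hess}f(X)$ are the Riemannian gradient and Hessian of $f|_{\mathcal{M}^e_r}$. Quotient geometry $\mathcal{M}^{q_2}_r$: total space $\overline{\mathcal{M}}^{q_2}_r=\mathrm{St}(r,p_1)\times\mathbb{S}_+(r)\times\mathrm{St}(r,p_2)$, equivalence classes $[U,B,V]=\{(UO,O^\top BO,VO):O\in\mathbb{O}_r\}$, $\mathcal{M}^{q_2}_r=\overline{\mathcal{M}}^{q_2}_r/\mathbb{O}_r$ with quotient map $\pi$. Tangent vectors are written $\theta_{(U,B,V)}=[\theta_U^\top\ \ \theta_B^\top\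 \ \theta_V^\top]^\top$. The total space carries the metric $\bar g^r_{(U,B,V)}(\eta,\theta)=\operatorname{tr}(\eta_U^\top\theta_U)+\operatorname{tr}(B^{-1}\eta_BB^{-1}\theta_B)+\operatorname{tr}(\eta_V^\top\theta_V)$. The chosen horizontal space (complementary, not necessarily orthogonal, to the tangent space of the fiber) $\mathcal{H}_{(U,B,V)}\overline{\mathcal{M}}^{q_2}_r$ consists of all $[\theta_U^\top\ \ \theta_B^\top\ \ \theta_V^\top]^\top$ with $\theta_U=U_\perp D_1+U\Omega$, $\theta_B\in\mathbb{S}^{r\times r}$, $\theta_V=V_\perp D_2-V\Omega$, where $\Omega=-\Omega^\top\in\mathbb{R}^{r\times r}$, $D_1\in\mathbb{R}^{(p_1-r)\times r}$, $D_2\in\mathbb{R}^{(p_2-r)\times r}$. The horizontal lift at $(U,B,V)$ of a tangent vector $\theta_{[U,B,V]}$ is the unique horizontal $\theta_{(U,B,V)}$ with $\mathrm{D}\pi(U,B,V)[\theta_{(U,B,V)}]=\theta_{[U,B,V]}$; the quotient metric is $g^r_{[U,B,V]}(\eta_{[U,B,V]},\theta_{[U,B,V]})=\bar g^r_{(U,B,V)}(\eta_{(U,B,V)},\theta_{(U,B,V)})$. $h_r([U,B,V])=f(UBV^\top)$. $\overline{\operatorname{grad}h_r([U,B,V])}$ is the horizontal lift of the Riemannian gradient, and $\overline{\operatorname{Hess}h_r([U,B,V])}[\theta_{(U,B,V)},\eta_{(U,B,V)}]=\operatorname{Hess}h_r([U,B,V])[\theta_{[U,B,V]},\eta_{[U,B,V]}]$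 is the bilinear form of the Riemannian Hessian, on the horizontal space; its eigenvalues are those of the corresponding self-adjoint operator on the horizontal space with inner product $\bar g^r_{(U,B,V)}$. A Riemannian first-order stationary point is a point where the Riemannian gradient vanishes. The map $\mathcal{L}^r_{U,B,V}:\mathcal{H}_{(U,B,V)}\overline{\mathcal{M}}^{q_2}_r\to T_X\mathcal{M}^e_r$ is $\mathcal{L}^r_{U,B,V}(\theta_{(U,B,V)})=\theta_UBV^\top+U\theta_BV^\top+UB\theta_V^\top$. *)

(* Defs.v *)
From HB Require Import structures.
From mathcomp Require Import all_boot all_order all_algebra.
From mathcomp Require Import mathcomp_extra boolp classical_sets filter reals.
From mathcomp Require Import topology normedtype derive.

Set Implicit Arguments.
Unset Strict Implicit.
Unset Printing Implicit Defensive.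

Import Order.TTheory GRing.Theory Num.Theory.
Import numFieldNormedType.Exports.

Local Open Scope classical_set_scope.
Local Open Scope ring_scope.

(* In finite dimension this is the usual "twice continuously differentiable
   on a neighbourhood of x". *)
Definition C2_at (R : realType) (E F : normedModType R) (f : E -> F) (x : E) :
    Prop :=
  \forall y \near x,
    [/\ differentiable f y,
        forall u, differentiable (fun z => 'D_u f z) y
      & forall u v, {for y, continuous (fun z => 'D_v (fun w => 'D_u f w) z)}].

Definition C2 (R : realType) (E F : normedModType R) (f : E -> F) : Prop :=
  forall x, C2_at f x.

(* Velocities at x of the curves drawn on S: the tangent space of S at x when S
   is an embedded submanifold of E. *)
Definition tangent (R : realType) (E : normedModType R) (S : set E) (x : E) :
    set E :=
  [set v | exists gamma : R -> E,
     [/\ gamma 0 = x, (\forall t \near (0 : R), S (gamma t))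
       & is_derive (0 : R) (1 : R) gamma v]].

Definition inner (R : realType) (m n : nat) (A B : 'M[R]_(m, n)) : R :=
  \tr (A^T *m B).

Definition sym_part (R : realType) (n : nat) (A : 'M[R]_n) : 'M[R]_n :=
  2^-1 *: (A + A^T).

Definition skew_part (R : realType) (n : nat) (A : 'M[R]_n) : 'M[R]_n :=
  2^-1 *: (A - A^T).

Definition stiefel (R : realType) (p r : nat) : set 'M[R]_(p, r) :=
  [set U | U^T *m U = 1%:M].

Definition orthogonal_group (R : realType) (r : nat) : set 'M[R]_r :=
  [set O | O^T *m O = 1%:M].

Definition spd (R : realType) (r : nat) : set 'M[R]_r :=
  [set B | B^T = B /\ forall x : 'rV[R]_r, x != 0 -> 0 < (x *m B *m x^T) 0 0].

Definition perp (R : realType) (p r : nat) (U : 'M[R]_(p, r)) :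
    'M[R]_(p, p - r) :=
  xget 0 [set W | W^T *m W = 1%:M /\ U^T *m W = 0].

Definition proj_perp (R : realType) (p r : nat) (U : 'M[R]_(p, r)) : 'M[R]_p :=
  perp U *m (perp U)^T.

(* Spectra: eigenvalues are the roots of the characteristic polynomial, listed
   with multiplicity in nonincreasing order; the default [::] is returned when
   the polynomial does not split. *)
Definition eigvals (R : realType) (n : nat) (A : 'M[R]_n) : seq R :=
  xget [::] [set s : seq R |
    sorted >=%R s /\ char_poly A = \prod_(a <- s) ('X - a%:P)].

(* i-th largest singular value, i >= 1 *)
Definition sigma (R : realType) (m n : nat) (i : nat) (A : 'M[R]_(m, n)) : R :=
  Num.sqrt (eigvals (A^T *m A))`_i.-1.

Definition is_basis (R : realType) (E : normedModType R) (W : set E) (n : nat)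
    (b : 'I_n -> E) : Prop :=
  (forall v, W v <-> exists c : 'I_n -> R, v = \sum_i c i *: b i) /\
  (forall c : 'I_n -> R, \sum_i c i *: b i = 0 -> forall i, c i = 0).

(* Eigenvalues of the bilinear form Q on the subspace W with inner product g:
   those of the operator T of W with Q x y = g (T x) y, whose matrix in a basis
   b is A (with the row-vector convention).  Only the values of T on W matter. *)
Definition form_eigvals (R : realType) (E : normedModType R) (W : set E)
    (g Q : E -> E -> R) : seq R :=
  xget [::] [set s : seq R |
    exists (n : nat) (b : 'I_n -> E) (T : {linear E -> E}) (A : 'M[R]_n),
      [/\ is_basis W b,
          (forall x, W x -> W (T x)),
          (forall x y, W x -> W y -> Q x y = g (T x) y),
          (forall i, T (b i) = \sum_j A i j *: b j)
        & s = eigvals A]].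

(* i-th largest eigenvalue, i >= 1 *)
Definition lambda (R : realType) (E : normedModType R) (W : set E)
    (g Q : E -> E -> R) (i : nat) : R :=
  (form_eigvals W g Q)`_i.-1.

Definition sandwiched (R : realType) (a b c : R) : Prop :=
  Num.min b c <= a <= Num.max b c.

(* Riemannian gradient at x of F on a manifold whose tangent space at x is
   represented by the subspace W of E, with inner product g. *)
Definition riem_grad (R : realType) (E : normedModType R) (W : set E)
    (g : E -> E -> R) (F : E -> R) (x : E) : E :=
  xget 0 [set xi | W xi /\ forall eta, W eta -> g xi eta = 'D_eta F x].

(* Riemannian geometry read in a local parametrization phi : R^d -> E, where
   g p xi eta is the metric evaluated at the tangent vectors at p represented
   by xi and eta, and F : E -> R represents the function on the manifold. *)

Definition dvec (R : realType) (d : nat) (i : 'I_d) : 'rV[R]_d := delta_mx 0 i.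

Definition gram (R : realType) (d : nat) (E : normedModType R)
    (g : E -> E -> E -> R) (phi : 'rV[R]_d -> E) (x : 'rV[R]_d) : 'M[R]_d :=
  \matrix_(i, j) g (phi x) ('D_(dvec R i) phi x) ('D_(dvec R j) phi x).

(* Levi-Civita connection: Gamma^k_(i,j) *)
Definition christoffel (R : realType) (d : nat) (E : normedModType R)
    (g : E -> E -> E -> R) (phi : 'rV[R]_d -> E) (k i j : 'I_d)
    (x : 'rV[R]_d) : R :=
  2^-1 * \sum_l invmx (gram g phi x) k l *
    ('D_(dvec R i) (fun y => gram g phi y j l) x
     + 'D_(dvec R j) (fun y => gram g phi y i l) x
     - 'D_(dvec R l) (fun y => gram g phi y i j) x).

(* nabla_u Y at x, for the vector field with coordinates Y *)
Definition covariant (R : realType) (d : nat) (E : normedModType R)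
    (g : E -> E -> E -> R) (phi : 'rV[R]_d -> E) (u : 'rV[R]_d)
    (Y : 'rV[R]_d -> 'rV[R]_d) (x : 'rV[R]_d) : 'rV[R]_d :=
  \row_k ('D_u (fun y => Y y 0 k) x
          + \sum_i \sum_j christoffel g phi k i j x * u 0 i * Y x 0 j).

Definition grad_coord (R : realType) (d : nat) (E : normedModType R)
    (g : E -> E -> E -> R) (F : E -> R) (phi : 'rV[R]_d -> E)
    (x : 'rV[R]_d) : 'rV[R]_d :=
  \row_k \sum_l invmx (gram g phi x) k l * 'D_(dvec R l) (F \o phi) x.

(* g (nabla_u grad F, v) at x *)
Definition hess_coord (R : realType) (d : nat) (E : normedModType R)
    (g : E -> E -> E -> R) (F : E -> R) (phi : 'rV[R]_d -> E)
    (u v x : 'rV[R]_d) : R :=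
  (covariant g phi u (grad_coord g F phi) x *m gram g phi x *m v^T) 0 0.

Definition dimM (p1 p2 r : nat) : nat := ((p1 + p2 - r) * r)%N.

Definition fixed_rank (R : realType) (p1 p2 r : nat) : set 'M[R]_(p1, p2) :=
  [set X | \rank X = r].

Definition TMe (R : realType) (p1 p2 r : nat) (X : 'M[R]_(p1, p2)) :
    set 'M[R]_(p1, p2) :=
  tangent (fixed_rank r) X.

Definition grad_e (R : realType) (p1 p2 r : nat) (f : 'M[R]_(p1, p2) -> R)
    (X : 'M[R]_(p1, p2)) : 'M[R]_(p1, p2) :=
  riem_grad (TMe r X) (@inner R p1 p2) f X.

(* An immersion of R^d at 0, d the dimension of the manifold, into the manifold:
   by the inverse function theorem, a local parametrization around X.  The
   Levi-Civita connection is invariant under C^2 changes of coordinates. *)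
Definition chart_e (R : realType) (p1 p2 r : nat) (X : 'M[R]_(p1, p2))
    (phi : 'rV[R]_(dimM p1 p2 r) -> 'M[R]_(p1, p2)) : Prop :=
  [/\ phi 0 = X, C2_at phi 0,
      (\forall x \near (0 : 'rV[R]_(dimM p1 p2 r)),
         fixed_rank r (phi x))
    & forall u, 'D_u phi 0 = 0 -> u = 0].

(* Hess f(X)[xi, eta]; the value does not depend on the parametrization. *)
Definition hess_e (R : realType) (p1 p2 r : nat) (f : 'M[R]_(p1, p2) -> R)
    (X xi eta : 'M[R]_(p1, p2)) : R :=
  xget 0 [set h |
    exists (phi : 'rV[R]_(dimM p1 p2 r) -> 'M[R]_(p1, p2))
           (u v : 'rV[R]_(dimM p1 p2 r)),
      [/\ chart_e X phi, 'D_u phi 0 = xi, 'D_v phi 0 = eta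
        & h = hess_coord (fun=> @inner R p1 p2) f phi u v 0]].

(* Quotient geometry St(r,p1) x S_+(r) x St(r,p2) / O_r.  A triple is read
   (U, B, V) = (P.1.1, P.1.2, P.2); tangent vectors of the quotient at the class
   of P are represented by their horizontal lifts at P. *)

Notation triple R p1 p2 r := ('M[R]_(p1, r) * 'M[R]_r * 'M[R]_(p2, r))%type.

Definition total_space (R : realType) (p1 p2 r : nat) :
    set (triple R p1 p2 r) :=
  [set P | [/\ stiefel P.1.1, spd P.1.2 & stiefel P.2]].

Definition orbit_pt (R : realType) (p1 p2 r : nat) (P : triple R p1 p2 r)
    (O : 'M[R]_r) : triple R p1 p2 r :=
  (P.1.1 *m O, O^T *m P.1.2 *m O, P.2 *m O).

Definition fiber (R : realType) (p1 p2 r : nat) (P : triple R p1 p2 r) :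
    set (triple R p1 p2 r) :=
  [set orbit_pt P O | O in @orthogonal_group R r].

(* kernel of the differential at P of the quotient map *)
Definition vertical (R : realType) (p1 p2 r : nat) (P : triple R p1 p2 r) :
    set (triple R p1 p2 r) :=
  tangent (fiber P) P.

Definition horizontal (R : realType) (p1 p2 r : nat) (P : triple R p1 p2 r) :
    set (triple R p1 p2 r) :=
  [set theta |
    exists (D1 : 'M[R]_(p1 - r, r)) (D2 : 'M[R]_(p2 - r, r)) (Om : 'M[R]_r),
      [/\ Om^T = - Om, theta.1.2^T = theta.1.2,
          theta.1.1 = perp P.1.1 *m D1 + P.1.1 *m Om
        & theta.2 = perp P.2 *m D2 - P.2 *m Om]].

(* Horizontal lift at P of the tangent vector of the quotient that the quotient
   map's differential assigns to eta, a tangent vector of the total space. *)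
Definition hlift (R : realType) (p1 p2 r : nat) (P eta : triple R p1 p2 r) :
    triple R p1 p2 r :=
  xget 0 [set theta | horizontal P theta /\ vertical P (theta - eta)].

Definition gbar (R : realType) (p1 p2 r : nat)
    (P eta theta : triple R p1 p2 r) : R :=
  \tr (eta.1.1^T *m theta.1.1)
  + \tr (invmx P.1.2 *m eta.1.2 *m invmx P.1.2 *m theta.1.2)
  + \tr (eta.2^T *m theta.2).

(* quotient metric on the classes of tangent vectors of the total space *)
Definition gquot (R : realType) (p1 p2 r : nat)
    (P eta theta : triple R p1 p2 r) : R :=
  gbar P (hlift P eta) (hlift P theta).

Definition hfun (R : realType) (p1 p2 r : nat) (f : 'M[R]_(p1, p2) -> R)
    (P : triple R p1 p2 r) : R :=
  f (P.1.1 *m P.1.2 *m P.2^T).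

(* Horizontal lift at P of the Riemannian gradient of h_r at the class of P: on
   horizontal lifts, the quotient metric is gbar P and the differential of h_r
   is that of hfun f. *)
Definition grad_q (R : realType) (p1 p2 r : nat) (f : 'M[R]_(p1, p2) -> R)
    (P : triple R p1 p2 r) : triple R p1 p2 r :=
  riem_grad (horizontal P) (gbar P) (hfun f) P.

(* psi followed by the quotient map is a local parametrization of the quotient
   around the class of P: its differential at 0 is injective.  Every local
   parametrization lifts in this way, through local sections. *)
Definition chart_q (R : realType) (p1 p2 r : nat) (P : triple R p1 p2 r)
    (psi : 'rV[R]_(dimM p1 p2 r) -> triple R p1 p2 r) : Prop :=
  [/\ psi 0 = P, C2_at psi 0,
      (\forall x \near (0 : 'rV[R]_(dimM p1 p2 r)),
         total_space (psi x))
    & forall u, vertical P ('D_u psi 0) -> u = 0].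

(* Hess h_r at the class of P, on the tangent vectors whose horizontal lifts at
   P are theta and eta. *)
Definition hess_q (R : realType) (p1 p2 r : nat) (f : 'M[R]_(p1, p2) -> R)
    (P theta eta : triple R p1 p2 r) : R :=
  xget 0 [set h |
    exists (psi : 'rV[R]_(dimM p1 p2 r) -> triple R p1 p2 r)
           (u v : 'rV[R]_(dimM p1 p2 r)),
      [/\ chart_q P psi, hlift P ('D_u psi 0) = theta,
          hlift P ('D_v psi 0) = eta
        & h = hess_coord (@gquot R p1 p2 r) (hfun f) psi u v 0]].

Definition Lmap (R : realType) (p1 p2 r : nat) (P theta : triple R p1 p2 r) :
    'M[R]_(p1, p2) :=
  theta.1.1 *m P.1.2 *m P.2^T + P.1.1 *m theta.1.2 *m P.2^T
  + P.1.1 *m P.1.2 *m theta.2^T.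

(* Main.v *)
Require Import Defs.
From HB Require Import structures.
From mathcomp Require Import all_boot all_order all_algebra.
From mathcomp Require Import fingroup perm complex.
From mathcomp Require Import mathcomp_extra boolp classical_sets functions filter reals.
From mathcomp Require Import topology normedtype landau derive.
From mathcomp Require Import ring lra.
Set Implicit Arguments.
Unset Strict Implicit.
Unset Printing Implicit Defensive.
Import Order.TTheory GRing.Theory Num.Theory.
Import numFieldNormedType.Exports.
Local Open Scope classical_set_scope.
Local Open Scope ring_scope.

(** Write T for the tangent space of the fixed-rank manifold at X = U B V^T; it consists of the
    xi with P_{U_perp} xi P_{V_perp} = 0.  On horizontal vectors the differential of h_r at
    [U, B, V] is that of f at X composed with the linear map L, and both metrics split
    orthogonally along the blocks of theta and L theta; comparing blocks gives the two gradient
    formulas.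

    At a stationary point the derivative of f at X vanishes on T, so in a chart the Hessian
    is the plain second derivative of f along the chart.  A curve Y of rank r matrices
    satisfies Y = Y V (U^T Y V)^-1 U^T Y near X, so the part of its second derivative normal
    to T only depends on its velocities; hence the second derivative of f along Y only depends
    on the velocities too, and the lift of a quotient chart, pushed forward by
    (U, B, V) |-> U B V^T, shows that Hess h_r is the pullback of Hess f by L.

    In an eigenbasis of B, sigma_r(X)^2 gbar(theta, theta) <= |L theta|^2 <=
    2 sigma_1(X)^2 gbar(theta, theta), and the eigenvalues of two pencils with the same
    quadratic form and comparable Gram matrices are compared by Courant-Fischer. *)

(** * Orthonormal completion and the spectral theorem *)

(** Gradients, Hessians, lifts and spectra are values chosen by [xget], with a default when no
    candidate exists. Each therefore needs an explicit candidate: for the Hessians, charts on both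
    sides with prescribed velocities, and a proof that every other chart gives the same number,
    [hess_val]. For the spectra, the basis behind the choice is unknown, so the comparison is made
    in whatever bases come out. Delta_1 turns out to equal Delta_2: its equations give the symmetric
    part directly, and the skew part through the map Z |-> Z B + B Z, injective since B is positive
    definite. The same map produces the 2 of the upper bound. The opposite signs of Omega in theta_U
    and theta_V put Omega B + B Omega into L theta, of squared norm up to 4 sigma_1(X)^2 |Omega|^2,
    whereas [gbar] counts |Omega|^2 only twice; the other blocks have ratio at most sigma_1(X)^2.
    Eigenvalues of either sign may occur, and multiplying the metric bounds by a negative one
    reverses them: hence a sandwich. *)

Ltac mx_lra := apply/matrixP => ? ?; rewrite !mxE; lra.


Section Orthonormal.
Context {R : realType}.

Lemma trmxD m n (A B : 'M[R]_(m, n)) : (A + B)^T = A^T + B^T.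
Proof. exact: linearD. Qed.
Lemma trmxN m n (A : 'M[R]_(m, n)) : (- A)^T = - A^T.
Proof. exact: linearN. Qed.
Lemma trmxZ m n a (A : 'M[R]_(m, n)) : (a *: A)^T = a *: A^T.
Proof. exact: linearZ. Qed.

Lemma mulmx_tr_ge0 n (x : 'rV[R]_n) : 0 <= (x *m x^T) 0 0.
Proof. by rewrite mxE sumr_ge0// => i _; rewrite mxE -expr2 sqr_ge0. Qed.

Lemma mulmx_tr_eq0 n (x : 'rV[R]_n) : (x *m x^T) 0 0 = 0 -> x = 0.
Proof.
rewrite mxE => /eqP; rewrite psumr_eq0; last first.
  by move=> i _; rewrite mxE -expr2 sqr_ge0.
move=> /allP H; apply/rowP => i; have := H i (mem_index_enum _).
by rewrite !mxE /= -expr2 sqrf_eq0 => /eqP.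
Qed.

Lemma mulmx_tr_gt0 n (x : 'rV[R]_n) : x != 0 -> 0 < (x *m x^T) 0 0.
Proof.
move=> x0; rewrite lt_neqAle mulmx_tr_ge0 andbT eq_sym.
by apply: contraNneq x0 => /mulmx_tr_eq0 ->.
Qed.

Lemma normalize_row n (x : 'rV[R]_n) : x != 0 ->
  exists2 c, c != 0 & (c *: x) *m (c *: x)^T = 1%:M.
Proof.
move=> /mulmx_tr_gt0 x0; exists (Num.sqrt ((x *m x^T) 0 0))^-1.
  by rewrite invr_eq0 gt_eqF// sqrtr_gt0.
rewrite linearZ/= -scalemxAl -scalemxAr scalerA -expr2 exprVn sqr_sqrtr ?ltW//.
rewrite [x *m _]mx11_scalar -[X in _ *: X]scalemx1 !mxE scalerA mulVf ?scale1r//.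
by move: x0; rewrite mxE => /gt_eqF ->.
Qed.

(** Columns are added one at a time. While r + k < p, the p by (r + k) matrix of [U] and the columns
    found so far has a nonzero left kernel; a normalized row of that kernel, transposed, is the next
    column. *)
Lemma orthonormal_completion p r (U : 'M[R]_(p, r)) k : U^T *m U = 1%:M ->
  (r + k <= p)%N -> exists2 W : 'M[R]_(p, k), W^T *m W = 1%:M & U^T *m W = 0.
Proof.
move=> U1; elim: k => [|k IH] rk; first by exists 0; [rewrite [LHS]flatmx0 [RHS]flatmx0| rewrite mulmx0].
have [|W W1 UW] := IH; first by rewrite (leq_trans _ rk)// addnS.
set M := row_mx U W.
have : kermx M != 0.
  rewrite kermx_eq0 /row_free ltn_eqF//.
  by rewrite (leq_ltn_trans (rank_leq_col M))// -addnS.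
move=> /rowV0Pn[x /sub_kermxP xM x0].
have [c c0 cx1] := normalize_row x0.
move: xM; rewrite /M mul_mx_row => /eqP; rewrite row_mx_eq0 => /andP[/eqP xU /eqP xW].
have Ux : U^T *m (c *: x)^T = 0.
  by apply: trmx_inj; rewrite trmx_mul !trmxK trmx0 -scalemxAl xU scaler0.
change (exists2 W0 : 'M[R]_(p, 1 + k), W0^T *m W0 = 1%:M & U^T *m W0 = 0).
exists (row_mx (c *: x)^T W); last by rewrite mul_mx_row Ux UW row_mx0.
rewrite tr_row_mx trmxK mul_col_row cx1 W1 -[_ *m W]scalemxAl xW scaler0.
have -> : W^T *m (c *: x)^T = 0.
  by apply: trmx_inj; rewrite trmx_mul !trmxK trmx0 -scalemxAl xW scaler0.
by rewrite -scalar_mx_block.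
Qed.

(** The equation q = p is propositional because r + (p - r), the number of columns of
    [row_mx U (perp U)], does not compute to p. *)
Lemma mulmx1_tr p q (M : 'M[R]_(p, q)) : q = p -> M^T *m M = 1%:M -> M *m M^T = 1%:M.
Proof. by move=> e; subst q; exact: mulmx1C. Qed.

Section Perp.
Context {p r : nat} {U : 'M[R]_(p, r)}.
Hypotheses (U1 : stiefel U) (rp : (r <= p)%N).

Lemma perp_spec : (perp U)^T *m perp U = 1%:M /\ U^T *m perp U = 0.
Proof.
apply: (@xgetPex _ 0 [set W | W^T *m W = 1%:M /\ U^T *m W = 0]).
have [|W W1 W2] := @orthonormal_completion p r U (p - r) U1; first by rewrite subnKC.
by exists W.
Qed.

Lemma tr_perp_mul : (perp U)^T *m U = 0.
Proof. by apply: trmx_inj; rewrite trmx_mul trmxK trmx0; have [] := perp_spec. Qed.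

(** [row_mx U (perp U)] is square with orthonormal columns, so U U^T and [proj_perp U] add up to 1.
    The projector is thus independent of the complement chosen by [perp]. *)
Lemma proj_perpE : proj_perp U = 1%:M - U *m U^T.
Proof.
have [W1 W2] := perp_spec.
have : row_mx U (perp U) *m (row_mx U (perp U))^T = 1%:M.
  apply: mulmx1_tr; first by rewrite subnKC.
  by rewrite tr_row_mx mul_col_row U1 W1 W2 tr_perp_mul -scalar_mx_block.
by rewrite tr_row_mx mul_row_col => <-; rewrite addrC addKr.
Qed.

End Perp.
End Orthonormal.

Section Spectral.
Context {R : realType}.

Lemma char_poly_conj n (P A B : 'M[R]_n) : P \in unitmx -> P *m A = B *m P ->
  char_poly A = char_poly B.
Proof.
move=> Pu PA; set Q := map_mx polyC P.
have Qu : \det Q != 0.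
  by rewrite det_map_mx polyC_eq0; move: Pu; rewrite unitmxE unitfE.
apply: (mulfI Qu); rewrite -det_mulmx mulrC -det_mulmx; congr (\det _).
rewrite /char_poly_mx mulmxBl mulmxBr -!map_mxM PA; congr (_ - _).
by rewrite scalar_mxC.
Qed.

(* A complex eigenvector x + i y of a real symmetric matrix has a real eigenvalue, so its real
   and imaginary parts are eigenvectors too. *)
Lemma symmetric_eigen n (A : 'M[R]_n.+1) : A^T = A ->
  exists (a : R) (v : 'rV[R]_n.+1), v != 0 /\ v *m A = a *: v.
Proof.
move=> sA; pose Ac : 'M[R[i]]_n.+1 := map_mx (real_complex R) A.
have [|[a b] /eigenvalueP[z zA z0]] := @spectral.eigenvalue_closed _ _ Ac; first by [].
pose v : 'rV[R]_n.+1 := map_mx (@complex.Re R) z.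
pose w : 'rV[R]_n.+1 := map_mx (@complex.Im R) z.
have vA : v *m A = a *: v - b *: w.
  apply/rowP => j; move/rowP: zA => /(_ j); rewrite !mxE => /(congr1 (@complex.Re R)).
  rewrite (raddf_sum (@complex.Re R)) /=.
  case: (z 0 j) => zr zi /= <-; apply: eq_bigr => k _; rewrite !mxE.
  by case: (z 0 k) => x y /=; rewrite mulr0 subr0.
have wA : w *m A = a *: w + b *: v.
  apply/rowP => j; move/rowP: zA => /(_ j); rewrite !mxE => /(congr1 (@complex.Im R)).
  rewrite (raddf_sum (@complex.Im R)) /=.
  case: (z 0 j) => zr zi /= <-; apply: eq_bigr => k _; rewrite !mxE.
  by case: (z 0 k) => x y /=; rewrite mulr0 add0r.
have vw0 : v != 0 \/ w != 0.
  apply/orP; rewrite -negb_and; apply: contra z0 => /andP[/eqP v0 /eqP w0].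
  apply/eqP/rowP => j; move/rowP: v0 => /(_ j); move/rowP: w0 => /(_ j); rewrite !mxE.
  by case: (z 0 j) => x y /= -> ->.
(* Symmetry of [A] gives v A w^T = w A v^T, that is - b |w|^2 = b |v|^2, and v, w are not both
   zero. *)
have b0 : b = 0.
  have E : (v *m A *m w^T) 0 0 = (w *m A *m v^T) 0 0.
    transitivity ((v *m A *m w^T)^T 0 0); first by rewrite [RHS]mxE.
    by rewrite !trmx_mul trmxK sA mulmxA.
  have vw : (v *m w^T) 0 0 = (w *m v^T) 0 0.
    transitivity ((v *m w^T)^T 0 0); first by rewrite [RHS]mxE.
    by rewrite !trmx_mul trmxK.
  have e1 : ((a *: v - b *: w) *m w^T) 0 0 = a * (v *m w^T) 0 0 - b * (w *m w^T) 0 0.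
    by rewrite mulmxBl -!scalemxAl; move: (v *m w^T) (w *m w^T) => X Y; rewrite !mxE.
  have e2 : ((a *: w + b *: v) *m v^T) 0 0 = a * (w *m v^T) 0 0 + b * (v *m v^T) 0 0.
    by rewrite mulmxDl -!scalemxAl; move: (w *m v^T) (v *m v^T) => X Y; rewrite !mxE.
  move: E; rewrite vA wA e1 e2 vw => /addrI /eqP.
  rewrite eq_sym -subr_eq0 opprK -mulrDr mulf_eq0 => /orP[/eqP//|].
  rewrite paddr_eq0 ?mulmx_tr_ge0// => /andP[/eqP/mulmx_tr_eq0 v0 /eqP/mulmx_tr_eq0 w0].
  by move: vw0; rewrite v0 w0 eqxx => -[].
rewrite b0 !scale0r ?addr0 ?subr0 in vA wA.
by case: vw0 => [v0|w0]; exists a; [exists v|exists w].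
Qed.

(** Deflation: a unit eigenvector is completed to an orthonormal basis, in which the symmetric [A]
    is block diagonal, and the induction hypothesis diagonalizes the remaining block. *)
Lemma spectral_theorem n (A : 'M[R]_n) : A^T = A ->
  exists (Q : 'M[R]_n) (d : 'rV[R]_n), Q *m Q^T = 1%:M /\ Q *m A *m Q^T = diag_mx d.
Proof.
elim: n A => [|n IH] A sA.
  by exists 1%:M, 0; split; rewrite [LHS]flatmx0 [RHS]flatmx0.
have [a [v0 [v0n v0A]]] := symmetric_eigen sA.
have [v v1 vA] : exists2 v : 'rV[R]_n.+1, v *m v^T = 1%:M & v *m A = a *: v.
  have [c c0 c1] := normalize_row v0n; exists (c *: v0) => //.
  by rewrite -scalemxAl v0A !scalerA mulrC.
have [||W W1 vW] := @orthonormal_completion _ n.+1 1 v^T n; rewrite ?trmxK ?add1n//.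
rewrite trmxK in vW.
have Wv : W^T *m v^T = 0 by apply: trmx_inj; rewrite trmx_mul !trmxK trmx0.
have [|Q' [d' [Q1 QA]]] := IH (W^T *m A *m W).
  by rewrite !trmx_mul trmxK sA mulmxA.
have : exists (Q : 'M[R]_(1 + n, 1 + n)) (d : 'rV[R]_(1 + n)), Q *m Q^T = 1%:M /\ Q *m (A : 'M[R]_(1 + n, 1 + n)) *m Q^T = diag_mx d; last by [].
pose P : 'M[R]_(1 + n, 1 + n) := col_mx v W^T.
have PP : P *m P^T = 1%:M.
  rewrite /P tr_col_mx (@mul_col_row _ 1 n) trmxK v1 vW Wv W1.
  by rewrite -scalar_mx_block.
have PAP : P *m (A : 'M[R]_(1 + n, 1 + n)) *m P^T = block_mx a%:M 0 0 (W^T *m A *m W).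
  rewrite /P tr_col_mx (@mul_col_mx _ 1 n) (@mul_col_row _ 1 n) trmxK vA -!scalemxAl v1 vW scaler0.
  have -> : W^T *m A *m v^T = 0.
    apply: trmx_inj; rewrite !trmx_mul !trmxK sA trmx0.
    by rewrite mulmxA vA -scalemxAl vW scaler0.
  by rewrite -[a%:M]scalemx1.
pose S : 'M[R]_(1 + n, 1 + n) := block_mx 1%:M 0 0 Q'.
exists (S *m P), (row_mx a%:M d'); split.
  rewrite trmx_mul mulmxA -(mulmxA S) PP mulmx1 /S tr_block_mx !trmx0 mulmx_block.
  by rewrite !mulmx0 !mul0mx trmx1 mulmx1 Q1 !addr0 add0r -scalar_mx_block.
rewrite trmx_mul !mulmxA -(mulmxA S) -(mulmxA S) PAP /S tr_block_mx !trmx0 !mulmx_block.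
rewrite !mulmx0 !mul0mx trmx1 !mul1mx mulmx1 !addr0 !add0r mul0mx QA diag_mx_row.
by rewrite mul0mx; congr block_mx; apply/matrixP => i j; rewrite !ord1 !mxE eqxx !mulr1n.
Qed.

(** The factorization fixes the roots up to permutation and sorting removes that freedom, so
    [eigvals] is evaluated by exhibiting a list. *)
Lemma eigvals_unique n (A : 'M[R]_n) (s : seq R) :
  sorted >=%R s -> char_poly A = \prod_(a <- s) ('X - a%:P) -> eigvals A = s.
Proof.
move=> ss sA; apply: xget_unique => //= t [st tA].
apply: (@sorted_eq _ >=%R) => //.
- by move=> x y z; rewrite /= => yx zx; apply: le_trans zx yx.
- by move=> x y; rewrite /= andbC => /le_anti.
by apply: prod_XsubC_eq; rewrite -tA -sA.
Qed.

Lemma eigvals_diag n (A P : 'M[R]_n) (d : 'rV[R]_n) : P \in unitmx ->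
  P *m A = diag_mx d *m P -> sorted >=%R [seq d 0 i | i : 'I_n] ->
  eigvals A = [seq d 0 i | i : 'I_n].
Proof.
move=> Pu PA ds; apply: eigvals_unique => //.
rewrite (char_poly_conj Pu PA) char_poly_trig ?diag_mx_is_trig// big_image /=.
by apply: eq_bigr => i _; rewrite mxE eqxx mulr1n.
Qed.

Lemma spectral_theorem_sorted n (A : 'M[R]_n) : A^T = A ->
  exists (Q : 'M[R]_n) (d : 'rV[R]_n), [/\ Q *m Q^T = 1%:M, Q *m A *m Q^T = diag_mx d
    & sorted >=%R [seq d 0 i | i : 'I_n]].
Proof.
move=> /spectral_theorem[Q [d [Q1 QA]]].
pose t := [tuple d 0 i | i < n].
have : perm_eq (sort_tuple >=%R t) t by rewrite perm_sort.
move=> /tuple_permP[s ts].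
exists (row_perm s Q), (\row_i d 0 (s i)); split.
- rewrite row_permE trmx_mul tr_perm_mx mulmxA -(mulmxA _ Q) Q1 mulmx1 -perm_mxM.
  by rewrite mulgV perm_mx1.
- rewrite row_permE trmx_mul tr_perm_mx !mulmxA -(mulmxA _ Q) -(mulmxA _ (Q *m _)) QA.
  rewrite -row_permE -col_permE; apply/matrixP => i j; rewrite !mxE.
  by rewrite (inj_eq perm_inj).
- have -> : [seq (\row_i d 0 (s i)) 0 i | i : 'I_n] = sort_tuple >=%R t.
    rewrite ts; apply: eq_map => i; by rewrite tnth_mktuple mxE.
  by apply: sort_sorted => x y; rewrite /= le_total.
Qed.

End Spectral.

(** * Pencils of symmetric matrices *)

Section Pencil.
Context {R : realType}.

Lemma nth_diag n (d : 'rV[R]_n) (i : 'I_n) : [seq d 0 j | j : 'I_n]`_i = d 0 i.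
Proof. by rewrite (nth_map i) ?size_enum_ord// nth_ord_enum. Qed.

Lemma sorted_diagP n (d : 'rV[R]_n) :
  sorted >=%R [seq d 0 i | i : 'I_n] <-> forall i j : 'I_n, (i <= j)%N -> d 0 j <= d 0 i.
Proof.
split=> [sd i j ij|H].
  rewrite -(nth_diag d i) -(nth_diag d j).
  apply: (sorted_leq_nth _ _ _ sd) => //.
  - by move=> x y z /= yx zx; apply: le_trans zx yx.
  - by move=> x /=.
  - by rewrite inE size_image card_ord.
  - by rewrite inE size_image card_ord.
apply/(sortedP (0 : R)) => k; rewrite size_image card_ord => kn.
have := H (Ordinal (ltnW kn)) (Ordinal kn) (leqnSn _).
by rewrite -!nth_diag.
Qed.

Lemma quad_diag n (M E : 'M[R]_n) (d y : 'rV[R]_n) : E *m M *m E^T = diag_mx d ->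
  ((y *m E) *m M *m (y *m E)^T) 0 0 = \sum_k d 0 k * y 0 k ^+ 2.
Proof.
move=> EM; rewrite trmx_mul !mulmxA -2!(mulmxA y) EM -mulmxA mxE.
apply: eq_bigr => k _; rewrite mul_diag_mx !mxE; by rewrite mulrCA expr2.
Qed.

Lemma row_mul_tr_row m n p (A : 'M[R]_(m, n)) (B : 'M[R]_(p, n)) i j :
  (row i A *m (row j B)^T) 0 0 = (A *m B^T) i j.
Proof. by rewrite !mxE; apply: eq_bigr => k _; rewrite !mxE. Qed.

(** Whitening: once K G K^T = 1, an orthogonal matrix diagonalizes the symmetric K S K^T. The
    product of the two conjugates [A] = S G^-1 to the diagonal matrix, so the eigenvalues of [A] are
    those of the pencil (S, G). *)
Lemma pencil_diag n (G S A : 'M[R]_n) : spd G -> S^T = S -> S = A *m G ->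
  exists (E : 'M[R]_n) (d : 'rV[R]_n), [/\ E *m G *m E^T = 1%:M,
    E *m S *m E^T = diag_mx d, sorted >=%R [seq d 0 i | i : 'I_n]
    & eigvals A = [seq d 0 i | i : 'I_n]].
Proof.
move=> [sG pG] sS SA.
have [Q [g [Q1 QG]]] := spectral_theorem sG.
have g0 i : 0 < g 0 i.
  have -> : g 0 i = (row i Q *m G *m (row i Q)^T) 0 0.
    by rewrite -row_mul row_mul_tr_row QG mxE eqxx mulr1n.
  apply: pG; apply/eqP => Qi0; have := row_mul_tr_row Q Q i i.
  by rewrite Q1 Qi0 mul0mx !mxE eqxx => /eqP; rewrite eq_sym oner_eq0.
have [K K1] : exists K : 'M[R]_n, K *m G *m K^T = 1%:M.
  exists (diag_mx (\row_i (Num.sqrt (g 0 i))^-1) *m Q); rewrite trmx_mul tr_diag_mx mulmxA -(mulmxA _ Q) -(mulmxA _ (Q *m G)) QG.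
  rewrite !mulmx_diag -diag_const_mx; congr diag_mx.
  apply/rowP => i; rewrite !mxE mulrAC -expr2 exprVn sqr_sqrtr ?ltW//.
  by rewrite mulVf ?gt_eqF.
have [|Q2 [d [Q21 QS ds]]] := @spectral_theorem_sorted R n (K *m S *m K^T).
  by rewrite !trmx_mul trmxK sS mulmxA.
have E1 : Q2 *m K *m G *m (Q2 *m K)^T = 1%:M.
  by rewrite trmx_mul !mulmxA -2!(mulmxA Q2) K1 mulmx1.
have E2 : Q2 *m K *m S *m (Q2 *m K)^T = diag_mx d.
  by rewrite trmx_mul -QS !mulmxA.
exists (Q2 *m K), d; split => //.
move: (Q2 *m K) E1 E2 => E E1 E2.
have Eu : E \in unitmx by move: E1; rewrite -mulmxA => /mulmx1_unit[].
(* By E G E^T = 1 the inverse of [E] is G E^T, so (E S E^T) E = E A (G E^T) E = E A. *)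
apply: (eigvals_diag Eu _ ds).
rewrite -E2 SA -!mulmxA; congr (_ *m _).
rewrite -[LHS]mulmx1; congr (_ *m _).
by rewrite mulmxA; apply/esym/mulmx1C; rewrite mulmxA.
Qed.

(** The first i + 1 rows of [E'] and the rows of [E] of index at least i span spaces of dimensions i
    + 1 and n - i, whose sum exceeds n. *)
Lemma cap_flags n (E E' : 'M[R]_n) (i : 'I_n) : E \in unitmx -> E' \in unitmx ->
  exists x y z : 'rV[R]_n, [/\ x != 0, x = y *m E', x = z *m E,
    (forall k : 'I_n, (i < k)%N -> y 0 k = 0) & (forall k : 'I_n, (k < i)%N -> z 0 k = 0)].
Proof.
move=> Eu Eu'.
pose A : 'M[R]_n := pid_mx i.+1 *m E'; pose B : 'M[R]_n := copid_mx i *m E.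
have rA : \rank A = i.+1 by rewrite mxrankMfree ?row_free_unit// rank_pid_mx.
have rB : \rank B = (n - i)%N by rewrite mxrankMfree ?row_free_unit// rank_copid_mx// ltnW.
have : (A :&: B)%MS != 0.
  rewrite -mxrank_eq0 -lt0n -(ltn_add2l (\rank (A + B)%MS)) addn0 mxrank_sum_cap rA rB.
  by rewrite addSn subnKC ?ltnS ?rank_leq_col// ltnW.
move=> /rowV0Pn[x]; rewrite sub_capmx => /andP[/submxP[y xy] /submxP[z xz]] x0.
exists x, (y *m pid_mx i.+1), (z *m copid_mx i); split; rewrite -?mulmxA//.
- move=> k ik; rewrite mxE big1// => j _; rewrite mxE.
  by case: eqP => [->|]; rewrite ?ltnS ?mulr0//= leqNgt ik mulr0.
- move=> k ki; rewrite mxE big1// => j _; rewrite !mxE.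
  have [->|jk] := eqVneq j k; first by rewrite eqxx ki subrr mulr0.
  by rewrite (_ : (j == k :> nat) = false) ?subr0 ?mulr0//; apply/negbTE.
Qed.

(* Courant-Fischer: the span of the first i+1 vectors of one diagonalizing
   basis meets the span of the vectors of index >= i of the other one. *)
Lemma pencil_test_vector n (G G' S E E' : 'M[R]_n) (d d' : 'rV[R]_n) (i : 'I_n) :
  E *m G *m E^T = 1%:M -> E *m S *m E^T = diag_mx d ->
  sorted >=%R [seq d 0 i | i : 'I_n] ->
  E' *m G' *m E'^T = 1%:M -> E' *m S *m E'^T = diag_mx d' ->
  sorted >=%R [seq d' 0 i | i : 'I_n] ->
  exists2 x : 'rV[R]_n, x != 0 &
    d' 0 i * (x *m G' *m x^T) 0 0 <= d 0 i * (x *m G *m x^T) 0 0.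
Proof.
move=> E1 E2 /sorted_diagP ds E1' E2' /sorted_diagP ds'.
have Eu : E \in unitmx by move: E1; rewrite -mulmxA => /mulmx1_unit[].
have Eu' : E' \in unitmx by move: E1'; rewrite -mulmxA => /mulmx1_unit[].
have [x [y [z [x0 xy xz y0 z0]]]] := cap_flags i Eu Eu'.
(* On the first i + 1 vectors of [E'] the form [S] is at least d'_i times [G']; on the vectors of
   [E] of index at least i it is at most d_i times [G]. *)
exists x => //; apply: (@le_trans _ _ ((x *m S *m x^T) 0 0)).
  rewrite {1 2}xy xy !(quad_diag _ E2') -diag_const_mx in E1' *.
  rewrite (quad_diag _ E1') mulr_sumr; apply: ler_sum => k _; rewrite mxE mul1r.
  have [ki|ik] := leqP k i; last by rewrite y0// expr0n !mulr0.
  by rewrite ler_wpM2r ?sqr_ge0// ds'.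
rewrite xz (quad_diag _ E2) -diag_const_mx in E1 *.
rewrite (quad_diag _ E1) mulr_sumr; apply: ler_sum => k _; rewrite mxE mul1r.
have [ik|ki] := leqP i k; last by rewrite z0// expr0n !mulr0.
by rewrite ler_wpM2r ?sqr_ge0// ds.
Qed.

(** A test vector x gives d'_i (x G' x^T) <= d_i (x G x^T), and another one, for the exchanged
    pencils, the reverse. The ratio of the two Gram forms lies in [a, b], so the sign of d'_i
    decides which of a d'_i and b d'_i bounds d_i from below, and which from above. *)
Lemma pencil_compare n (G G' S A A' : 'M[R]_n) (a b : R) :
  spd G -> spd G' -> S^T = S -> S = A *m G -> S = A' *m G' ->
  (forall x : 'rV[R]_n, a * (x *m G *m x^T) 0 0 <= (x *m G' *m x^T) 0 0 <= b * (x *m G *m x^T) 0 0) ->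
  size (eigvals A) = n /\ forall i, (i < n)%N ->
    sandwiched (eigvals A)`_i (a * (eigvals A')`_i) (b * (eigvals A')`_i).
Proof.
move=> pG pG' sS SA SA' ab.
have [E [d [E1 E2 ds ->]]] := pencil_diag pG sS SA.
have [E' [d' [E1' E2' ds' ->]]] := pencil_diag pG' sS SA'.
split=> [|k kn]; first by rewrite size_image card_ord.
pose i := Ordinal kn; rewrite -[k]/(nat_of_ord i) !nth_diag /sandwiched.
have cmp c e (x : 'rV[R]_n) : x != 0 ->
    c * (x *m G *m x^T) 0 0 <= e * (x *m G *m x^T) 0 0 -> c <= e.
  by move=> x0; rewrite ler_pM2r//; apply: pG.2.
apply/andP; split.
- have [x x0 H] := pencil_test_vector i E1 E2 ds E1' E2' ds'.
  have /andP[aG bG] := ab x; apply: (cmp _ _ _ x0); apply: le_trans H.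
  have [d0|d0] := leP 0 (d' 0 i).
    apply: (@le_trans _ _ (a * d' 0 i * (x *m G *m x^T) 0 0)).
      by rewrite ler_wpM2r ?ge_min ?lexx// ltW//; apply: pG.2.
    by rewrite mulrAC mulrC ler_wpM2l.
  apply: (@le_trans _ _ (b * d' 0 i * (x *m G *m x^T) 0 0)).
    by rewrite ler_wpM2r ?ge_min ?lexx ?orbT// ltW//; apply: pG.2.
  by rewrite mulrAC mulrC; apply: ler_wnM2l => //; exact: ltW.
- have [x x0 H] := pencil_test_vector i E1' E2' ds' E1 E2 ds.
  have /andP[aG bG] := ab x; apply: (cmp _ _ _ x0); apply: (le_trans H).
  have [d0|d0] := leP 0 (d' 0 i).
    apply: (@le_trans _ _ (b * d' 0 i * (x *m G *m x^T) 0 0)); last first.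
      by rewrite ler_wpM2r ?le_max ?lexx ?orbT// ltW//; apply: pG.2.
    by rewrite mulrAC [leRHS]mulrC ler_wpM2l.
  apply: (@le_trans _ _ (a * d' 0 i * (x *m G *m x^T) 0 0)); last first.
    by rewrite ler_wpM2r ?le_max ?lexx// ltW//; apply: pG.2.
  by rewrite mulrAC [leRHS]mulrC; apply: ler_wnM2l => //; exact: ltW.
Qed.

End Pencil.

(** * Norm estimates in an eigenbasis *)

Section Frobenius.
Context {R : realType}.

Lemma innerE m n (A B : 'M[R]_(m, n)) : inner A B = \sum_i \sum_j A i j * B i j.
Proof.
rewrite /inner /mxtrace exchange_big; apply: eq_bigr => j _.
by rewrite mxE; apply: eq_bigr => i _; rewrite mxE.
Qed.

Lemma innerC m n (A B : 'M[R]_(m, n)) : inner A B = inner B A.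
Proof. by rewrite /inner -mxtrace_tr trmx_mul trmxK. Qed.

Lemma innerDl m n (A B C : 'M[R]_(m, n)) : inner (A + B) C = inner A C + inner B C.
Proof. by rewrite /inner linearD mulmxDl mxtraceD. Qed.

Lemma innerDr m n (A B C : 'M[R]_(m, n)) : inner C (A + B) = inner C A + inner C B.
Proof. by rewrite innerC innerDl !(innerC C). Qed.

Lemma innerZl m n a (A C : 'M[R]_(m, n)) : inner (a *: A) C = a * inner A C.
Proof. by rewrite /inner linearZ -scalemxAl mxtraceZ. Qed.

Lemma innerNl m n (A C : 'M[R]_(m, n)) : inner (- A) C = - inner A C.
Proof. by rewrite -scaleN1r innerZl mulN1r. Qed.

Lemma innerNr m n (A C : 'M[R]_(m, n)) : inner C (- A) = - inner C A.
Proof. by rewrite innerC innerNl innerC. Qed.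

Lemma inner0l m n (C : 'M[R]_(m, n)) : inner 0 C = 0.
Proof. by rewrite /inner trmx0 mul0mx mxtrace0. Qed.

Lemma inner_tr m n (A B : 'M[R]_(m, n)) : inner A^T B^T = inner A B.
Proof. by rewrite /inner trmxK mxtrace_mulC -mxtrace_tr trmx_mul trmxK. Qed.

Lemma inner_mulL m n p (U : 'M[R]_(m, n)) (A : 'M[R]_(n, p)) (B : 'M[R]_(m, p)) :
  inner (U *m A) B = inner A (U^T *m B).
Proof. by rewrite /inner trmx_mul mulmxA. Qed.

Lemma inner_mulR m n p (A : 'M[R]_(m, n)) (V : 'M[R]_(n, p)) (B : 'M[R]_(m, p)) :
  inner (A *m V) B = inner A (B *m V^T).
Proof. by rewrite -[LHS]inner_tr -[RHS]inner_tr !trmx_mul inner_mulL trmxK. Qed.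

Lemma inner_ge0 m n (A : 'M[R]_(m, n)) : 0 <= inner A A.
Proof. by rewrite innerE; do 2!apply: sumr_ge0 => ? _; rewrite -expr2 sqr_ge0. Qed.

Lemma inner_eq0 m n (A : 'M[R]_(m, n)) : inner A A = 0 -> A = 0.
Proof.
rewrite innerE => /eqP; rewrite psumr_eq0; last first.
  by move=> i _; apply: sumr_ge0 => j _; rewrite -expr2 sqr_ge0.
move=> /allP H; apply/matrixP => i j; have := H i (mem_index_enum _).
rewrite /= psumr_eq0 => [/allP/(_ j (mem_index_enum _))|k _]; last by rewrite -expr2 sqr_ge0.
by rewrite /= -expr2 sqrf_eq0 mxE => /eqP.
Qed.

Lemma inner_sym_skew n (A S : 'M[R]_n) : A^T = - A -> S^T = S -> inner A S = 0.
Proof.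
move=> sA sS; have := inner_tr A S; rewrite sA sS innerNl => /eqP.
by rewrite eq_sym -addr_eq0 -mulr2n mulrn_eq0 /= => /eqP.
Qed.

Lemma sum2_bounds m n (F G : 'I_m -> 'I_n -> R) a b :
  (forall i j, a * F i j <= G i j <= b * F i j) ->
  a * (\sum_i \sum_j F i j) <= \sum_i \sum_j G i j <= b * (\sum_i \sum_j F i j).
Proof.
move=> H; rewrite !mulr_sumr; apply/andP; split; apply: ler_sum => i _;
  rewrite mulr_sumr; apply: ler_sum => j _; by have /andP[] := H i j.
Qed.

End Frobenius.

Section Eigenbasis.
Context {R : realType} {r : nat}.
Variables (B Q : 'M[R]_r) (d : 'rV[R]_r) (lo hi : R).
Hypotheses (Q1 : Q *m Q^T = 1%:M) (QB : Q *m B *m Q^T = diag_mx d).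
Hypotheses (lo0 : 0 < lo) (d_lo : forall i, lo <= d 0 i) (d_hi : forall i, d 0 i <= hi).

Let Q2 : Q^T *m Q = 1%:M. Proof. exact: mulmx1C. Qed.

Let d0 i : 0 < d 0 i. Proof. exact: lt_le_trans (d_lo i). Qed.

Let BE : B = Q^T *m diag_mx d *m Q.
Proof. by rewrite -QB !mulmxA Q2 mul1mx -mulmxA Q2 mulmx1. Qed.

Let BV : invmx B = Q^T *m diag_mx (\row_i (d 0 i)^-1) *m Q.
Proof.
have BK : B *m (Q^T *m diag_mx (\row_i (d 0 i)^-1) *m Q) = 1%:M.
  rewrite {1}BE !mulmxA -(mulmxA _ Q) Q1 mulmx1 -(mulmxA Q^T) mulmx_diag.
  rewrite (_ : \row__ _ = const_mx 1) ?diag_const_mx ?mulmx1//.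
  by apply/rowP => i; rewrite !mxE mulfV ?gt_eqF.
have [Bu _] := mulmx1_unit BK.
by rewrite -[LHS]mulmx1 -BK mulKmx.
Qed.

(** Rotating the columns by [Q] preserves the norms and turns [B] into a diagonal matrix, which
    scales column j by d_j. *)
Lemma fro_mul_bounds m (D : 'M[R]_(m, r)) :
  lo ^+ 2 * inner D D <= inner (D *m B) (D *m B) <= hi ^+ 2 * inner D D.
Proof.
have -> : inner D D = inner (D *m Q^T) (D *m Q^T).
  by rewrite inner_mulR trmxK -mulmxA Q2 mulmx1.
have -> : inner (D *m B) (D *m B) = inner (D *m Q^T *m diag_mx d) (D *m Q^T *m diag_mx d).
  by rewrite BE !mulmxA inner_mulR -(mulmxA _ Q) Q1 mulmx1.
move: (D *m Q^T) => D'; rewrite !innerE; apply: sum2_bounds => i j.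
rewrite mul_mx_diag mxE -!expr2 exprMn mulrC [hi ^+ 2 * _]mulrC.
have dj := d0 j; have hi0 := lt_le_trans lo0 (le_trans (d_lo j) (d_hi j)).
by apply/andP; split; rewrite ler_wpM2l ?sqr_ge0// ler_sqr ?nnegrE ?(ltW lo0) ?(ltW dj) ?(ltW hi0).
Qed.

(** In the eigenbasis this map multiplies the entry (i, j) by d_i + d_j, which lies between 2 lo and
    2 hi. The lower bound also yields the injectivity behind the uniqueness of Delta_1. *)
Lemma skew_anticomm_bounds (Om : 'M[R]_r) :
  4 * lo ^+ 2 * inner Om Om <= inner (Om *m B + B *m Om) (Om *m B + B *m Om)
     <= 4 * hi ^+ 2 * inner Om Om.
Proof.
have conj_inner (A C : 'M[R]_r) : inner (Q *m A *m Q^T) (Q *m C *m Q^T) = inner A C.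
  by rewrite inner_mulR trmxK -!mulmxA Q2 mulmx1 inner_mulL mulmxA Q2 mul1mx.
rewrite -(conj_inner Om) -(conj_inner (_ + _)).
have -> : Q *m (Om *m B + B *m Om) *m Q^T =
   (Q *m Om *m Q^T) *m diag_mx d + diag_mx d *m (Q *m Om *m Q^T).
  rewrite mulmxDr mulmxDl -QB !mulmxA; congr (_ + _).
    by rewrite -(mulmxA _ Q^T) Q2 mulmx1.
  by rewrite -(mulmxA _ Q^T Q) Q2 mulmx1.
move: (Q *m Om *m Q^T) => W; rewrite !innerE; apply: sum2_bounds => i j.
rewrite mul_mx_diag mul_diag_mx !mxE [W i j * _]mulrC -mulrDl -!expr2 exprMn.
have s0 : 0 <= W i j ^+ 2 by rewrite sqr_ge0.
have [di dj] := (d0 i, d0 j); have hi0 := lt_le_trans lo0 (le_trans (d_lo j) (d_hi j)).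
have e x : 4 * x ^+ 2 = (x + x) ^+ 2 :> R by rewrite -mulr2n exprMn_n mulr_natl.
by rewrite !e; apply/andP; split; rewrite ler_wpM2r// ler_sqr ?nnegrE ?addr_ge0 ?(ltW lo0) ?(ltW dj) ?(ltW di) ?(ltW hi0) ?lerD.
Qed.

(** In the eigenbasis the metric is the sum of the squared entries divided by d_i d_j. *)
Lemma affine_metric_bounds (S : 'M[R]_r) : S^T = S ->
  let g := \tr (invmx B *m S *m invmx B *m S) in
  lo ^+ 2 * g <= inner S S <= hi ^+ 2 * g.
Proof.
move=> sS.
have conj_inner (A C : 'M[R]_r) : inner (Q *m A *m Q^T) (Q *m C *m Q^T) = inner A C.
  by rewrite inner_mulR trmxK -!mulmxA Q2 mulmx1 inner_mulL mulmxA Q2 mul1mx.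
have sS' : (Q *m S *m Q^T)^T = Q *m S *m Q^T by rewrite !trmx_mul trmxK sS mulmxA.
have -> : \tr (invmx B *m S *m invmx B *m S) =
   inner (Q *m S *m Q^T) (diag_mx (\row_i (d 0 i)^-1) *m (Q *m S *m Q^T) *m diag_mx (\row_i (d 0 i)^-1)).
  rewrite /inner sS' BV !mulmxA -mulmxA mxtrace_mulC !mulmxA mxtrace_mulC.
  by rewrite !mulmxA.
rewrite -(conj_inner S S).
move: (Q *m S *m Q^T) sS' => W sW; rewrite !innerE; apply: sum2_bounds => i j.
rewrite mul_mx_diag mul_diag_mx !mxE.
have [di dj] := (d0 i, d0 j); have hi0 := lt_le_trans lo0 (le_trans (d_lo j) (d_hi j)).
have -> : W i j * ((d 0 i)^-1 * W i j / d 0 j) = W i j ^+ 2 / (d 0 i * d 0 j).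
  by rewrite invfM expr2 !mulrA [W i j / d 0 i * _]mulrAC.
have s0 : 0 <= W i j ^+ 2 by rewrite sqr_ge0.
have dd0 : 0 < d 0 i * d 0 j by rewrite mulr_gt0.
rewrite -expr2 ![_ ^+ 2 * (_ / _)]mulrA ![_ * W i j ^+ 2]mulrC ler_pdivrMr// ler_pdivlMr//.
by apply/andP; split; rewrite ler_wpM2l// expr2 ler_pM ?(ltW lo0) ?(ltW dj) ?(ltW di) ?(ltW hi0).
Qed.

Lemma affine_metric_eq0 (S : 'M[R]_r) : S^T = S ->
  \tr (invmx B *m S *m invmx B *m S) <= 0 -> S = 0.
Proof.
move=> sS g0; apply: inner_eq0; apply/eqP; rewrite eq_le inner_ge0 andbT.
have /andP[_ H] := affine_metric_bounds sS; apply: (le_trans H).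
by rewrite mulr_ge0_le0// sqr_ge0.
Qed.

End Eigenbasis.

(** * Singular values of U B V^T *)

Section SingularValues.
Context {R : realType} {p1 p2 r : nat}.
Variables (U : 'M[R]_(p1, r)) (B : 'M[R]_r) (V : 'M[R]_(p2, r)).
Hypotheses (U_st : stiefel U) (B_spd : spd B) (V_st : stiefel V) (r_le : (r <= p2)%N).

Lemma spd_spectral : exists (Q : 'M[R]_r) (d : 'rV[R]_r), [/\ Q *m Q^T = 1%:M,
  Q *m B *m Q^T = diag_mx d, sorted >=%R [seq d 0 i | i : 'I_r] & forall i, 0 < d 0 i].
Proof.
have [sB pB] := B_spd; have [Q [d [Q1 QB ds]]] := spectral_theorem_sorted sB.
exists Q, d; split=> // i.
have -> : d 0 i = (row i Q *m B *m (row i Q)^T) 0 0.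
  by rewrite -row_mul row_mul_tr_row QB mxE eqxx mulr1n.
apply: pB; apply/eqP => Qi0; have := row_mul_tr_row Q Q i i.
by rewrite Q1 Qi0 mul0mx !mxE eqxx => /eqP; rewrite eq_sym oner_eq0.
Qed.

(** X^T X = V B^2 V^T has the eigenvalues d_i^2, carried by the rows of Q V^T, and 0 on the
    complement of [V]. In the nonincreasing list of p2 entries the zeros come last, so position i <
    r holds d_i^2. *)
Lemma sigma_diag (Q : 'M[R]_r) (d : 'rV[R]_r) : Q *m Q^T = 1%:M ->
  Q *m B *m Q^T = diag_mx d -> sorted >=%R [seq d 0 i | i : 'I_r] ->
  (forall i, 0 < d 0 i) -> forall i : 'I_r, sigma i.+1 (U *m B *m V^T) = d 0 i.
Proof.
move=> Q1 QB /sorted_diagP ds d0 i; have [sB _] := B_spd.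
have Q2 : Q^T *m Q = 1%:M by exact: mulmx1C.
have QBr : Q *m B = diag_mx d *m Q by rewrite -QB -mulmxA Q2 mulmx1.
rewrite /sigma /=.
have -> : (U *m B *m V^T)^T *m (U *m B *m V^T) = V *m (B *m B) *m V^T.
  rewrite !trmx_mul trmxK sB !mulmxA -(mulmxA _ U^T) U_st.
  by rewrite mulmx1.
have [k e] : exists k, p2 = (r + k)%N by exists (p2 - r)%N; rewrite subnKC.
move: (V) V_st; clear V_st V r_le; rewrite e => {e} V V_st.
have [|W W1 VW] := @orthonormal_completion _ _ _ V k V_st; first by [].
have WV : W^T *m V = 0 by apply: trmx_inj; rewrite trmx_mul trmxK trmx0.
pose dd : 'rV[R]_(r + k) := row_mx (\row_j (d 0 j ^+ 2)) 0.
rewrite (@eigvals_diag _ _ _ (col_mx (Q *m V^T) W^T) dd); first last.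
- apply/sorted_diagP => a b; case: (split_ordP b) => b' ->; last first.
    rewrite /dd row_mxEr mxE => _; case: (split_ordP a) => a' ->; first by rewrite row_mxEl mxE sqr_ge0.
    by rewrite row_mxEr mxE.
  case: (split_ordP a) => a' -> /=; last by move=> h; have := leq_trans (ltn_ord b') (leq_trans (leq_addr a' r) h); rewrite ltnn.
  move=> ab; rewrite /dd !row_mxEl !mxE ler_sqr ?nnegrE ?(ltW (d0 _))//; exact: ds.
- rewrite diag_mx_row mul_col_mx mul_block_col !mul0mx addr0 add0r; congr col_mx.
    rewrite !mulmxA -(mulmxA Q) V_st mulmx1 QBr -(mulmxA _ Q) QBr mulmxA mulmx_diag.
    by congr (diag_mx _ *m _ *m _); apply/rowP => j; rewrite !mxE expr2.
  by rewrite !mulmxA WV !mul0mx linear0 mul0mx.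
- have : col_mx (Q *m V^T) W^T *m (col_mx (Q *m V^T) W^T)^T = 1%:M.
    rewrite tr_col_mx mul_col_row !trmx_mul !trmxK.
    rewrite !mulmxA -(mulmxA Q) V_st mulmx1 Q1 W1 WV mul0mx -(mulmxA Q) VW mulmx0.
    by rewrite -scalar_mx_block.
  by move=> /mulmx1_unit[].
by rewrite -[nat_of_ord i]/(nat_of_ord (lshift k i)) nth_diag /dd row_mxEl mxE sqrtr_sqr gtr0_norm.
Qed.

End SingularValues.

(** * Differential calculus *)

Section Derivatives.
Context {R : realType} {E : normedModType R}.
Implicit Types (x u v : E).

Lemma is_derive_linear (F G : normedModType R) (L : {linear F -> G}) (f : E -> F)
    x v df : continuous L -> is_derive x v f df -> is_derive x v (L \o f) (L df).
Proof.
move=> Lc [fd <-].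
have H : (fun h => h^-1 *: ((((L \o f) \o shift x) (h *: v)) - (L \o f) x)) @ 0^'
   --> L ('D_v f x).
  have -> : (fun h => h^-1 *: ((((L \o f) \o shift x) (h *: v)) - (L \o f) x)) =
     L \o (fun h => h^-1 *: ((f \o shift x) (h *: v) - f x)).
    by apply/funext => h; rewrite /= -linearB -linearZ.
  exact: (cvg_comp _ _ fd (Lc _)).
by split; [apply/cvg_ex; eexists; exact: H | apply/cvg_lim].
Qed.

Lemma is_derive_mx m n (M : E -> 'M[R]_(m, n)) x v (dM : 'M[R]_(m, n)) :
  (forall i j, is_derive x v (fun y => M y i j) (dM i j)) -> is_derive x v M dM.
Proof.
move=> H; have Md : derivable M x v by apply/derivable_mxP => i j; have [] := H i j.
split=> //; rewrite derive_mx//; apply/matrixP => i j; rewrite mxE.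
by have [_ ->] := H i j.
Qed.

Lemma is_derive_coord m n (M : E -> 'M[R]_(m, n)) x v (dM : 'M[R]_(m, n)) i j :
  is_derive x v M dM -> is_derive x v (fun y => M y i j) (dM i j).
Proof.
move=> [Md <-]; split; first by move/derivable_mxP: Md; apply.
by rewrite derive_mx// mxE.
Qed.

Lemma is_derive_sumf (F : normedModType R) (I : Type) (s : seq I)
    (f : I -> E -> F) x v (df : I -> F) :
  (forall i, is_derive x v (f i) (df i)) ->
  is_derive x v (fun y => \sum_(i <- s) f i y) (\sum_(i <- s) df i).
Proof.
move=> H; elim: s => [|i s IH].
  have -> : (fun y => \sum_(i <- [::]) f i y) = cst 0.
    by apply/funext => y; rewrite big_nil.
  by rewrite big_nil; exact: is_derive_cst.
have -> : (fun y => \sum_(i0 <- i :: s) f i0 y) =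
    f i + (fun y => \sum_(i <- s) f i y).
  by apply/funext => y; rewrite big_cons.
by rewrite big_cons; exact: is_deriveD.
Qed.

Lemma is_derive_mulmx m n p (M : E -> 'M[R]_(m, n)) (N : E -> 'M[R]_(n, p))
    x v dM dN : is_derive x v M dM -> is_derive x v N dN ->
  is_derive x v (fun y => M y *m N y) (dM *m N x + M x *m dN).
Proof.
move=> HM HN; apply: is_derive_mx => i j.
have -> : (fun y => (M y *m N y) i j) =
   (fun y => \sum_k ((fun z => M z i k) * (fun z => N z k j)) y).
  by apply/funext => y; rewrite mxE.
rewrite !mxE -big_split /=.
apply: is_derive_sumf => k.
have := is_deriveM (is_derive_coord i k HM) (is_derive_coord k j HN).
by move=> H; apply: (is_derive_eq H); rewrite addrC /GRing.scale/= [N x k j * _]mulrC.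
Qed.

Lemma is_derive_trmx m n (M : E -> 'M[R]_(m, n)) x v dM :
  is_derive x v M dM -> is_derive x v (fun y => (M y)^T) dM^T.
Proof.
move=> HM; apply: is_derive_mx => i j; rewrite mxE.
have -> : (fun y => (M y)^T i j) = (fun y => M y j i).
  by apply/funext => y; rewrite mxE.
exact: is_derive_coord.
Qed.

Lemma is_derive_unique (F : normedModType R) (f : E -> F) x v a b :
  is_derive x v f a -> is_derive x v f b -> a = b.
Proof. by move=> [_ <-] [_ <-]. Qed.

Lemma near_is_derive_eq (F : normedModType R) (f g : E -> F) x v a b :
  (\near x, f x = g x) -> is_derive x v f a -> is_derive x v g b -> a = b.
Proof. by move=> fg fa /(is_derive_unique (near_eq_is_derive fg fa)). Qed.

Lemma fst_is_cont (F G : normedModType R) : continuous (@fst F G).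
Proof. by move=> z; exact: cvg_fst. Qed.
Lemma snd_is_cont (F G : normedModType R) : continuous (@snd F G).
Proof. by move=> z; exact: cvg_snd. Qed.

Lemma is_derive_fst (F G : normedModType R) (f : E -> F * G) x v df :
  is_derive x v f df -> is_derive x v (fun y => (f y).1) df.1.
Proof. move=> H; exact: (@is_derive_linear _ _ fst _ _ _ _ (@fst_is_cont F G) H). Qed.
Lemma is_derive_snd (F G : normedModType R) (f : E -> F * G) x v df :
  is_derive x v f df -> is_derive x v (fun y => (f y).2) df.2.
Proof. move=> H; exact: (@is_derive_linear _ _ snd _ _ _ _ (@snd_is_cont F G) H). Qed.

Lemma is_derive_pair (F G : normedModType R) (f : E -> F) (g : E -> G) x v df dg :
  is_derive x v f df -> is_derive x v g dg ->
  is_derive x v (fun y => (f y, g y)) (df, dg).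
Proof.
move=> [fd <-] [gd <-].
have H : (fun h => h^-1 *: ((((fun y => (f y, g y)) \o shift x) (h *: v))
   - (f x, g x))) @ 0^' --> ('D_v f x, 'D_v g x).
  exact: (cvg_pair fd gd).
by split; [apply/cvg_ex; eexists; exact: H | apply/cvg_lim].
Qed.

Lemma differentiable_is_derive (F : normedModType R) (f : E -> F) x v :
  differentiable f x -> is_derive x v f ('D_v f x).
Proof. by move=> H; apply/derivableP; exact: diff_derivable. Qed.

Lemma derive_lin_dir (F : normedModType R) (f : E -> F) x k u v :
  differentiable f x -> 'D_(k *: u + v) f x = k *: 'D_u f x + 'D_v f x.
Proof. by move=> H; rewrite !deriveE// linearP. Qed.

Lemma derive_sum_dir (F : normedModType R) (f : E -> F) x (I : Type) (s : seq I)
   (c : I -> R) (w : I -> E) : differentiable f x ->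
  'D_(\sum_(i <- s) c i *: w i) f x = \sum_(i <- s) c i *: 'D_(w i) f x.
Proof.
move=> H; rewrite deriveE// linear_sum; apply: eq_bigr => i _.
by rewrite linearZ deriveE.
Qed.

End Derivatives.

Lemma is_derive_comp_diff {R : realType} {E F G : normedModType R} (f : E -> F)
    (g : F -> G) x v : differentiable f x -> differentiable g (f x) ->
  is_derive x v (g \o f) ('D_('D_v f x) g (f x)).
Proof.
move=> fd gd; have gfd := differentiable_comp fd gd; split.
  exact: diff_derivable.
by rewrite !deriveE// diff_comp.
Qed.

Lemma differentiable_mx {R : realType} {E : normedModType R} m n
    (M : E -> 'M[R]_(m, n)) x :
  (forall i j, differentiable (fun y => M y i j) x) <-> differentiable M x.
Proof.
split=> [H|H i j]; last first.
  by apply: (@differentiable_comp _ _ _ _ M (fun N : 'M[R]_(m, n) => N i j));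
    [|exact: differentiable_coord].
have -> : M = (fun y => \sum_(p : 'I_m * 'I_n) M y p.1 p.2 *: delta_mx p.1 p.2).
  apply/funext => y; rewrite [LHS]matrix_sum_delta.
  by rewrite pair_bigA.
elim: (index_enum _) => [|p s IH].
  have -> : (fun y => \sum_(p <- [::]) M y p.1 p.2 *: delta_mx p.1 p.2) =
     cst (0 : 'M[R]_(m,n)) by apply/funext => y; rewrite big_nil.
  exact: differentiable_cst.
have -> : (fun y => \sum_(q <- p :: s) M y q.1 q.2 *: delta_mx q.1 q.2) =
   (fun y => M y p.1 p.2 *: (delta_mx p.1 p.2 : 'M[R]_(m,n))) +
   (fun y => \sum_(q <- s) M y q.1 q.2 *: delta_mx q.1 q.2).
  by apply/funext => y; rewrite big_cons.
by apply: differentiableD => //; apply: differentiableZl.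
Qed.

(** * Maps of class C^k on an open set *)

Section Ck.
Context {R : realType} {E : normedModType R}.

(* The quantifier over directions is outside, unlike in [C2_at]: closure under products and
   inverses is then a plain induction on k. *)
Fixpoint Ck_on (F : normedModType R) (k : nat) (A : set E) (f : E -> F) : Prop :=
  if k is k'.+1 then
    (forall y, A y -> differentiable f y) /\ forall u, Ck_on k' A ('D_u f)
  else forall y, A y -> {for y, continuous f}.

Variable A : set E.
Hypothesis Ao : open A.

Lemma near_open_eq (F : Type) (f g : E -> F) x : (forall y, A y -> f y = g y) -> A x ->
  \near x, f x = g x.
Proof. by move=> fg Ax; near=> y; apply: fg; near: y; exact: open_nbhs_nbhs. Unshelve. all: by end_near. Qed.

(** The first-order expansion of [f] at x is also one of [g], with the same remainder; uniqueness of
    the linear part identifies it with the differential of [g]. *)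
Lemma differentiable_near (F : normedModType R) (f g : E -> F) x :
  (\near x, f x = g x) -> differentiable f x -> differentiable g x.
Proof.
move=> fg /diff_locallyP[fc fd].
have fx : f x = g x by exact: (nbhs_singleton fg).
have fg0 : \forall z \near 0, f (z + x) = g (z + x).
  by move: fg; rewrite (near_shift 0)/= subr0.
have gd : g \o shift x = cst (g x) + 'd f x +o_ 0 id.
  apply/eqaddoP => e e0; move/eqaddoP: fd => /(_ e e0); rewrite -fx.
  apply: filter_app; near=> z; rewrite !fctE /=.
  by have -> : f (z + x) = g (z + x) by near: z.
have dE := diff_unique fc gd.
by apply/diff_locallyP; rewrite dE.
Unshelve. all: by end_near. Qed.

(** Since [A] is open, equality on [A] is equality of germs at each of its points, so derivatives
    agree on [A] too. This is how a derivative gets replaced by its computed formula in the closure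
    lemmas. *)
Lemma Ck_on_eq (F : normedModType R) k (f g : E -> F) :
  (forall y, A y -> f y = g y) -> Ck_on k A f -> Ck_on k A g.
Proof.
elim: k f g => [|k IH] f g fg /=.
  move=> fc y Ay; have H : f @ y --> f y := fc y Ay.
  change (g @ y --> g y); rewrite -(fg y Ay).
  by apply: cvg_trans H; apply: near_eq_cvg; exact: near_open_eq.
move=> [fd fD]; split.
  by move=> y Ay; apply: differentiable_near (fd y Ay); exact: near_open_eq.
move=> u; apply: IH (fD u) => y Ay; apply: near_eq_derive.
exact: near_open_eq.
Qed.

Lemma Ck_onS (F : normedModType R) k (f : E -> F) : Ck_on k.+1 A f -> Ck_on k A f.
Proof.
elim: k f => [|k IH] f /= [fd fD].
  by move=> y Ay; apply: differentiable_continuous; exact: fd.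
by split=> // u; apply: IH; split; [exact: (fD u).1| exact: (fD u).2].
Qed.

Lemma Ck_on_cst (F : normedModType R) k (a : F) : Ck_on k A (cst a).
Proof.
elim: k a => [|k IH] a /=; first by move=> y _; exact: cst_continuous.
split=> [y _|u]; first exact: differentiable_cst.
have -> : 'D_u (cst a) = cst (0 : F) by apply/funext => y; rewrite derive_cst.
exact: IH.
Qed.

Lemma Ck_onD (F : normedModType R) k (f g : E -> F) :
  Ck_on k A f -> Ck_on k A g -> Ck_on k A (f + g).
Proof.
elim: k f g => [|k IH] f g /=.
  by move=> fc gc y Ay; apply: cvgD; [exact: fc|exact: gc].
move=> [fd fD] [gd gD]; split=> [y Ay|u].
  by apply: differentiableD; [exact: fd|exact: gd].
apply: Ck_on_eq (IH _ _ (fD u) (gD u)) => y Ay.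
by rewrite fctE deriveD//; apply: diff_derivable; [exact: fd|exact: gd].
Qed.

Lemma Ck_onM k (f g : E -> R) :
  Ck_on k A f -> Ck_on k A g -> Ck_on k A (fun y => f y * g y).
Proof.
elim: k f g => [|k IH] f g.
  by move=> /= fc gc y Ay; apply: cvgM; [exact: fc|exact: gc].
move=> fC gC; have [fd fD] := fC; have [gd gD] := gC; split=> [y Ay|u].
  by apply: differentiableM; [exact: fd|exact: gd].
apply: Ck_on_eq (Ck_onD (IH _ _ (Ck_onS fC) (gD u)) (IH _ _ (Ck_onS gC) (fD u))).
move=> y Ay /=.
by rewrite fctE (@deriveM _ _ f g)//; apply: diff_derivable; [exact: fd|exact: gd].
Qed.

Lemma Ck_onV k (f : E -> R) : (forall y, A y -> f y != 0) ->
  Ck_on k A f -> Ck_on k A (fun y => (f y)^-1).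
Proof.
move=> f0; elim: k f f0 => [|k IH] f f0.
  by move=> /= fc y Ay; apply: cvgV; [exact: f0|exact: fc].
move=> fC; have [fd fD] := fC; split=> [y Ay|u].
  by apply: differentiableV; [exact: fd|exact: f0].
have H := IH _ f0 (Ck_onS fC).
apply: Ck_on_eq (Ck_onM (Ck_on_cst k (-1 : R)) (Ck_onM (Ck_onM H H) (fD u))).
move=> y Ay /=; rewrite deriveV//; [|exact: f0|by apply: diff_derivable; exact: fd].
by rewrite /GRing.scale/= expr2 invfM mulN1r mulNr.
Qed.

Lemma Ck_on_sum (F : normedModType R) k I (s : seq I) (f : I -> E -> F) :
  (forall i, Ck_on k A (f i)) -> Ck_on k A (fun y => \sum_(i <- s) f i y).
Proof.
move=> H; elim: s => [|i s IH].
  by apply: Ck_on_eq (Ck_on_cst k (0 : F)) => y _; rewrite big_nil.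
by apply: Ck_on_eq (Ck_onD (H i) IH) => y _; rewrite big_cons.
Qed.

Lemma Ck_on_prod k I (s : seq I) (f : I -> E -> R) :
  (forall i, Ck_on k A (f i)) -> Ck_on k A (fun y => \prod_(i <- s) f i y).
Proof.
move=> H; elim: s => [|i s IH].
  by apply: Ck_on_eq (Ck_on_cst k (1 : R)) => y _; rewrite big_nil.
by apply: Ck_on_eq (Ck_onM (H i) IH) => y _; rewrite big_cons.
Qed.

Lemma continuous_mx_at m n (M : E -> 'M[R]_(m, n)) x :
  (forall i j, {for x, continuous (fun y => M y i j)}) <-> {for x, continuous M}.
Proof.
split=> H; last first.
  by move=> i j; exact: (@continuous_comp _ _ _ M (fun N : 'M[R]_(m, n) => N i j) x H (@coord_continuous _ _ _ i j _)).
apply/cvgrPdist_le => /= e e0; near=> y.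
rewrite /Num.Def.normr/= mx_normrE (bigmax_le _ (ltW e0))//= => -[i j] _.
rewrite !mxE/=; move: i j; near: y.
apply: filter_forall => i; apply: filter_forall => j.
by have /cvgrPdist_le/(_ _ e0) := H i j.
Unshelve. all: by end_near. Qed.

Lemma Ck_on_mx k m n (M : E -> 'M[R]_(m, n)) :
  (forall i j, Ck_on k A (fun y => M y i j)) <-> Ck_on k A M.
Proof.
elim: k M => [|k IH] M.
  split=> [H y Ay|H i j y Ay]; first by apply/continuous_mx_at => i j; exact: H.
  by move: i j; apply/continuous_mx_at; exact: H.
split=> [H|[Md MD] i j]; last first.
  split=> [y Ay|u]; first by move: i j; apply/differentiable_mx; exact: Md.
  have := (IH _).2 (MD u) i j; apply: Ck_on_eq => y Ay.
  by rewrite derive_mx ?mxE//; apply: diff_derivable; exact: Md.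
have Md : forall y, A y -> differentiable M y.
  by move=> y Ay; apply/differentiable_mx => i j; exact: (H i j).1.
split=> // u; apply/IH => i j; have := (H i j).2 u; apply: Ck_on_eq => y Ay.
by rewrite derive_mx ?mxE//; apply: diff_derivable; exact: Md.
Qed.

Lemma Ck_on_pair (F G : normedModType R) k (f : E -> F) (g : E -> G) :
  Ck_on k A f -> Ck_on k A g -> Ck_on k A (fun y => (f y, g y)).
Proof.
elim: k f g => [|k IH] f g /=.
  by move=> fc gc y Ay; apply: cvg_pair; [exact: fc|exact: gc].
move=> [fd fD] [gd gD]; split=> [y Ay|u].
  by apply: differentiable_pair; [exact: fd|exact: gd].
apply: Ck_on_eq (IH _ _ (fD u) (gD u)) => y Ay.
have H := is_derive_pair (differentiable_is_derive u (fd y Ay))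
  (differentiable_is_derive u (gd y Ay)).
by have [_ ->] := H.
Qed.

Lemma Ck_on_linear (F G : normedModType R) k (L : {linear F -> G}) (f : E -> F) :
  continuous L -> Ck_on k A f -> Ck_on k A (L \o f).
Proof.
move=> Lc; elim: k f => [|k IH] f /=.
  by move=> fc y Ay; apply: continuous_comp; [exact: fc|exact: Lc].
move=> [fd fD]; split=> [y Ay|u].
  by apply: differentiable_comp; [exact: fd|exact: linear_differentiable].
apply: Ck_on_eq (IH _ (fD u)) => y Ay.
by have [_ ->] := is_derive_linear Lc (differentiable_is_derive u (fd y Ay)).
Qed.

Lemma Ck_on_id k : Ck_on k A (fun y : E => y).
Proof.
case: k => [|k] /=; first by move=> y _; exact: cvg_id.
split=> [y _|u]; first by apply: (@linear_differentiable R E E idfun) => z; exact: cvg_id.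
by apply: Ck_on_eq (Ck_on_cst k u) => y _; rewrite /= [RHS]derive_id.
Qed.

Lemma Ck_on_mulmx k m n p (M : E -> 'M[R]_(m, n)) (N : E -> 'M[R]_(n, p)) :
  Ck_on k A M -> Ck_on k A N -> Ck_on k A (fun y => M y *m N y).
Proof.
move=> /Ck_on_mx HM /Ck_on_mx HN; apply/Ck_on_mx => i j.
apply: (@Ck_on_eq _ _ (fun y => \sum_l M y i l * N y l j)).
  by move=> y _; rewrite mxE.
by apply: Ck_on_sum => l; apply: Ck_onM.
Qed.

Lemma Ck_on_trmx k m n (M : E -> 'M[R]_(m, n)) :
  Ck_on k A M -> Ck_on k A (fun y => (M y)^T).
Proof.
move=> /Ck_on_mx HM; apply/Ck_on_mx => i j.
by apply: Ck_on_eq (HM j i) => y _; rewrite mxE.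
Qed.

Lemma Ck_on_det k n (M : E -> 'M[R]_n) :
  Ck_on k A M -> Ck_on k A (fun y => \det (M y)).
Proof.
move=> /Ck_on_mx HM; apply: Ck_on_sum => s; apply: Ck_onM.
  exact: (Ck_on_cst k).
by apply: Ck_on_prod => i.
Qed.

(** Cramer's rule reduces the inverse to determinants and one scalar inverse. *)
Lemma Ck_on_invmx k n (M : E -> 'M[R]_n) : (forall y, A y -> M y \in unitmx) ->
  Ck_on k A M -> Ck_on k A (fun y => invmx (M y)).
Proof.
move=> Mu HM; apply/Ck_on_mx => i j.
apply: (@Ck_on_eq _ _ (fun y => (\det (M y))^-1 * cofactor (M y) j i)).
  by move=> y Ay; rewrite /invmx Mu// !mxE.
apply: Ck_onM.
  apply: Ck_onV; last exact: Ck_on_det.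
  by move=> y Ay; have := Mu y Ay; rewrite unitmxE unitfE.
apply: Ck_onM; first exact: (Ck_on_cst k).
apply: Ck_on_det; apply/Ck_on_mx => a b.
by move/Ck_on_mx: HM => /(_ (lift j a) (lift i b)); apply: Ck_on_eq => y _; rewrite !mxE.
Qed.

End Ck.

Lemma C2_at_Ck_on {R : realType} {E F : normedModType R} (f : E -> F) x :
  C2_at f x -> exists A, [/\ open A, A x & Ck_on 2 A f].
Proof.
move=> fC.
have [N xN NP] : exists2 N, nbhs x N & forall y, N y ->
    [/\ differentiable f y, forall u, differentiable (fun z => 'D_u f z) y
      & forall u v, {for y, continuous (fun z => 'D_v (fun w => 'D_u f w) z)}].
  by eexists; first exact: fC.
exists (interior N); split; [exact: open_interior|exact: xN|].
have NS y : interior N y -> N y := @interior_subset _ N y.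
by split=> [y /NS/NP[]//|u]; split=> [y /NS/NP[_ H _]|v y /NS/NP[_ _ H]]; exact: H.
Qed.

Lemma Ck_on_C2_at {R : realType} {E F : normedModType R} (A : set E) (f : E -> F) x :
  open A -> A x -> Ck_on 2 A f -> C2_at f x.
Proof.
move=> Ao Ax [fd fD]; near=> y.
have Ay : A y by near: y; exact: open_nbhs_nbhs.
by split=> [|u|u v]; [exact: fd| exact: (fD u).1| exact: ((fD u).2 v)].
Unshelve. all: by end_near. Qed.

(** * Symmetry of second derivatives *)

Section Schwarz.
Context {R : realType} {E : normedModType R}.

Lemma differentiable_affine_line (a u : E) s : differentiable (fun t : R => a + t *: u) s.
Proof.
apply: differentiableD; first exact: differentiable_cst.
by apply: differentiableZl; apply: (@linear_differentiable R R R idfun) => z; exact: cvg_id.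
Qed.

Lemma is_derive_scalel (u : E) s : is_derive s (1 : R) (fun t : R => t *: u) u.
Proof.
have d : differentiable (fun t : R => t *: u) s.
  by apply: differentiableZl; apply: (@linear_differentiable R R R idfun) => z; exact: cvg_id.
by split; [exact: diff_derivable|rewrite deriveE// diff_val /= scale1r].
Qed.

Lemma is_derive_affine_line (F : normedModType R) (g : E -> F) a u s :
  differentiable g (a + s *: u) ->
  is_derive s (1 : R) (fun t => g (a + t *: u)) ('D_u g (a + s *: u)).
Proof.
move=> gd; have := is_derive_comp_diff (1 : R) (differentiable_affine_line a u s) gd.
suff -> : 'D_1 (fun t : R => a + t *: u) s = u by [].
have := is_deriveD (is_derive_cst a s (1 : R)) (is_derive_scalel u s).
by rewrite add0r => -[_ H]; exact: H.
Qed.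

Lemma MVT_line (g : E -> R) a u t : 0 < t ->
  (forall s, 0 <= s <= t -> differentiable g (a + s *: u)) ->
  exists2 c, 0 <= c <= t & g (a + t *: u) - g a = 'D_u g (a + c *: u) * t.
Proof.
move=> t0 gd.
have gD s : s \in `[0, t] -> is_derive s 1 (fun s => g (a + s *: u)) ('D_u g (a + s *: u)).
  by rewrite in_itv /= => st; apply: is_derive_affine_line; exact: gd.
have [c] := MVT_segment (ltW t0) (fun s st => gD s (subset_itv_oo_cc st))
  (derivable_within_continuous (fun s st => @ex_derive _ _ _ _ _ _ _ (gD s st))).
by rewrite in_itv /= => ct; rewrite scale0r addr0 subr0; exists c.
Qed.

(* Two applications of the mean value theorem; exchanging the roles of u and v yields the
   symmetry of the second derivatives. *)
Lemma second_difference (f : E -> R) (x : E) (u v : E) (N : set E) e : 0 < e ->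
  (forall y, `|x - y| < e -> N y) ->
  (forall y, N y -> differentiable f y /\ differentiable ('D_u f) y) ->
  forall t, 0 < t -> t * (`|u| + `|v|) < e ->
  exists2 y, N y & f (x + t *: u + t *: v) - f (x + t *: u) - f (x + t *: v) + f x =
     'D_v ('D_u f) y * t * t.
Proof.
move=> e0 eN fd t t0 te.
have in_N s s' : 0 <= s <= t -> 0 <= s' <= t -> N (x + s *: u + s' *: v).
  move=> /andP[s0 st] /andP[s0' st']; apply: eN.
  rewrite -addrA opprD addrA subrr add0r normrN.
  apply: le_lt_trans te; rewrite mulrDr.
  by apply: le_trans (ler_normD _ _) _; rewrite !normrZ !ger0_norm// lerD// ler_wpM2r.
pose g y := f (y + t *: v) - f y.
have t00 : 0 <= t <= t by rewrite lexx ltW.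
have z00 : 0 <= (0:R) <= t by rewrite lexx ltW.
have gd s : 0 <= s <= t -> differentiable g (x + s *: u) /\
   'D_u g (x + s *: u) = 'D_u f (x + s *: u + t *: v) - 'D_u f (x + s *: u).
  move=> st.
  have h1 : differentiable f (x + s *: u).
    by have [] := fd _ (in_N s 0 st z00); rewrite scale0r addr0.
  have h2 : differentiable (fun y => f (y + t *: v)) (x + s *: u) /\ 'D_u (fun y => f (y + t *: v)) (x + s *: u) = 'D_u f (x + s *: u + t *: v).
    have h3 : differentiable f (x + s *: u + t *: v) by have [] := fd _ (in_N s t st t00).
    have h4 : differentiable (fun y : E => y + t *: v) (x + s *: u).
      apply: differentiableD; last exact: differentiable_cst.
      by apply: (@linear_differentiable R E E idfun) => z; exact: cvg_id.
    split; first exact: differentiable_comp h4 h3.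
    have [_ ->] := is_derive_comp_diff u h4 h3.
    congr ('D_ _ f _).
    have := is_deriveD (is_derive_id (x + s *: u) u) (is_derive_cst (t *: v) (x + s *: u) u).
    by rewrite addr0 => -[_ H]; exact: H.
  have [h5 h6] := h2; split; first exact: differentiableB h5 h1.
  have := is_deriveB (differentiable_is_derive u h5) (differentiable_is_derive u h1).
  by rewrite h6 => -[_ H]; exact: H.
have [c ct] := MVT_line t0 (fun s st => (gd s st).1).
rewrite (gd c ct).2.
have [d dt] := @MVT_line ('D_u f) (x + c *: u) v t t0 (fun s' st' => (fd _ (in_N c s' ct st')).2).
move=> -> H; exists (x + c *: u + d *: v); first exact: in_N.
by rewrite -H /g opprB [f x - _]addrC addrA.
Qed.

Lemma derive2_sym (f : E -> R) (A : set E) x u v : open A -> A x -> Ck_on 2 A f ->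
  'D_u ('D_v f) x = 'D_v ('D_u f) x.
Proof.
move=> Ao Ax [fd fD]; apply/eqP; rewrite -subr_eq0 -normr_le0.
apply/ler_addgt0Pr => e e0; rewrite add0r.
have c1 : {for x, continuous ('D_u ('D_v f))} by apply: (fD v).2.
have c2 : {for x, continuous ('D_v ('D_u f))} by apply: (fD u).2.
have e20 : 0 < e / 2 by rewrite divr_gt0.
have H : \forall y \near x, [/\ A y, `|'D_u ('D_v f) x - 'D_u ('D_v f) y| <= e / 2
     & `|'D_v ('D_u f) x - 'D_v ('D_u f) y| <= e / 2].
  have H1 : \forall y \near x, A y by exact: open_nbhs_nbhs.
  have /cvgrPdist_le/(_ _ e20) H2 := c1.
  have /cvgrPdist_le/(_ _ e20) H3 := c2.
  exact: (filterS3 _ (fun y a b c => And3 a b c) H1 H2 H3).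
have /nbhs_normP[d /= d0 dN] := H.
have [t t0 td] : exists2 t : R, 0 < t & t * (`|u| + `|v|) < d.
  (* The added 1 keeps the denominator positive when u and v both vanish. *)
  have k0 : 0 < `|u| + `|v| + 1 by rewrite ltr_wpDl// addr_ge0.
  have t0 : 0 < d / 2 / (`|u| + `|v| + 1) by rewrite !divr_gt0.
  exists (d / 2 / (`|u| + `|v| + 1)) => //.
  apply: (@lt_le_trans _ _ (d / 2 / (`|u| + `|v| + 1) * (`|u| + `|v| + 1))).
    by rewrite ltr_pM2l// ltrDl.
  by rewrite divfK ?gt_eqF// ler_pdivrMr// ler_peMr ?ler1n// ltW.
have td' : t * (`|v| + `|u|) < d by rewrite addrC.
have [y1 [Ay1 _ ny1] E1] := second_difference d0 dN (fun y yN =>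
  let: And3 Ay _ _ := yN in conj (fd y Ay) ((fD u).1 y Ay)) t0 td.
have [y2 [Ay2 ny2 _] E2] := second_difference d0 dN (fun y yN =>
  let: And3 Ay _ _ := yN in conj (fd y Ay) ((fD v).1 y Ay)) t0 td'.
have t2 : t * t != 0 by rewrite mulf_neq0 ?gt_eqF.
(* Both are one and the same second difference divided by t^2; by continuity each lies within e / 2
   of its value at x. *)
have E3 : 'D_v ('D_u f) y1 = 'D_u ('D_v f) y2.
  have E4 : x + t *: v + t *: u = x + t *: u + t *: v by rewrite addrAC.
  rewrite E4 in E2; apply: (mulIf t2).
  transitivity ('D_v ('D_u f) y1 * t * t); first exact: mulrA.
  transitivity ('D_u ('D_v f) y2 * t * t); last exact/esym/mulrA.
  apply: (etrans (esym E1)); apply: etrans E2; congr (_ + _).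
  exact: addrAC.
rewrite (_ : _ - _ = ('D_u ('D_v f) x - 'D_u ('D_v f) y2)
   - ('D_v ('D_u f) x - 'D_v ('D_u f) y1)); last first.
  by rewrite E3 opprB addrA addrNK.
by rewrite [e]splitr; apply: (le_trans (ler_normB _ _)); exact: (lerD ny2 ny1).
Qed.
End Schwarz.

Section ChainRule.
Context {R : realType} {E : normedModType R} {m n : nat}.
Implicit Types (f : 'M[R]_(m, n) -> R) (phi : E -> 'M[R]_(m, n)).

Lemma derive_dir_delta f X eta : differentiable f X ->
  'D_eta f X = \sum_(p : 'I_m * 'I_n) eta p.1 p.2 * 'D_(delta_mx p.1 p.2) f X.
Proof.
move=> fd; rewrite {1}(matrix_sum_delta eta) pair_bigA /=.
by rewrite derive_sum_dir.
Qed.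

(** The direction ['D_v phi y] moves with y, so the derivative of [f] along it is first expanded
    over the fixed directions [delta_mx], where the product rule applies; the two resulting sums are
    then folded back. *)
Lemma derive2_comp f phi (A : set E) x u v : C2 f -> open A -> A x ->
    Ck_on 2 A phi ->
  is_derive x u ('D_v (f \o phi))
    ('D_('D_u phi x) ('D_('D_v phi x) f) (phi x) + 'D_('D_u ('D_v phi) x) f (phi x)).
Proof.
move=> fC Ao Ax [pd pD].
have fd X : differentiable f X by have /nbhs_singleton[] := fC X.
have fd2 X w : differentiable ('D_w f) X by have /nbhs_singleton[] := fC X.
pose G p : 'M[R]_(m, n) -> R := 'D_(delta_mx p.1 p.2) f.
have near_eq : \near x, \sum_(p : 'I_m * 'I_n) ('D_v phi x) p.1 p.2 * G p (phi x) = 'D_v (f \o phi) x.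
  near=> y; have Ay : A y by near: y; exact: open_nbhs_nbhs.
  have [_ ->] := is_derive_comp_diff v (pd y Ay) (fd (phi y)).
  by rewrite derive_dir_delta.
apply: near_eq_is_derive near_eq _.
have D1 p : is_derive x u (fun y => ('D_v phi y) p.1 p.2 * G p (phi y))
   (('D_v phi x) p.1 p.2 * 'D_('D_u phi x) (G p) (phi x) + 'D_u ('D_v phi) x p.1 p.2 * G p (phi x)).
  have h1 := is_derive_coord p.1 p.2 (differentiable_is_derive u ((pD v).1 x Ax)).
  have h2 := is_derive_comp_diff u (pd x Ax) (fd2 (phi x) (delta_mx p.1 p.2)).
  have h3 := is_deriveM h1 h2.
  by apply: (is_derive_eq h3); congr (_ + _); exact: mulrC.
have D2 := is_derive_sumf (index_enum _) D1.
apply: (is_derive_eq D2); rewrite big_split /=; congr (_ + _); last first.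
  by rewrite [RHS]derive_dir_delta.
have E3 : 'D_('D_v phi x) f = fun X => \sum_(p : 'I_m * 'I_n) ('D_v phi x) p.1 p.2 *: G p X.
  by apply/funext => X; rewrite derive_dir_delta.
rewrite E3; apply/esym.
have D4 p : is_derive (phi x) ('D_u phi x) (fun X => ('D_v phi x) p.1 p.2 *: G p X)
   (('D_v phi x) p.1 p.2 *: 'D_('D_u phi x) (G p) (phi x)).
  have h2 := differentiable_is_derive ('D_u phi x) (fd2 (phi x) (delta_mx p.1 p.2)).
  exact: is_deriveZ.
by have [_ ->] := is_derive_sumf (index_enum _) D4.
Unshelve. all: by end_near. Qed.

End ChainRule.

(** * Vertical, horizontal and tangent spaces *)

Section Cayley.
Context {R : realType}.

(** The Cayley transform sends skew matrices to orthogonal ones, as the exponential does; being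
    rational, it inherits its regularity from [invmx]. *)
Definition cayley n (A : 'M[R]_n) : 'M[R]_n := invmx (1%:M - A) *m (1%:M + A).

(** If x = x A then |x|^2 = x A x^T, which is 0 because [A] is skew. *)
Lemma skew_unit n (A : 'M[R]_n) : A^T = - A -> 1%:M - A \in unitmx.
Proof.
move=> sA; rewrite -row_free_unit -kermx_eq0; apply/negPn/negP.
move=> /rowV0Pn[x /sub_kermxP]; rewrite mulmxBr mulmx1 => /eqP.
rewrite subr_eq0 => /eqP xA; apply/negP; rewrite negbK; apply/eqP.
apply: mulmx_tr_eq0; apply/eqP; rewrite {1}xA.
have : (x *m A *m x^T)^T = - (x *m A *m x^T).
  by rewrite !trmx_mul trmxK sA mulNmx mulmxN mulmxA.
move/matrixP/(_ 0 0); rewrite mxE [RHS]mxE => /eqP.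
by rewrite -addr_eq0 -mulr2n mulrn_eq0.
Qed.

Lemma cayley_mul n (A : 'M[R]_n) : A^T = - A -> (1%:M - A) *m cayley A = 1%:M + A.
Proof. by move=> sA; rewrite /cayley mulKVmx// skew_unit. Qed.

Lemma cayley0 n : cayley (0 : 'M[R]_n) = 1%:M.
Proof. by rewrite /cayley subr0 addr0 mulmx1 invmx1. Qed.

Lemma cayley_orthogonal n (A : 'M[R]_n) : A^T = - A -> (cayley A)^T *m cayley A = 1%:M.
Proof.
move=> sA; have u1 := skew_unit sA.
have u2 : 1%:M + A \in unitmx.
  by rewrite -[A]opprK; apply: skew_unit; rewrite linearN /= sA.
have -> : (cayley A)^T = (1%:M - A) *m invmx (1%:M + A).
  by rewrite /cayley trmx_mul trmx_inv [X in X *m _]linearD [X in invmx X]linearB /= trmx1 sA opprK.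
rewrite /cayley.
have c : (1%:M + A) *m (1%:M - A) = (1%:M - A) *m (1%:M + A).
  by rewrite mulmxBr mulmxBl mulmx1 mul1mx mulmxDl mulmxDr mul1mx mulmx1.
have -> : invmx (1%:M - A) *m (1%:M + A) = (1%:M + A) *m invmx (1%:M - A).
  by rewrite -[LHS](mulmxK u1) -(mulmxA (invmx _)) c mulKmx.
by rewrite mulmxA mulmxKV// mulmxV.
Qed.

Context {E : normedModType R}.

Lemma Ck_on_cayley (D : set E) k n (M : E -> 'M[R]_n) : open D ->
  (forall y, (M y)^T = - M y) -> Ck_on k D M -> Ck_on k D (fun y => cayley (M y)).
Proof.
move=> Do sM MC.
have one : Ck_on k D (fun _ : E => 1%:M : 'M[R]_n) by exact: Ck_on_cst.
apply: Ck_on_mulmx => //; last exact: Ck_onD.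
apply: Ck_on_invmx => // [y _|]; first exact: skew_unit.
have H := Ck_on_mulmx Do (Ck_on_cst D k (- 1%:M : 'M[R]_n)) MC.
apply: Ck_on_eq (Ck_onD Do one H) => // y _.
by rewrite fctE /cst mulNmx mul1mx.
Qed.

(** Differentiating (1 - M) cayley(M) = 1 + M at a point where M = 0 gives C' - dM = dM. The
    resulting factor 2 is why the curves built below start from half of the wanted velocity. *)
Lemma is_derive_cayley n (M : E -> 'M[R]_n) x v dM : (forall y, (M y)^T = - M y) ->
  M x = 0 -> differentiable (fun y => cayley (M y)) x -> is_derive x v M dM ->
  is_derive x v (fun y => cayley (M y)) (2 *: dM).
Proof.
move=> sM M0 Cd Md; have Cd' := differentiable_is_derive v Cd.
apply: (is_derive_eq Cd').
have one := is_derive_cst (1%:M : 'M[R]_n) x v.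
have h1 := is_derive_mulmx (is_deriveB one Md) Cd'.
have h2 := is_deriveD one Md.
have E12 : (fun y => (cst 1%:M - M) y *m cayley (M y)) = cst 1%:M + M.
  by apply/funext => y; rewrite !fctE cayley_mul.
rewrite E12 in h1; have := is_derive_unique h1 h2.
rewrite !fctE M0 cayley0 subr0 mul1mx mulmx1 sub0r add0r => /eqP.
by rewrite addrC subr_eq -mulr2n -scaler_nat => /eqP.
Qed.

End Cayley.

Section Geometry.
Context {R : realType} {p1 p2 r : nat}.
Hypotheses (rp1 : (r <= p1)%N) (rp2 : (r <= p2)%N).
Implicit Types (U : 'M[R]_(p1, r)) (B A : 'M[R]_r) (V : 'M[R]_(p2, r)).
Implicit Types (P theta eta : triple R p1 p2 r).

(* Velocity at P of the curve of the fiber with velocity A, skew, in the orthogonal group. *)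
Definition vert P A : triple R p1 p2 r :=
  (P.1.1 *m A, P.1.2 *m A - A *m P.1.2, P.2 *m A).

Definition tangent_total P eta : Prop :=
  [/\ (P.1.1^T *m eta.1.1)^T = - (P.1.1^T *m eta.1.1), eta.1.2^T = eta.1.2
    & (P.2^T *m eta.2)^T = - (P.2^T *m eta.2)].

(** The parameters can be read off theta: Omega is U^T theta_U, and D1, D2 are the components along
    the complements. The equations left over do not mention [perp]. *)
Lemma horizontalP P theta : total_space P -> horizontal P theta <->
  [/\ theta.1.2^T = theta.1.2, (P.1.1^T *m theta.1.1)^T = - (P.1.1^T *m theta.1.1)
    & P.2^T *m theta.2 = - (P.1.1^T *m theta.1.1)].
Proof.
move: P theta => [[U B] V] [[tU tB] tV] [/= U1 pB V1].
have [_ UW] := perp_spec U1 rp1; have [_ VW] := perp_spec V1 rp2.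
split=> [[D1 [D2 [Om /= [sO sB -> ->]]]]|/= [sB sO VO]].
  split=> //; rewrite ?mulmxDr ?mulmxBr !mulmxA UW ?VW U1 ?V1 !mul0mx !mul1mx add0r //.
  by rewrite mulmxN mulmxA V1 mul1mx add0r.
exists ((perp U)^T *m tU), ((perp V)^T *m tV), (U^T *m tU); split=> //=.
  rewrite mulmxA -[perp U *m _]/(proj_perp U) proj_perpE// mulmxBl mul1mx.
  by rewrite mulmxA addrNK.
rewrite mulmxA -[perp V *m _]/(proj_perp V) proj_perpE// mulmxBl mul1mx.
by rewrite -[U^T *m tU]opprK -VO mulmxN opprK mulmxA addrNK.
Qed.

Lemma is_derive_triple (E : normedModType R) (psi : E -> triple R p1 p2 r) x v eta :
  is_derive x v psi eta ->
  [/\ is_derive x v (fun y => (psi y).1.1) eta.1.1, is_derive x v (fun y => (psi y).1.2) eta.1.2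
    & is_derive x v (fun y => (psi y).2) eta.2].
Proof.
move=> H; split; last exact: is_derive_snd.
  exact/is_derive_fst/is_derive_fst.
exact/is_derive_snd/is_derive_fst.
Qed.

(** One inclusion differentiates a curve of the fiber; the other uses the curve of orthogonal
    matrices cayley(t A / 2), whose velocity at 0 is [A]. *)
Lemma verticalP P theta : stiefel P.1.1 -> vertical P theta <->
  exists2 A, A^T = - A & theta = vert P A.
Proof.
move: P theta => [[U B] V] [[tU tB] tV] /= U1; split.
  move=> [gamma [g0 gO /is_derive_triple[/= d1 d2 d3]]].
  (* The definition of the fiber gives some orthogonal matrix for each t, with no regularity in t;
     U^T U = 1 recovers it from the curve itself, hence as a differentiable function. *)
  pose o t := U^T *m (gamma t).1.1; pose A := U^T *m tU.
  have o0 : o 0 = 1%:M by rewrite /o g0.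
  have gE : \forall t \near (0 : R), [/\ (o t)^T *m o t = 1%:M,
      U *m o t = (gamma t).1.1, (o t)^T *m (B *m o t) = (gamma t).1.2 & V *m o t = (gamma t).2].
    move: gO; apply: filterS => t [Q O1 gQ].
    have -> : o t = Q by rewrite /o -gQ /= mulmxA U1 mul1mx.
    by rewrite -gQ /= mulmxA.
  have od : is_derive (0 : R) (1 : R) o A.
    have := is_derive_mulmx (is_derive_cst U^T (0 : R) (1 : R)) d1.
    by rewrite mul0mx add0r.
  have Cd m n (C : 'M[R]_(m, n)) (D : 'M[R]_(n, r)) f : is_derive (0 : R) (1 : R) f D ->
      is_derive (0 : R) (1 : R) (fun t => C *m f t) (C *m D).
    by move=> /(is_derive_mulmx (is_derive_cst C (0 : R) (1 : R))); rewrite mul0mx add0r.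
  have n1 : \forall t \near (0 : R), (o t)^T *m o t = cst 1%:M t by move: gE; apply: filterS => t [].
  have n2 : \forall t \near (0 : R), U *m o t = (gamma t).1.1 by move: gE; apply: filterS => t [].
  have n3 : \forall t \near (0 : R), (o t)^T *m (B *m o t) = (gamma t).1.2 by move: gE; apply: filterS => t [].
  have n4 : \forall t \near (0 : R), V *m o t = (gamma t).2 by move: gE; apply: filterS => t [].
  exists A.
    have := near_is_derive_eq n1 (is_derive_mulmx (is_derive_trmx od) od) (is_derive_cst _ _ _).
    by rewrite o0 trmx1 mulmx1 mul1mx => /eqP; rewrite addr_eq0 => /eqP.
  have e1 := near_is_derive_eq n2 (Cd _ _ U _ _ od) d1.
  have e2 := near_is_derive_eq n3 (is_derive_mulmx (is_derive_trmx od) (Cd _ _ B _ _ od)) d2.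
  have e3 := near_is_derive_eq n4 (Cd _ _ V _ _ od) d3.
  have sA : A^T = - A.
    have := near_is_derive_eq n1 (is_derive_mulmx (is_derive_trmx od) od) (is_derive_cst _ _ _).
    by rewrite o0 trmx1 mulmx1 mul1mx => /eqP; rewrite addr_eq0 => /eqP.
  rewrite /vert /= -e1 -e3 -e2 o0 trmx1 mul1mx mulmx1 sA mulNmx.
  by rewrite addrC.
move=> [A sA ->].
pose M (t : R) := t *: (2^-1 *: A).
have sM t : (M t)^T = - M t by rewrite /M !linearZ /= sA !scalerN.
have M0 : M 0 = 0 by rewrite /M scale0r.
have Md : is_derive (0 : R) (1 : R) M (2^-1 *: A).
  exact: is_derive_scalel.
have Cd : differentiable (fun t => cayley (M t)) (0 : R).
  suff [H _] : Ck_on 1 setT (fun t => cayley (M t)) by exact: H.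
  apply: Ck_on_cayley => //; first exact: openT.
  apply/Ck_on_mx; first exact: openT.
  move=> i j; apply: (@Ck_on_eq _ _ _ openT _ _ (fun t : R => t * (2^-1 *: A) i j)).
    by move=> t _; rewrite /M [RHS]mxE.
  by apply: Ck_onM; [exact: openT|exact: (Ck_on_id openT)|exact: Ck_on_cst].
have cd := is_derive_cayley sM M0 Cd Md.
rewrite scalerA mulfV ?pnatr_eq0// scale1r in cd.
exists (fun t => orbit_pt (U, B, V) (cayley (M t))); split.
- by rewrite M0 cayley0 /orbit_pt /= trmx1 mul1mx !mulmx1.
- by near=> t; exists (cayley (M t)) => //; exact: cayley_orthogonal.
- have Cd' m n (C : 'M[R]_(m, n)) (D : 'M[R]_(n, r)) f : is_derive (0 : R) (1 : R) f D ->
      is_derive (0 : R) (1 : R) (fun t => C *m f t) (C *m D).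
    by move=> /(is_derive_mulmx (is_derive_cst C (0 : R) (1 : R))); rewrite mul0mx add0r.
  change (is_derive (0 : R) (1 : R) (fun t => (U *m cayley (M t),
    (cayley (M t))^T *m B *m cayley (M t), V *m cayley (M t))) (U *m A, B *m A - A *m B, V *m A)).
  refine (is_derive_pair (is_derive_pair (Cd' _ _ U _ _ cd) _) (Cd' _ _ V _ _ cd)).
  have := is_derive_mulmx (is_derive_mulmx (is_derive_trmx cd) (is_derive_cst B _ _)) cd.
  rewrite M0 cayley0 mulmx0 addr0 trmx1 mul1mx mulmx1 sA mulNmx => H.
  by apply: (is_derive_eq H); rewrite addrC.
Unshelve. all: by end_near. Qed.

End Geometry.

(** * Horizontal lifts and the map L *)

Section Quotient.
Context {R : realType} {p1 p2 r : nat}.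
Hypotheses (rp1 : (r <= p1)%N) (rp2 : (r <= p2)%N).
Implicit Types (U : 'M[R]_(p1, r)) (B A : 'M[R]_r) (V : 'M[R]_(p2, r)).
Implicit Types (P theta eta : triple R p1 p2 r).

Lemma eq_opp_0 m n (A : 'M[R]_(m, n)) : A = - A -> A = 0.
Proof.
by move=> /eqP; rewrite -addr_eq0 -mulr2n -scaler_nat scaler_eq0 pnatr_eq0 => /eqP.
Qed.

(** U^T theta_U and V^T theta_V are both [A] on a vertical vector and opposite on a horizontal
    one. *)
Lemma vert_horizontal0 P theta : total_space P -> horizontal P theta ->
  vertical P theta -> theta = 0.
Proof.
move=> tP; have [U1 _ V1] := tP; move=> /(horizontalP rp1 rp2 _ tP)[_ _ HV] /(verticalP _ U1)[A sA tE].
move: HV; rewrite tE /vert /= !mulmxA U1 V1 !mul1mx => /eq_opp_0 ->.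
by rewrite !mulmx0 mul0mx subr0.
Qed.

(* The skew A for which eta + (U A, B A - A B, V A) is horizontal. *)
Definition vertical_correction P eta : 'M[R]_r := - (2^-1 *: (P.1.1^T *m eta.1.1 + P.2^T *m eta.2)).

Lemma horizontalB P theta eta : total_space P -> horizontal P theta -> horizontal P eta ->
  horizontal P (theta - eta).
Proof.
move=> tP /(horizontalP rp1 rp2 _ tP)[t1 t2 t3] /(horizontalP rp1 rp2 _ tP)[e1 e2 e3].
apply/(horizontalP rp1 rp2 _ tP); split => /=.
- by rewrite linearB /= t1 e1.
- by rewrite !mulmxBr linearB /= t2 e2 opprD.
- by rewrite !mulmxBr t3 e3 opprD.
Qed.

Lemma vertB P A A' : vert P A - vert P A' = vert P (A - A').
Proof.
rewrite /vert !mulmxBr mulmxBl; congr (_, _, _).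
by move: (P.1.2 *m A) (P.1.2 *m A') (A *m _) (A' *m _) => a b c d; mx_lra.
Qed.

Lemma vertical_correction_skew P eta : tangent_total P eta -> (vertical_correction P eta)^T = - vertical_correction P eta.
Proof.
by move=> [e1 _ e3]; rewrite /vertical_correction trmxN trmxZ trmxD e1 e3 -opprD scalerN.
Qed.

Lemma horizontal_hlift_form P eta : total_space P -> tangent_total P eta ->
  horizontal P (eta + vert P (vertical_correction P eta)).
Proof.
move=> tP Te; have [e1 e2 e3] := Te; have [U1 [sB _] V1] := tP.
have sA := vertical_correction_skew Te.
apply/(horizontalP rp1 rp2 _ tP); split => /=.
- rewrite !(trmxD, trmxN) !trmx_mul e2 sA sB; congr (_ + _).
  by rewrite mulNmx mulmxN opprK addrC.
- by rewrite !mulmxDr !mulmxA U1 mul1mx linearD /= e1 sA opprD.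
- rewrite !mulmxDr !mulmxA U1 V1 !mul1mx /vertical_correction.
  by move: (_ *m eta.1.1) (_ *m eta.2) => a b; mx_lra.
Qed.

(** The right-hand side is a candidate because it is horizontal and differs from eta by a vertical
    vector; the candidate is unique because horizontal and vertical spaces meet only in 0. *)
Lemma hliftE P eta : total_space P -> tangent_total P eta ->
  hlift P eta = eta + vert P (vertical_correction P eta).
Proof.
move=> tP Te; have [U1 _ _] := tP; have sA := vertical_correction_skew Te.
have Hh := horizontal_hlift_form tP Te.
apply: xget_unique => [|theta [Ht /(verticalP _ U1)[A' sA' tE]]].
  by split=> //; apply/(verticalP _ U1); exists (vertical_correction P eta); rewrite // addrC addKr.
apply/eqP; rewrite -subr_eq0; apply/eqP; apply: (vert_horizontal0 tP).
  exact: horizontalB.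
apply/(verticalP _ U1); exists (A' - vertical_correction P eta); first by rewrite trmxD trmxN sA' sA opprD.
by rewrite -vertB -tE opprD addrA.
Qed.

Lemma horizontal_tangent P theta : total_space P -> horizontal P theta -> tangent_total P theta.
Proof.
move=> tP /(horizontalP rp1 rp2 _ tP)[t1 t2 t3]; split=> //.
by rewrite t3 trmxN t2.
Qed.

Lemma hlift_id P theta : total_space P -> horizontal P theta -> hlift P theta = theta.
Proof.
move=> tP H; rewrite hliftE//; last exact: horizontal_tangent.
move/(horizontalP rp1 rp2 _ tP): H => [_ _ t3].
by rewrite /vertical_correction t3 subrr scaler0 oppr0 /vert !mulmx0 mul0mx subr0 addr0.
Qed.

Lemma hlift_horizontal P eta : total_space P -> tangent_total P eta -> horizontal P (hlift P eta).
Proof. by move=> tP Te; rewrite hliftE//; exact: horizontal_hlift_form. Qed.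

Lemma hlift_eq0 P eta : total_space P -> tangent_total P eta -> hlift P eta = 0 ->
  vertical P eta.
Proof.
move=> tP Te /eqP; rewrite hliftE// addrC addr_eq0 => /eqP H.
have [U1 _ _] := tP; apply/(verticalP _ U1); exists (- vertical_correction P eta).
  by rewrite trmxN vertical_correction_skew.
rewrite -[LHS]opprK -H.
have vz : 0 = vert P 0 by rewrite /vert !mulmx0 mul0mx subr0.
by rewrite -[LHS]sub0r vz vertB sub0r.
Qed.

Lemma LmapD P theta eta : Lmap P (theta + eta) = Lmap P theta + Lmap P eta.
Proof.
rewrite /Lmap /= trmxD !(mulmxDl, mulmxDr).
move: (theta.1.1 *m _ *m _) (eta.1.1 *m _ *m _) (P.1.1 *m _ *m _) => a b c.
move: (P.1.1 *m eta.1.2 *m _) (P.1.1 *m _ *m theta.2^T) (P.1.1 *m _ *m eta.2^T) => d e g.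
by mx_lra.
Qed.

Lemma LmapZ P a theta : Lmap P (a *: theta) = a *: Lmap P theta.
Proof.
by rewrite /Lmap /= trmxZ -!scalemxAl -!scalemxAr -!scalemxAl !scalerDr.
Qed.

(** U B V^T is constant along the fiber, so its differential kills vertical vectors. *)
Lemma Lmap_vert P A : A^T = - A -> Lmap P (vert P A) = 0.
Proof.
move=> sA; rewrite /Lmap /vert /= trmx_mul sA mulmxBr mulmxBl mulNmx mulmxN !mulmxA.
by move: (P.1.1 *m A *m _ *m _) (P.1.1 *m _ *m A *m _) => a b; mx_lra.
Qed.

Lemma Lmap_hlift P eta : total_space P -> tangent_total P eta -> Lmap P (hlift P eta) = Lmap P eta.
Proof.
by move=> tP Te; rewrite hliftE// LmapD Lmap_vert ?addr0//; exact: vertical_correction_skew.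
Qed.

(** The three blocks are mutually orthogonal, and multiplication by [U] on the left or by V^T on the
    right preserves inner products. *)
Lemma inner_decomp U V (X1 Y1 : 'M[R]_(p1, r)) (K J : 'M[R]_r) (X2 Y2 : 'M[R]_(p2, r)) :
  stiefel U -> stiefel V -> U^T *m X1 = 0 -> U^T *m Y1 = 0 -> V^T *m X2 = 0 -> V^T *m Y2 = 0 ->
  inner (X1 *m V^T + U *m K *m V^T + U *m X2^T) (Y1 *m V^T + U *m J *m V^T + U *m Y2^T)
   = inner X1 Y1 + inner K J + inner X2 Y2.
Proof.
move=> U1 V1 UX UY VX VY.
have XU : X1^T *m U = 0 by apply: trmx_inj; rewrite trmx_mul trmxK trmx0.
have YV : Y2^T *m V = 0 by apply: trmx_inj; rewrite trmx_mul trmxK trmx0.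
have XV : X2^T *m V = 0 by apply: trmx_inj; rewrite trmx_mul trmxK trmx0.
have z1 K' (Z : 'M[R]_(r, p2)) : inner (X1 *m K') (U *m Z) = 0.
  by rewrite innerC inner_mulL mulmxA UX mul0mx innerC inner0l.
have z2 (Z : 'M[R]_(r, p2)) K' : inner (U *m Z) (Y1 *m K') = 0.
  by rewrite inner_mulL mulmxA UY mul0mx innerC inner0l.
have iU (Z Z' : 'M[R]_(r, p2)) : inner (U *m Z) (U *m Z') = inner Z Z'.
  by rewrite inner_mulL mulmxA U1 mul1mx.
have iV m (Z Z' : 'M[R]_(m, r)) : inner (Z *m V^T) (Z' *m V^T) = inner Z Z'.
  by rewrite inner_mulR trmxK -mulmxA V1 mulmx1.
rewrite !innerDl !innerDr -!mulmxA !z1 !z2 !iU !iV inner_tr.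
rewrite (inner_mulR K) trmxK YV (innerC K 0) inner0l.
rewrite (innerC X2^T (J *m _)) (inner_mulR J) trmxK XV (innerC J 0) inner0l.
by rewrite !addr0 !add0r.
Qed.

Lemma tangent_decomp U V (xi : 'M[R]_(p1, p2)) :
  (1%:M - U *m U^T) *m xi *m (1%:M - V *m V^T) = 0 ->
  xi = (1%:M - U *m U^T) *m xi *m V *m V^T + U *m (U^T *m xi *m V) *m V^T
       + U *m ((1%:M - V *m V^T) *m xi^T *m U)^T.
Proof.
move=> H; rewrite trmx_mul trmx_mul trmxK trmxD trmxN trmx_mul trmxK trmx1 /=.
rewrite -[LHS]subr0 -H !(mulmxBl, mulmxBr, mul1mx, mulmx1, mulmxA).
by move: (U *m _ *m xi) => a; move: (a *m _ *m _) (xi *m V *m _) => b c; mx_lra.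
Qed.

(** Since [Om] enters theta_V with a minus sign and is transposed, its two contributions add up to
    Om B + B Om instead of a commutator. This matrix is skew, hence orthogonal to theta_B in the
    same block. *)
Lemma LmapE U B V theta : total_space (U, B, V) -> horizontal (U, B, V) theta ->
  let X1 := theta.1.1 - U *m (U^T *m theta.1.1) in
  let X2 := theta.2 - V *m (V^T *m theta.2) in
  let Om := U^T *m theta.1.1 in
  Lmap (U, B, V) theta = X1 *m B *m V^T + U *m (Om *m B + B *m Om + theta.1.2) *m V^T
     + U *m (X2 *m B)^T.
Proof.
move=> tP Ht X1 X2 Om; have [/= t1 t2 t3] := (horizontalP rp1 rp2 theta tP).1 Ht; have [_ [sB _] _] := tP.
rewrite /Lmap /X1 /X2 /= trmx_mul sB trmxD trmxN trmx_mul t3 -/Om trmxN t2 opprK.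
rewrite !(mulmxBl, mulmxBr, mulmxDl, mulmxDr, mulmxA).
rewrite /=; move: (theta.1.1 *m _ *m _) (U *m _ *m theta.1.1 *m _ *m _) => a b.
by move: (_ *m theta.1.1 *m _) (U *m theta.1.2 *m _) (U *m B *m theta.2^T) => c d e; mx_lra.
Qed.

(** The factor 2 arises because [Om] appears in theta_U and, up to sign, in theta_V. *)
Lemma gbarE U B V theta eta : total_space (U, B, V) -> horizontal (U, B, V) theta ->
  horizontal (U, B, V) eta ->
  let X1 := theta.1.1 - U *m (U^T *m theta.1.1) in
  let X2 := theta.2 - V *m (V^T *m theta.2) in
  let Y1 := eta.1.1 - U *m (U^T *m eta.1.1) in
  let Y2 := eta.2 - V *m (V^T *m eta.2) in
  gbar (U, B, V) theta eta = inner X1 Y1 + 2 * inner (U^T *m theta.1.1) (U^T *m eta.1.1)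
    + \tr (invmx B *m theta.1.2 *m invmx B *m eta.1.2) + inner X2 Y2.
Proof.
move=> tP Ht He X1 X2 Y1 Y2.
have [/= _ _ t3] := (horizontalP rp1 rp2 theta tP).1 Ht.
have [/= _ _ e3] := (horizontalP rp1 rp2 eta tP).1 He.
have [U1 _ V1] := tP.
have proj p (W : 'M[R]_(p, r)) (a b : 'M[R]_(p, r)) : W^T *m W = 1%:M ->
   inner (a - W *m (W^T *m a)) (b - W *m (W^T *m b)) = inner a b - inner (W^T *m a) (W^T *m b).
  move=> W1; set w := W^T *m a; set z := W^T *m b.
  have h1 : inner a (W *m z) = inner w z by rewrite innerC inner_mulL innerC.
  have h2 : inner (W *m w) b = inner w z by rewrite inner_mulL.
  have h3 : inner (W *m w) (W *m z) = inner w z by rewrite inner_mulL mulmxA W1 mul1mx.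
  rewrite !(innerDl, innerDr, innerNl, innerNr) h1 h2 h3; lra.
rewrite /gbar /X1 /X2 /Y1 /Y2 /= !proj// t3 e3 innerNl innerNr opprK /inner; lra.
Qed.

End Quotient.

(** * Matrices of fixed rank *)

Section Rank.
Context {R : realType}.

Lemma continuous_det n (M : 'M[R]_n) : {for M, continuous (fun N : 'M[R]_n => \det N)}.
Proof. exact: (Ck_on_det openT (Ck_on_id openT 0)). Qed.

Lemma near_unitmx (E : normedModType R) n (M : E -> 'M[R]_n) x :
  {for x, continuous M} -> M x \in unitmx -> \forall y \near x, M y \in unitmx.
Proof.
move=> Mc; rewrite unitmxE unitfE => d0.
have dc : {for x, continuous (fun y => \det (M y))}.
  exact: (@continuous_comp _ _ _ M (fun N : 'M[R]_n => \det N) x Mc (@continuous_det _ _)).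
have H := @cvgr_neq0 _ _ _ _ _ _ _ dc d0.
near=> y; rewrite unitmxE unitfE; near: y; exact: H.
Unshelve. all: by end_near. Qed.

Lemma open_unitmx n : open [set N : 'M[R]_n | N \in unitmx].
Proof.
rewrite openE => N Nu; apply: (near_unitmx (M := fun N => N)) => //.
Qed.

Lemma Ck_on_invmx_unit k n : Ck_on k [set N : 'M[R]_n | N \in unitmx] (fun N => invmx N).
Proof.
by apply: Ck_on_invmx; [exact: open_unitmx| |exact: Ck_on_id (@open_unitmx _) _].
Qed.

Lemma differentiable_invmx n (N : 'M[R]_n) : N \in unitmx -> differentiable (fun N => invmx N) N.
Proof. by move=> Nu; have [H _] := Ck_on_invmx_unit 1 n; exact: H. Qed.

(** U^T Y already has rank r, so it has the same row space as [Y] and Y = C (U^T Y) for some C;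
    multiplying by [V] on the right determines C. *)
Lemma rank_factor p1 p2 r (U : 'M[R]_(p1, r)) (V : 'M[R]_(p2, r)) (Y : 'M[R]_(p1, p2)) :
  \rank Y = r -> U^T *m Y *m V \in unitmx ->
  Y = Y *m V *m invmx (U^T *m Y *m V) *m (U^T *m Y).
Proof.
move=> rY Ku.
have rUY : \rank (U^T *m Y) = r.
  apply/eqP; rewrite eqn_leq rank_leq_row /=.
  by rewrite -{1}(mxrank_unit Ku) mxrankM_maxl.
have /submxP[C YC] : (Y <= U^T *m Y)%MS.
  have := mxrank_leqif_sup (submxMl U^T Y); rewrite rUY rY => -[_].
  by rewrite eqxx => <-.
have YV : Y *m V = C *m (U^T *m Y *m V) by rewrite {1}YC !mulmxA.
by rewrite YV mulmxK.
Qed.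

Lemma rank_unit_ge p1 p2 r (U : 'M[R]_(p1, r)) (V : 'M[R]_(p2, r)) (Y : 'M[R]_(p1, p2)) :
  U^T *m Y *m V \in unitmx -> (r <= \rank Y)%N.
Proof.
move=> Ku; rewrite -{1}(mxrank_unit Ku) (leq_trans (mxrankM_maxl _ _))//.
exact: mxrankM_maxr.
Qed.

End Rank.

Lemma spd_unit {R : realType} n (B : 'M[R]_n) : spd B -> B \in unitmx.
Proof.
move=> [_ pB]; rewrite -row_free_unit -kermx_eq0; apply/negPn/negP.
move=> /rowV0Pn[x /sub_kermxP xB x0]; have := pB x x0.
by rewrite xB mul0mx mxE ltxx.
Qed.

Lemma spd_congr {R : realType} n (B C : 'M[R]_n) : spd B -> C \in unitmx -> spd (C^T *m B *m C).
Proof.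
move=> [sB pB] Cu; split; first by rewrite !trmx_mul trmxK sB mulmxA.
move=> x x0; have := pB (x *m C^T); rewrite trmx_mul trmxK !mulmxA; apply.
by apply: contra x0 => /eqP xC; rewrite -[x](@mulmxK _ _ _ C^T) ?unitmx_tr// xC mul0mx.
Qed.

(** * Tangent space of the fixed-rank manifold *)

Section TangentSpace.
Context {R : realType} {p1 p2 r : nat}.
Variables (U : 'M[R]_(p1, r)) (B : 'M[R]_r) (V : 'M[R]_(p2, r)).
Hypotheses (U1 : stiefel U) (B_spd : spd B) (V1 : stiefel V).
Let X := U *m B *m V^T.

Lemma compress_product : U^T *m X *m V = B.
Proof. by rewrite /X !mulmxA U1 mul1mx -mulmxA V1 mulmx1. Qed.

Lemma left_perp_product : (1%:M - U *m U^T) *m X = 0.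
Proof. by rewrite /X !mulmxA mulmxBl mul1mx -(mulmxA U U^T) U1 mulmx1 subrr !mul0mx. Qed.

Lemma right_perp_product : X *m (1%:M - V *m V^T) = 0.
Proof.
by rewrite /X -mulmxA mulmxBr mulmx1 mulmxA V1 mul1mx subrr mulmx0.
Qed.

Lemma is_derive_mulmxl (E : normedModType R) m n p (C : 'M[R]_(m, n)) (f : E -> 'M[R]_(n, p)) x v D :
  is_derive x v f D -> is_derive x v (fun y => C *m f y) (C *m D).
Proof.
by move=> /(is_derive_mulmx (is_derive_cst C x v)); rewrite mul0mx add0r.
Qed.

Lemma is_derive_mulmxr (E : normedModType R) m n p (C : 'M[R]_(n, p)) (f : E -> 'M[R]_(m, n)) x v D :
  is_derive x v f D -> is_derive x v (fun y => f y *m C) (D *m C).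
Proof.
by move=> /is_derive_mulmx /(_ (is_derive_cst C x v)); rewrite mulmx0 addr0.
Qed.

(* Vanishing of the Schur complement of U^T gamma V. *)
Lemma near_tangent_rank (E : normedModType R) (gamma : E -> 'M[R]_(p1, p2)) x :
  {for x, continuous gamma} -> gamma x = X ->
  (\forall t \near x, fixed_rank r (gamma t)) -> \forall t \near x,
   U^T *m gamma t *m V \in unitmx /\
   (1%:M - U *m U^T) *m gamma t *m (1%:M - V *m V^T) =
   (1%:M - U *m U^T) *m gamma t *m V *m (invmx (U^T *m gamma t *m V) *m
     (U^T *m gamma t *m (1%:M - V *m V^T))).
Proof.
move=> gc g0 gr.
have Kc : {for x, continuous (fun t => U^T *m gamma t *m V)}.
  have Mc (Z : 'M[R]_(p1, p2)) : {for Z, continuous (fun Z : 'M[R]_(p1, p2) => U^T *m Z *m V)}.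
    exact: (Ck_on_mulmx openT (Ck_on_mulmx openT (Ck_on_cst setT 0 U^T) (Ck_on_id openT 0)) (Ck_on_cst setT 0 V)).
  exact: (@continuous_comp _ _ _ gamma (fun Z : 'M[R]_(p1, p2) => U^T *m Z *m V) x gc (Mc _)).
have Ku : \forall t \near x, U^T *m gamma t *m V \in unitmx.
  by apply: near_unitmx => //; rewrite g0 compress_product spd_unit.
near=> t.
have H1 : U^T *m gamma t *m V \in unitmx by near: t.
have H2 : fixed_rank r (gamma t) by near: t.
split=> //; have := rank_factor H2 H1; rewrite /= => {1}->.
by rewrite !mulmxA.
Unshelve. all: by end_near. Qed.

(** Along the curve, the normal block is the product of Schur complement factors. The two outer ones
    vanish at [X], whose column and row spaces lie in those of [U] and [V], so every term of the
    product rule is 0. *)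
Lemma TMe_sub xi : TMe r X xi -> (1%:M - U *m U^T) *m xi *m (1%:M - V *m V^T) = 0.
Proof.
move=> [gamma [g0 gr gd]].
have gD : differentiable gamma (0 : R) by apply/derivable1_diffP; have [] := gd.
have gc := differentiable_continuous gD.
have H := near_tangent_rank gc g0 gr.
have Kd := is_derive_mulmxr V (is_derive_mulmxl U^T gd).
have KD : differentiable (fun t => U^T *m gamma t *m V) (0 : R).
  by apply/derivable1_diffP; have [] := Kd.
have iK : differentiable (fun N : 'M[R]_r => invmx N) (U^T *m gamma 0 *m V).
  by apply: differentiable_invmx; rewrite g0 compress_product spd_unit.
have iKd := is_derive_comp_diff (1 : R) KD iK.
have cd := is_derive_mulmxr (1%:M - V *m V^T) (is_derive_mulmxl U^T gd).
have ad := is_derive_mulmxr V (is_derive_mulmxl (1%:M - U *m U^T) gd).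
have rd := is_derive_mulmx ad (is_derive_mulmx iKd cd).
have ld := is_derive_mulmxr (1%:M - V *m V^T) (is_derive_mulmxl (1%:M - U *m U^T) gd).
have n1 : \forall t \near (0 : R), (1%:M - U *m U^T) *m gamma t *m (1%:M - V *m V^T) =
   (1%:M - U *m U^T) *m gamma t *m V *m (invmx (U^T *m gamma t *m V) *m
     (U^T *m gamma t *m (1%:M - V *m V^T))).
  by move: H; apply: filterS => t [].
rewrite (near_is_derive_eq n1 ld rd) g0 left_perp_product !mul0mx addr0.
by rewrite -(mulmxA U^T) right_perp_product !mulmx0.
Qed.

Lemma tangent_of_map (E F : normedModType R) (S : set F) (phi : E -> F) x u :
  (\forall y \near x, S (phi y)) -> differentiable phi x ->
  tangent S (phi x) ('D_u phi x).
Proof.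
move=> nS pd; exists (fun t => phi (x + t *: u)); split.
- by rewrite scale0r addr0.
- have c : {for (0 : R), continuous (fun t : R => x + t *: u)}.
    exact/differentiable_continuous/differentiable_affine_line.
  have := c; rewrite /prop_for /continuous_at scale0r addr0 => c'.
  exact: (c' _ nS).
- have := @is_derive_affine_line R E F phi x u 0.
  by rewrite scale0r addr0; apply.
Qed.

Section RankChart.
Context {E : normedModType R}.
Variables (M : E -> 'M[R]_(p1, r)) (N : E -> 'M[R]_(r, p2)).

(** A product through dimension r has rank at most r everywhere. Where M and N vanish it equals [X],
    and near there U^T Y V stays invertible, which forces the rank to be r. *)
Definition rank_map (x : E) := (U + M x) *m (B *m V^T + N x).

Lemma Ck_on_rank_map k : Ck_on k setT M -> Ck_on k setT N -> Ck_on k setT rank_map.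
Proof.
move=> MC NC; apply: Ck_on_mulmx; first exact: openT.
  exact: (Ck_onD openT (Ck_on_cst setT k U)).
exact: (Ck_onD openT (Ck_on_cst setT k (B *m V^T))).
Qed.

Lemma is_derive_rank_map x v dM dN : M x = 0 -> N x = 0 ->
  is_derive x v M dM -> is_derive x v N dN ->
  is_derive x v rank_map (dM *m B *m V^T + U *m dN).
Proof.
move=> M0 N0 Md Nd.
have := is_derive_mulmx (is_deriveD (is_derive_cst U x v) Md) (is_deriveD (is_derive_cst (B *m V^T) x v) Nd).
by rewrite !fctE M0 N0 !addr0 !add0r mulmxA.
Qed.

Lemma near_rank_map x : M x = 0 -> N x = 0 -> Ck_on 0 setT M -> Ck_on 0 setT N ->
  \forall y \near x, fixed_rank r (rank_map y).
Proof.
move=> M0 N0 MC NC.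
have rc := Ck_on_rank_map MC NC.
have Ku : \forall y \near x, U^T *m rank_map y *m V \in unitmx.
  apply: near_unitmx.
    by apply: (Ck_on_mulmx openT (Ck_on_mulmx openT (Ck_on_cst setT 0 U^T) rc) (Ck_on_cst setT 0 V)).
  by rewrite /rank_map M0 N0 !addr0 (mulmxA U B) -/X compress_product spd_unit.
near=> y; have H : U^T *m rank_map y *m V \in unitmx by near: y.
rewrite /fixed_rank /=; apply/eqP; rewrite eqn_leq (rank_unit_ge H) andbT.
exact: leq_trans (mxrankM_maxl _ _) (rank_leq_col _).
Unshelve. all: by end_near. Qed.

End RankChart.

Lemma Ck_on_scale_cst k m n (C : 'M[R]_(m, n)) : Ck_on k setT (fun t : R => t *: C).
Proof.
apply/Ck_on_mx; first exact: openT.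
move=> i j; apply: (@Ck_on_eq _ _ _ openT _ _ (fun t : R => t * C i j)).
  by move=> t _; rewrite [RHS]mxE.
by apply: Ck_onM; [exact: openT|exact: (Ck_on_id openT)|exact: Ck_on_cst].
Qed.

Lemma TMe_sup xi : (1%:M - U *m U^T) *m xi *m (1%:M - V *m V^T) = 0 -> TMe r X xi.
Proof.
move=> xi0; have Bu := spd_unit B_spd.
(* With these choices the velocity is xi V V^T + U U^T xi (1 - V V^T), which is xi minus its normal
   part. *)
pose M (t : R) := t *: (xi *m V *m invmx B).
pose N (t : R) := t *: (U^T *m xi *m (1%:M - V *m V^T)).
have MC k : Ck_on k setT M by exact: Ck_on_scale_cst.
have NC k : Ck_on k setT N by exact: Ck_on_scale_cst.
have [M0 N0] : M 0 = 0 /\ N 0 = 0 by rewrite /M /N !scale0r.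
have rd := is_derive_rank_map M0 N0 (is_derive_scalel _ _) (is_derive_scalel _ _).
have rn := near_rank_map M0 N0 (MC 0) (NC 0).
exists (rank_map M N); split => //; first by rewrite /rank_map M0 N0 !addr0 (mulmxA U B).
apply: (is_derive_eq rd); rewrite -(mulmxA (xi *m V)) mulVmx// mulmx1.
apply/eqP; rewrite eq_sym -subr_eq0 -{}xi0; apply/eqP.
rewrite !(mulmxBl, mulmxBr, mul1mx, mulmx1, mulmxA).
move: (U *m U^T *m xi *m V *m V^T) (xi *m V *m V^T) (U *m _ *m xi) => a b c; mx_lra.
Qed.

End TangentSpace.

(** * Local parametrizations *)

Section Coordinates.
Context {R : realType}.

(** Three matrices stacked on top of each other are read off one row vector. The size equation is
    propositional, to be used with [dimM], where natural subtraction prevents conversion. *)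
Lemma stacked_coordinates d a b c r : d = ((a + (b + c)) * r)%N ->
  exists (f1 : {linear 'rV[R]_d -> 'M[R]_(a, r)}) (f2 : {linear 'rV[R]_d -> 'M[R]_(b, r)})
    (f3 : {linear 'rV[R]_d -> 'M[R]_(c, r)}),
  (forall x, f1 x = 0 -> f2 x = 0 -> f3 x = 0 -> x = 0) /\
  forall A B C, exists x, [/\ f1 x = A, f2 x = B & f3 x = C].
Proof.
move=> ->.
exists (usubmx \o vec_mx), (usubmx \o (dsubmx \o vec_mx)), (dsubmx \o (dsubmx \o vec_mx)); split.
  move=> x /= h1 h2 h3; apply: (can_inj (@vec_mxK _ _ _)); rewrite linear0.
  by rewrite -[LHS]vsubmxK h1 -[dsubmx _]vsubmxK h2 h3 !col_mx0.
move=> A B C; exists (mxvec (col_mx A (col_mx B C))).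
by split; rewrite /= mxvecK ?col_mxKu// col_mxKd ?col_mxKu ?col_mxKd.
Qed.

Lemma rV_linear_sum d (F : lmodType R) (f : {linear 'rV[R]_d -> F}) x :
  f x = \sum_i x 0 i *: f (dvec R i).
Proof.
rewrite {1}(row_sum_delta x) linear_sum; apply: eq_bigr => i _.
by rewrite linearZ.
Qed.

Lemma Ck_on_rV_linear k d m n (f : {linear 'rV[R]_d -> 'M[R]_(m, n)}) : Ck_on k setT f.
Proof.
apply/Ck_on_mx; first exact: openT.
move=> i j; apply: (@Ck_on_eq _ _ _ openT _ _ (fun x : 'rV[R]_d => \sum_l x 0 l * f (dvec R l) i j)).
  move=> x _; rewrite (rV_linear_sum f x) summxE; apply: eq_bigr => l _.
  by rewrite [RHS]mxE.
apply: Ck_on_sum; first exact: openT.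
move=> l; apply: Ck_onM; [exact: openT| |exact: Ck_on_cst].
by have /(Ck_on_mx openT)/(_ 0 l) := Ck_on_id (E := 'rV[R]_d) openT k.
Qed.

Lemma is_derive_rV_linear d m n (f : {linear 'rV[R]_d -> 'M[R]_(m, n)}) x v :
  is_derive x v f (f v).
Proof.
have fc : continuous f by move=> y; exact: (Ck_on_rV_linear 0 f y I).
exact: (is_derive_linear fc (is_derive_id x v)).
Qed.

Lemma basis_of_param d (F : normedModType R) (W : set F) (f : 'rV[R]_d -> F) :
  linear f -> (forall x, f x = 0 -> x = 0) -> (forall v, W v <-> exists x, v = f x) ->
  is_basis W (fun i => f (dvec R i)).
Proof.
move=> fl fi fW.
pose fL := GRing.isLinear.Build _ _ _ _ f fl.
pose fF : {linear 'rV[R]_d -> F} := HB.pack f fL.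
have fE (c : 'I_d -> R) : \sum_i c i *: f (dvec R i) = f (\row_i c i).
  by rewrite -[RHS]/(fF _) rV_linear_sum; apply: eq_bigr => i _; rewrite mxE.
split=> [v|c].
  rewrite fW; split=> [[x ->]|[c ->]].
    exists (fun i => x 0 i); rewrite fE; congr f.
    by apply/rowP => i; rewrite mxE.
  by exists (\row_i c i).
rewrite fE => /fi c0 i; by move/rowP: c0 => /(_ i); rewrite !mxE.
Qed.

Lemma sym_skewK n (Z : 'M[R]_n) : sym_part Z + skew_part Z = Z.
Proof. rewrite /sym_part /skew_part; mx_lra. Qed.
Lemma sym_part_tr n (Z : 'M[R]_n) : (sym_part Z)^T = sym_part Z.
Proof. rewrite /sym_part; mx_lra. Qed.
Lemma skew_part_tr n (Z : 'M[R]_n) : (skew_part Z)^T = - skew_part Z.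
Proof. rewrite /skew_part; mx_lra. Qed.
Lemma sym_part_id n (S K : 'M[R]_n) : S^T = S -> K^T = - K -> sym_part (S + K) = S.
Proof. by move=> sS sK; rewrite /sym_part trmxD sS sK; mx_lra. Qed.
Lemma skew_part_id n (S K : 'M[R]_n) : S^T = S -> K^T = - K -> skew_part (S + K) = K.
Proof. by move=> sS sK; rewrite /skew_part trmxD sS sK; mx_lra. Qed.
Lemma sym_part_is_linear n : linear (@sym_part R n).
Proof. move=> a A B; rewrite /sym_part; apply/matrixP => i j; rewrite !mxE; ring. Qed.
Lemma skew_part_is_linear n : linear (@skew_part R n).
Proof. move=> a A B; rewrite /skew_part; apply/matrixP => i j; rewrite !mxE; ring. Qed.

End Coordinates.

Section Charts.
Context {R : realType} {p1 p2 r : nat}.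
Hypotheses (rp1 : (r <= p1)%N) (rp2 : (r <= p2)%N).
Variables (U : 'M[R]_(p1, r)) (B : 'M[R]_r) (V : 'M[R]_(p2, r)).
Hypotheses (U1 : stiefel U) (B_spd : spd B) (V1 : stiefel V).
Let X := U *m B *m V^T.
Let P : triple R p1 p2 r := (U, B, V).
Let d := dimM p1 p2 r.

Variables (f1 : {linear 'rV[R]_d -> 'M[R]_(p1 - r, r)}) (f2 : {linear 'rV[R]_d -> 'M[R]_r})
  (f3 : {linear 'rV[R]_d -> 'M[R]_(p2 - r, r)}).
Hypotheses (f_inj : forall x, f1 x = 0 -> f2 x = 0 -> f3 x = 0 -> x = 0)
  (f_surj : forall A C D, exists x, [/\ f1 x = A, f2 x = C & f3 x = D]).

Let tP : total_space P. Proof. by split. Qed.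
Let PUE : (1%:M - U *m U^T) = perp U *m (perp U)^T.
Proof. by rewrite -(proj_perpE U1 rp1). Qed.
Let PVE : (1%:M - V *m V^T) = perp V *m (perp V)^T.
Proof. by rewrite -(proj_perpE V1 rp2). Qed.

(* Horizontal and tangent vectors share the coordinates (D1, Z, D2): for the former, Z is split
   into theta_B = sym Z and Omega = skew Z, so that no separate count of dimensions is needed. *)
Definition hpar (x : 'rV[R]_d) : triple R p1 p2 r :=
  (perp U *m f1 x + U *m skew_part (f2 x), sym_part (f2 x),
   perp V *m f3 x - V *m skew_part (f2 x)).

Definition tpar (x : 'rV[R]_d) : 'M[R]_(p1, p2) :=
  perp U *m f1 x *m V^T + U *m f2 x *m V^T + U *m (perp V *m f3 x)^T.

Lemma hpar_linear : linear hpar.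
Proof.
move=> a x y; rewrite /hpar (linearP f1) (linearP f2) (linearP f3).
rewrite skew_part_is_linear sym_part_is_linear.
move: (skew_part (f2 x)) (skew_part (f2 y)) => K L.
congr (_, _, _); rewrite /= !mulmxDr -!scalemxAr.
  by move: (perp U *m f1 x) (perp U *m f1 y) (U *m K) (U *m L) => e g h k; mx_lra.
by move: (perp V *m f3 x) (perp V *m f3 y) (V *m K) (V *m L) => e g h k; mx_lra.
Qed.

Lemma tpar_linear : linear tpar.
Proof.
move=> a x y; rewrite /tpar (linearP f1) (linearP f2) (linearP f3) !mulmxDr !trmxD !(mulmxDl, mulmxDr).
rewrite -!scalemxAr !trmxZ -!(scalemxAl) -!scalemxAr !scalerDr.
move: (perp U *m f1 x *m _) (perp U *m f1 y *m _) (U *m f2 x *m _) (U *m f2 y *m _) => e g h k.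
by move: (U *m _) (U *m _) => l n; mx_lra.
Qed.

Lemma horizontal_hpar v : horizontal P v <-> exists x, v = hpar x.
Proof.
split=> [[D1 [D2 [Om [sO sB v1 v2]]]]|[x ->]].
  have [x [x1 x2 x3]] := f_surj D1 (v.1.2 + Om) D2.
  exists x; rewrite /hpar x1 x2 x3 sym_part_id// skew_part_id//.
  by move: v v1 v2 {sB x2} => [[vU vB] vV] /= -> ->.
exists (f1 x), (f3 x), (skew_part (f2 x)); split=> //=.
  exact: skew_part_tr.
exact: sym_part_tr.
Qed.

Lemma hpar_inj x : hpar x = 0 -> x = 0.
Proof.
have [WU UW] := perp_spec U1 rp1; have [WV _] := perp_spec V1 rp2.
move=> [h1 h2 h3].
have s0 : skew_part (f2 x) = 0.
  by have := congr1 (mulmx U^T) h1; rewrite mulmxDr !mulmxA UW U1 mul0mx mul1mx add0r mulmx0.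
rewrite s0 mulmx0 ?addr0 ?subr0 in h1 h3.
apply: f_inj.
- by have := congr1 (mulmx (perp U)^T) h1; rewrite mulmxA WU mul1mx mulmx0.
- by rewrite -(sym_skewK (f2 x)) h2 s0 addr0.
- by have := congr1 (mulmx (perp V)^T) h3; rewrite mulmx0 subr0 mulmxA WV mul1mx mulmx0.
Qed.

Lemma TMe_tpar v : TMe r X v <-> exists x, v = tpar x.
Proof.
split=> [/(TMe_sub U1 B_spd V1) Hv|[x ->]].
  have [x [x1 x2 x3]] := f_surj ((perp U)^T *m v *m V) (U^T *m v *m V) ((perp V)^T *m v^T *m U).
  exists x; rewrite /tpar x1 x2 x3 [LHS](tangent_decomp Hv) PUE PVE.
  by rewrite !mulmxA.
have UP : (1%:M - U *m U^T) *m U = 0 by rewrite mulmxBl mul1mx -mulmxA U1 mulmx1 subrr.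
have VP : V^T *m (1%:M - V *m V^T) = 0 by rewrite mulmxBr mulmx1 mulmxA V1 mul1mx subrr.
apply: (TMe_sup U1 B_spd V1); rewrite /tpar.
move: (1%:M - U *m U^T) (1%:M - V *m V^T) UP VP => a b UP VP; rewrite !mulmxDr !mulmxDl -!mulmxA VP !mulmx0.
by rewrite !(mulmxA a U) UP !mul0mx !addr0.
Qed.

Lemma tpar_inj x : tpar x = 0 -> x = 0.
Proof.
have [WU UW] := perp_spec U1 rp1; have [WV VW] := perp_spec V1 rp2.
have WUU := tr_perp_mul U1 rp1; have WVV := tr_perp_mul V1 rp2.
move=> h; apply: f_inj.
- have := congr1 (fun Z => (perp U)^T *m Z *m V) h.
  rewrite /tpar !mulmxDr !mulmxDl !mulmxA WU WUU !mul0mx !mul1mx -!mulmxA V1 mulmx1 !addr0.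
  by rewrite mul0mx mulmx0.
- have := congr1 (fun Z => U^T *m Z *m V) h.
  rewrite /tpar !mulmxDr !mulmxDl !mulmxA UW U1 !mul0mx !mul1mx add0r -!mulmxA V1 mulmx1.
  by rewrite trmx_mul -mulmxA WVV mulmx0 addr0 mul0mx mulmx0.
- have := congr1 (fun Z => U^T *m Z *m perp V) h.
  rewrite /tpar !mulmxDr !mulmxDl !mulmxA UW U1 !mul0mx !mul1mx add0r -!mulmxA VW mulmx0 add0r.
  rewrite trmx_mul -mulmxA WV mulmx1 mul0mx mulmx0 => /(congr1 trmx).
  by rewrite trmxK trmx0.
Qed.

Lemma hpar_basis : is_basis (horizontal P) (fun i => hpar (dvec R i)).
Proof. exact: (basis_of_param hpar_linear hpar_inj horizontal_hpar). Qed.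

Lemma tpar_basis : is_basis (TMe r X) (fun i => tpar (dvec R i)).
Proof. exact: (basis_of_param tpar_linear tpar_inj TMe_tpar). Qed.

Lemma chart_e_exists : exists phi, chart_e X phi /\ forall u, 'D_u phi 0 = tpar u.
Proof.
have Bu := spd_unit B_spd.
(* The factors [invmx B] cancel the [B] that multiplies dM in [is_derive_rank_map], so the
   differential at 0 is exactly [tpar]. *)
pose M x := perp U *m f1 x *m invmx B + U *m f2 x *m invmx B.
pose N x := (perp V *m f3 x)^T.
have ck k m n (C : 'M[R]_(m, n)) := Ck_on_cst (E := 'rV[R]_d) setT k C.
have fC k m n (f : {linear 'rV[R]_d -> 'M[R]_(m, n)}) := Ck_on_rV_linear k f.
have mul k m n p (F : _ -> 'M[R]_(m, n)) (G : _ -> 'M[R]_(n, p)) := @Ck_on_mulmx _ _ _ (@openT 'rV[R]_d) k m n p F G.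
have MC k : Ck_on k setT M.
  exact: (Ck_onD openT
    (mul _ _ _ _ _ _ (mul _ _ _ _ _ _ (ck _ _ _ (perp U)) (fC _ _ _ f1)) (ck _ _ _ (invmx B)))
    (mul _ _ _ _ _ _ (mul _ _ _ _ _ _ (ck _ _ _ U) (fC _ _ _ f2)) (ck _ _ _ (invmx B)))).
have NC k : Ck_on k setT N by exact: (Ck_on_trmx openT (mul _ _ _ _ _ _ (ck _ _ _ (perp V)) (fC _ _ _ f3))).
have M0 : M 0 = 0 by rewrite /M (linear0 f1) (linear0 f2) !mulmx0 !mul0mx addr0.
have N0 : N 0 = 0 by rewrite /N (linear0 f3) mulmx0 trmx0.
have Md u : is_derive 0 u M (M u).
  apply: is_deriveD; apply: is_derive_mulmxr; apply: is_derive_mulmxl; exact: is_derive_rV_linear.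
have Nd u : is_derive 0 u N (N u).
  apply: is_derive_trmx; apply: is_derive_mulmxl; exact: is_derive_rV_linear.
have D u : 'D_u (rank_map U B V M N) 0 = tpar u.
  have [_ ->] := is_derive_rank_map U B V M0 N0 (Md u) (Nd u).
  by rewrite /M !mulmxDl -!(mulmxA _ (invmx B)) !mulVmx// !mulmx1.
exists (rank_map U B V M N); split=> //; split.
- by rewrite /rank_map M0 N0 !addr0 mulmxA.
- exact: (Ck_on_C2_at openT I (Ck_on_rank_map U B V (MC 2) (NC 2))).
- exact: (near_rank_map U1 B_spd V1 M0 N0 (MC 0) (NC 0)).
- by move=> u; rewrite D => /tpar_inj.
Qed.

End Charts.

Section LinearMaps.
Context {R : realType} {E : lmodType R}.

Lemma linear_fun_D m n (f g : E -> 'M[R]_(m, n)) : linear f -> linear g -> linear (fun x => f x + g x).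
Proof.
move=> fl gl a x y; rewrite fl gl scalerDr.
by move: (a *: f x) (a *: g x) => b c; mx_lra.
Qed.
Lemma linear_fun_Z m n b (f : E -> 'M[R]_(m, n)) : linear f -> linear (fun x => b *: f x).
Proof. by move=> fl a x y; rewrite fl scalerDr !scalerA mulrC. Qed.
Lemma linear_fun_mull m n p (C : 'M[R]_(p, m)) (f : E -> 'M[R]_(m, n)) : linear f -> linear (fun x => C *m f x).
Proof. by move=> fl a x y; rewrite fl mulmxDr -scalemxAr. Qed.
Lemma linear_fun_mulr m n p (C : 'M[R]_(n, p)) (f : E -> 'M[R]_(m, n)) : linear f -> linear (fun x => f x *m C).
Proof. by move=> fl a x y; rewrite fl mulmxDl -scalemxAl. Qed.
Lemma linear_fun_tr m n (f : E -> 'M[R]_(m, n)) : linear f -> linear (fun x => (f x)^T).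
Proof. by move=> fl a x y; rewrite fl trmxD trmxZ. Qed.
Lemma linear_fun_N m n (f : E -> 'M[R]_(m, n)) : linear f -> linear (fun x => - f x).
Proof. by move=> fl a x y; rewrite fl opprD scalerN. Qed.
End LinearMaps.

Lemma Ck_on_linear_fun {R : realType} k d m n (f : 'rV[R]_d -> 'M[R]_(m, n)) : linear f -> Ck_on k setT f.
Proof.
move=> fl; pose fL := GRing.isLinear.Build _ _ _ _ f fl.
pose fF : {linear 'rV[R]_d -> 'M[R]_(m, n)} := HB.pack f fL.
exact: (Ck_on_rV_linear k fF).
Qed.

Lemma is_derive_linear_fun {R : realType} d m n (f : 'rV[R]_d -> 'M[R]_(m, n)) x v : linear f ->
  is_derive x v f (f v).
Proof.
move=> fl; pose fL := GRing.isLinear.Build _ _ _ _ f fl.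
pose fF : {linear 'rV[R]_d -> 'M[R]_(m, n)} := HB.pack f fL.
exact: (is_derive_rV_linear fF).
Qed.

Lemma linear_fun_0 {R : realType} d m n (f : 'rV[R]_d -> 'M[R]_(m, n)) : linear f -> f 0 = 0.
Proof.
move=> fl; pose fL := GRing.isLinear.Build _ _ _ _ f fl.
pose fF : {linear 'rV[R]_d -> 'M[R]_(m, n)} := HB.pack f fL.
exact: (linear0 fF).
Qed.

(** * A chart of the quotient with horizontal velocities *)

Section QuotientChart.
Context {R : realType} {p1 p2 r : nat}.
Hypotheses (rp1 : (r <= p1)%N) (rp2 : (r <= p2)%N).
Variables (U : 'M[R]_(p1, r)) (B : 'M[R]_r) (V : 'M[R]_(p2, r)).
Hypotheses (U1 : stiefel U) (B_spd : spd B) (V1 : stiefel V).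
Let P : triple R p1 p2 r := (U, B, V).
Let d := dimM p1 p2 r.

Variables (f1 : {linear 'rV[R]_d -> 'M[R]_(p1 - r, r)}) (f2 : {linear 'rV[R]_d -> 'M[R]_r})
  (f3 : {linear 'rV[R]_d -> 'M[R]_(p2 - r, r)}).
Hypotheses (f_inj : forall x, f1 x = 0 -> f2 x = 0 -> f3 x = 0 -> x = 0).

Let tP : total_space P. Proof. by split. Qed.

Section StiefelCurve.
Context {p : nat}.
Variables (W : 'M[R]_(p, r)) (D : 'rV[R]_d -> 'M[R]_(p - r, r)) (Om : 'rV[R]_d -> 'M[R]_r).
Hypotheses (rp : (r <= p)%N) (W1 : stiefel W) (Dl : linear D) (Oml : linear Om)
  (sOm : forall x, (Om x)^T = - Om x).

(** A skew matrix whose product with [W] is half of perp(W) D + W Om: the transposed term is there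
    for skewness and dies on [W]. The factor 2 in the derivative of [cayley] restores the full
    velocity. *)
Definition rotation_generator x : 'M[R]_p :=
  2^-1 *: (perp W *m D x *m W^T + - (perp W *m D x *m W^T)^T + W *m Om x *m W^T).

Lemma rotation_generator_linear : linear rotation_generator.
Proof.
have h : linear (fun x => perp W *m D x *m W^T).
  exact/linear_fun_mulr/linear_fun_mull.
apply: linear_fun_Z; apply: linear_fun_D; last exact/linear_fun_mulr/linear_fun_mull.
by apply: linear_fun_D => //; exact/linear_fun_N/linear_fun_tr.
Qed.

Lemma rotation_generator_skew x : (rotation_generator x)^T = - rotation_generator x.
Proof.
rewrite /rotation_generator trmxZ !trmxD trmxN trmxK.
have -> : (W *m Om x *m W^T)^T = - (W *m Om x *m W^T).
  by rewrite !trmx_mul trmxK sOm mulNmx mulmxN mulmxA.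
by move: (perp W *m D x *m W^T) (W *m Om x *m W^T) => a b; mx_lra.
Qed.

Definition stiefel_map x := cayley (rotation_generator x) *m W.

Lemma stiefel_mapP x : stiefel (stiefel_map x).
Proof.
rewrite /stiefel /stiefel_map /= trmx_mul mulmxA -(mulmxA W^T).
by rewrite cayley_orthogonal ?mulmx1//; exact: rotation_generator_skew.
Qed.

Lemma stiefel_map0 : stiefel_map 0 = W.
Proof. by rewrite /stiefel_map (linear_fun_0 rotation_generator_linear) cayley0 mul1mx. Qed.

Lemma Ck_on_stiefel_map k : Ck_on k setT stiefel_map.
Proof.
apply: Ck_on_mulmx; [exact: openT| |exact: Ck_on_cst].
apply: Ck_on_cayley; [exact: openT|exact: rotation_generator_skew|].
exact: Ck_on_linear_fun rotation_generator_linear.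
Qed.

Lemma is_derive_stiefel_map u : is_derive 0 u stiefel_map (perp W *m D u + W *m Om u).
Proof.
have [_ WW] := perp_spec W1 rp; have WpW := tr_perp_mul W1 rp.
have Cd : differentiable (fun y => cayley (rotation_generator y)) 0.
  have [H _] := Ck_on_cayley (k := 1) openT rotation_generator_skew
    (Ck_on_linear_fun 1 rotation_generator_linear).
  exact: H.
have := is_derive_mulmxr W (is_derive_cayley rotation_generator_skew
  (linear_fun_0 rotation_generator_linear) Cd (is_derive_linear_fun 0 u rotation_generator_linear)).
move=> H; apply: (is_derive_eq H).
rewrite /rotation_generator scalerA mulfV ?pnatr_eq0// scale1r !mulmxDl mulNmx.
rewrite !trmx_mul trmxK -!mulmxA W1 !mulmx1 WpW !mulmx0 oppr0 addr0.
by [].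
Qed.

End StiefelCurve.

(* A congruence C^T B C, which stays positive definite; its derivative at 0 is sym (f2 u). *)
Definition spd_map x := (1%:M + 2^-1 *: (invmx B *m sym_part (f2 x)))^T *m B *m
  (1%:M + 2^-1 *: (invmx B *m sym_part (f2 x))).

(** Rotations of [U] and [V] and a congruence of [B] stay in the total space. Their joint velocity
    is horizontal, so it is vertical only when it is 0, which gives injectivity modulo the fiber. *)
Lemma chart_q_exists : exists psi, chart_q P psi /\ forall u, 'D_u psi 0 = hpar U V f1 f2 f3 u.
Proof.
have Bu := spd_unit B_spd; have [sB _] := B_spd.
have l1 : linear f1 by exact: linearP.
have l3 : linear f3 by exact: linearP.
have lsk : linear (fun x => skew_part (f2 x)).
  by move=> a x y; rewrite (linearP f2) skew_part_is_linear.
have lskN := linear_fun_N lsk.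
have lsy : linear (fun x => sym_part (f2 x)).
  by move=> a x y; rewrite (linearP f2) sym_part_is_linear.
have lC : linear (fun x => 2^-1 *: (invmx B *m sym_part (f2 x))).
  exact/linear_fun_Z/linear_fun_mull.
have skN x : (- skew_part (f2 x))^T = - - skew_part (f2 x) by rewrite trmxN skew_part_tr.
have sk x : (skew_part (f2 x))^T = - skew_part (f2 x) by rewrite skew_part_tr.
pose C x := 1%:M + 2^-1 *: (invmx B *m sym_part (f2 x)).
have CC k : Ck_on k setT C.
  exact: (Ck_onD openT (Ck_on_cst setT k (1%:M : 'M[R]_r)) (Ck_on_linear_fun k lC)).
have C0 : C 0 = 1%:M by rewrite /C (linear_fun_0 lC) addr0.
have Cd u : is_derive 0 u C (2^-1 *: (invmx B *m sym_part (f2 u))).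
  have := is_deriveD (is_derive_cst (1%:M : 'M[R]_r) 0 u) (is_derive_linear_fun 0 u lC).
  by rewrite add0r.
have SC k : Ck_on k setT spd_map.
  apply: (Ck_on_mulmx openT _ (CC k)); apply: (Ck_on_mulmx openT _ (Ck_on_cst setT k B)).
  exact: (Ck_on_trmx openT (CC k)).
have S0 : spd_map 0 = B by rewrite /spd_map -/(C 0) C0 trmx1 mul1mx mulmx1.
have Sd u : is_derive 0 u spd_map (sym_part (f2 u)).
  have H := is_derive_mulmx (is_derive_mulmx (is_derive_trmx (Cd u)) (is_derive_cst B 0 u)) (Cd u).
  apply: (is_derive_eq H); rewrite mulmx0 addr0 C0 trmx1 mul1mx mulmx1.
  rewrite trmxZ trmx_mul trmx_inv sB sym_part_tr -scalemxAl -scalemxAr.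
  by rewrite mulmxKV// mulKVmx//; mx_lra.
pose psi x : triple R p1 p2 r := (stiefel_map U f1 (fun x => skew_part (f2 x)) x, spd_map x,
  stiefel_map V f3 (fun x => - skew_part (f2 x)) x).
have D u : 'D_u psi 0 = hpar U V f1 f2 f3 u.
  have [_ ->] := is_derive_pair (is_derive_pair (is_derive_stiefel_map rp1 U1 l1 lsk sk u) (Sd u))
    (is_derive_stiefel_map rp2 V1 l3 lskN skN u).
  by rewrite /hpar mulmxN.
exists psi; split=> //; split.
- by rewrite /psi S0 !stiefel_map0.
- apply: (Ck_on_C2_at openT I); apply: (Ck_on_pair openT).
    apply: (Ck_on_pair openT) => //; exact: Ck_on_stiefel_map.
  exact: Ck_on_stiefel_map.
- have Cu : \forall x \near (0 : 'rV[R]_d), C x \in unitmx.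
    by apply: near_unitmx; [exact: (CC 0)|rewrite C0 unitmx1].
  near=> x; split; [exact: stiefel_mapP| |exact: stiefel_mapP].
  by apply: spd_congr => //; near: x.
- move=> u; rewrite D => Vu; apply: (hpar_inj rp1 rp2 U1 V1 f_inj).
  apply: (vert_horizontal0 rp1 rp2 tP _ Vu).
  exists (f1 u), (f3 u), (skew_part (f2 u)); split=> //=; exact: sym_part_tr.
Unshelve. all: by end_near. Qed.

End QuotientChart.

(** * Hessians at critical points *)

Section CriticalHessian.
Context {R : realType}.

(** At a zero of b the difference quotient of a b is a times that of b, so continuity of a suffices;
    a will be an entry of the inverse Gram matrix. *)
Lemma is_derive_mul_vanishing (E : normedModType R) (a b : E -> R) x v c :
  {for x, continuous a} -> b x = 0 -> is_derive x v b c ->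
  is_derive x v (fun y => a y * b y) (a x * c).
Proof.
move=> ac b0 [bd <-].
have H : (fun h => h^-1 *: (((fun y => a y * b y) \o shift x) (h *: v) - a x * b x)) @ 0^'
    --> a x * 'D_v b x.
  have -> : (fun h => h^-1 *: (((fun y => a y * b y) \o shift x) (h *: v) - a x * b x)) =
     (fun h => a (h *: v + x) * (h^-1 *: ((b \o shift x) (h *: v) - b x))).
    apply/funext => h; rewrite /= b0 mulr0 !subr0 /GRing.scale /=; exact: mulrCA.
  apply: cvgM; last exact: bd.
  have lc : (fun h : R => h *: v + x) @ 0^' --> x.
    have c0 : {for (0 : R), continuous (fun t : R => x + t *: v)}.
      exact/differentiable_continuous/differentiable_affine_line.
    have c1 : (fun h : R => h *: v + x) @ (0 : R) --> x.
      have := c0; rewrite /prop_for /continuous_at scale0r addr0.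
      by under eq_fun do rewrite addrC.
    exact: (cvg_comp _ _ (@cvg_within _ (nbhs (0 : R)) _ (fun x => x != 0)) c1).
  exact: (cvg_comp _ _ lc ac).
by split; [apply/cvg_ex; eexists; exact: H | apply/cvg_lim].
Qed.

Lemma continuous_invmx_at (E : normedModType R) n (M : E -> 'M[R]_n) x :
  {for x, continuous M} -> M x \in unitmx -> {for x, continuous (fun y => invmx (M y))}.
Proof.
move=> Mc Mu.
have ic := differentiable_continuous (differentiable_invmx Mu).
exact: (@continuous_comp _ _ _ M (fun N : 'M[R]_n => invmx N) x Mc ic).
Qed.

(* At a critical point the Christoffel symbols multiply a vanishing gradient,
   so only the continuity of the metric matters. *)
Lemma hess_coord_crit d (E : normedModType R) (g : E -> E -> E -> R) (F : E -> R)
    (phi : 'rV[R]_d -> E) (u v : 'rV[R]_d) (c : 'I_d -> R) :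
  {for 0, continuous (gram g phi)} -> gram g phi 0 \in unitmx ->
  (gram g phi 0)^T = gram g phi 0 ->
  (forall l, 'D_(dvec R l) (F \o phi) 0 = 0) ->
  (forall l, is_derive 0 u ('D_(dvec R l) (F \o phi)) (c l)) ->
  hess_coord g F phi u v 0 = \sum_l c l * v 0 l.
Proof.
move=> gc gu gs b0 bd.
have gi := continuous_invmx_at gc gu.
have grad0 : grad_coord g F phi 0 = 0.
  by apply/rowP => k; rewrite !mxE big1// => l _; rewrite b0 mulr0.
have covE : covariant g phi u (grad_coord g F phi) 0 = (\row_l c l) *m (invmx (gram g phi 0)).
  apply/rowP => k; rewrite !mxE [X in _ + X]big1 ?addr0; last first.
    by move=> i _; rewrite big1// => j _; rewrite grad0 mxE mulr0.
  have -> : (fun y => grad_coord g F phi y 0 k) =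
    (fun y => \sum_l invmx (gram g phi y) k l * 'D_(dvec R l) (F \o phi) y).
    by apply/funext => y; rewrite mxE.
  have D l : is_derive (0 : 'rV[R]_d) u (fun y => invmx (gram g phi y) k l * 'D_(dvec R l) (F \o phi) y)
     (invmx (gram g phi 0) k l * c l).
    apply: is_derive_mul_vanishing => //.
    by move: k l; apply/continuous_mx_at.
  have [_ ->] := is_derive_sumf (index_enum _) D.
  apply: eq_bigr => l _; rewrite mxE mulrC; congr (_ * _).
  have sI : (invmx (gram g phi 0))^T = invmx (gram g phi 0) by rewrite trmx_inv gs.
  by rewrite -{1}sI mxE.
rewrite /hess_coord covE mulmxKV// mxE; apply: eq_bigr => l _.
by rewrite !mxE.
Qed.

(** Of the four terms of the second-order Leibniz rule, those with an undifferentiated factor vanish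
    at x. *)
Lemma is_derive2_mulmx_vanishing (E : normedModType R) m n p (A : set E)
    (a : E -> 'M[R]_(m, n)) (q : E -> 'M[R]_(n, p)) x u v :
  open A -> A x -> Ck_on 2 A a -> Ck_on 2 A q -> a x = 0 -> q x = 0 ->
  is_derive x u ('D_v (fun y => a y *m q y))
    ('D_v a x *m 'D_u q x + 'D_u a x *m 'D_v q x).
Proof.
move=> Ao Ax [ad aD] [qd qD] a0 q0.
have Dv : \near x, 'D_v a x *m q x + a x *m 'D_v q x = 'D_v (fun y => a y *m q y) x.
  apply: (near_open_eq Ao) Ax => y Ay.
  have H := is_derive_mulmx (differentiable_is_derive v (ad y Ay)) (differentiable_is_derive v (qd y Ay)).
  by have [_ ->] := H.
apply: near_eq_is_derive Dv _.
have H1 := is_derive_mulmx (differentiable_is_derive u ((aD v).1 x Ax)) (differentiable_is_derive u (qd x Ax)).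
have H2 := is_derive_mulmx (differentiable_is_derive u (ad x Ax)) (differentiable_is_derive u ((qD v).1 x Ax)).
have vanish (b c : 'M[R]_(m, p)) (C : 'M[R]_(m, n)) (D : 'M[R]_(n, p)) :
    (C *m 0 + b) + (c + 0 *m D) = b + c by rewrite mulmx0 mul0mx add0r addr0.
by apply: (is_derive_eq (is_deriveD H1 H2)); rewrite a0 q0; exact: vanish.
Qed.

End CriticalHessian.

(** * Second fundamental form of the fixed-rank manifold *)

Section SecondFundamentalForm.
Context {R : realType} {p1 p2 r : nat}.
Variables (U : 'M[R]_(p1, r)) (B : 'M[R]_r) (V : 'M[R]_(p2, r)).
Hypotheses (U1 : stiefel U) (B_spd : spd B) (V1 : stiefel V).
Let X := U *m B *m V^T.
Let PU : 'M[R]_p1 := 1%:M - U *m U^T.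
Let PV : 'M[R]_p2 := 1%:M - V *m V^T.

(* The normal part of the second derivative of a map into the fixed-rank manifold whose
   velocities at X are xi and eta. *)
Definition second_form (xi eta : 'M[R]_(p1, p2)) : 'M[R]_(p1, p2) :=
  PU *m (eta *m V *m invmx B *m U^T *m xi + xi *m V *m invmx B *m U^T *m eta) *m PV.

(** By the Schur complement identity the normal block of phi is a q, with a = PU phi V and q = (U^T
    phi V)^-1 U^T phi PV. Both factors vanish at [X], so only products of first derivatives
    survive. *)
Lemma second_derivative_normal (E : normedModType R) (phi : E -> 'M[R]_(p1, p2)) x u v :
  C2_at phi x -> phi x = X -> (\forall y \near x, fixed_rank r (phi y)) ->
  PU *m 'D_u ('D_v phi) x *m PV = second_form ('D_u phi x) ('D_v phi x).
Proof.
move=> /C2_at_Ck_on[A0 [A0o A0x phiC0]] px pr.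
have pd0 : differentiable phi x by exact: phiC0.1.
have pc := differentiable_continuous pd0.
have H := near_tangent_rank U1 B_spd V1 pc px pr.
(* [Ck_on] refers to an open set: the one on which phi is C^2 is cut down to where the Schur
   complement identity also holds. *)
pose A := A0 `&` interior [set y | U^T *m phi y *m V \in unitmx /\
   PU *m phi y *m PV = PU *m phi y *m V *m (invmx (U^T *m phi y *m V) *m (U^T *m phi y *m PV))].
have Ao : open A by apply: openI => //; exact: open_interior.
have Ax : A x by split=> //; exact: H.
have AP y : A y -> U^T *m phi y *m V \in unitmx /\
   PU *m phi y *m PV = PU *m phi y *m V *m (invmx (U^T *m phi y *m V) *m (U^T *m phi y *m PV)).
  by move=> [_ /interior_subset].
have phiC : Ck_on 2 A phi.
  move: phiC0 => [h1 h2]; split=> [y [] /h1//|w].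
  by have [h3 h4] := h2 w; split=> [y [] /h3//|w' y [Ay _]]; exact: h4.
have ck m n (C : 'M[R]_(m, n)) := Ck_on_cst (E := E) A 2 C.
have mul m n p (F : _ -> 'M[R]_(m, n)) (G : _ -> 'M[R]_(n, p)) := @Ck_on_mulmx _ _ _ Ao 2 m n p F G.
have aC : Ck_on 2 A (fun y => PU *m phi y *m V).
  exact: (mul _ _ _ _ _ (mul _ _ _ _ _ (ck _ _ PU) phiC) (ck _ _ V)).
have cC : Ck_on 2 A (fun y => U^T *m phi y *m PV).
  exact: (mul _ _ _ _ _ (mul _ _ _ _ _ (ck _ _ U^T) phiC) (ck _ _ PV)).
have KC : Ck_on 2 A (fun y => U^T *m phi y *m V).
  exact: (mul _ _ _ _ _ (mul _ _ _ _ _ (ck _ _ U^T) phiC) (ck _ _ V)).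
have MC : Ck_on 2 A (fun y => invmx (U^T *m phi y *m V)).
  by apply: Ck_on_invmx => // y /AP[].
have qC := mul _ _ _ _ _ MC cC.
have a0 : PU *m phi x *m V = 0 by rewrite px /PU left_perp_product// mul0mx.
have c0 : U^T *m phi x *m PV = 0 by rewrite px -mulmxA /PV right_perp_product// mulmx0.
have q0 : invmx (U^T *m phi x *m V) *m (U^T *m phi x *m PV) = 0 by rewrite c0 mulmx0.
have D2 := is_derive2_mulmx_vanishing u v Ao Ax aC qC a0 q0.
have lin w y : A y -> is_derive y w phi ('D_w phi y).
  by move=> Ay; apply: differentiable_is_derive; exact: phiC.1.
have Da w : 'D_w (fun y => PU *m phi y *m V) x = PU *m 'D_w phi x *m V.
  by have [_ ->] := is_derive_mulmxr V (is_derive_mulmxl PU (lin w x Ax)).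
(* The derivative of the inverse comes multiplied by U^T phi PV, which is 0 at x. *)
have Dq w : 'D_w (fun y => invmx (U^T *m phi y *m V) *m (U^T *m phi y *m PV)) x =
    invmx B *m (U^T *m 'D_w phi x *m PV).
  have h1 := is_derive_mulmxr PV (is_derive_mulmxl U^T (lin w x Ax)).
  have h2 := differentiable_is_derive w (MC.1 x Ax).
  have [_ ->] := is_derive_mulmx h2 h1.
  by rewrite c0 mulmx0 add0r px compress_product.
have n1 : \near x, 'D_v (fun y => PU *m phi y *m V *m
     (invmx (U^T *m phi y *m V) *m (U^T *m phi y *m PV))) x = PU *m 'D_v phi x *m PV.
  apply: (near_open_eq Ao) Ax => y Ay.
  have [_ <-] := is_derive_mulmxr PV (is_derive_mulmxl PU (lin v y Ay)).
  apply: near_eq_derive; apply: (near_open_eq Ao) Ay => z Az.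
  by have [_ <-] := AP z Az.
have D3 := near_eq_is_derive n1 D2.
have D4 := is_derive_mulmxr PV (is_derive_mulmxl PU (differentiable_is_derive u ((phiC.2 v).1 x Ax))).
rewrite -(is_derive_unique D3 D4) !Da !Dq; move: ('D_u phi x) ('D_v phi x) => xi eta.
by rewrite /second_form mulmxDr mulmxDl !mulmxA.
Qed.

Variable (f : 'M[R]_(p1, p2) -> R).
Hypotheses (fC : C2 f)
  (crit : forall xi, PU *m xi *m PV = 0 -> 'D_xi f X = 0).

(** The Euclidean Hessian plus the derivative of [f] along the second fundamental form: at a
    critical point, the common value of the Hessian in all charts. *)
Definition hess_val xi eta : R := 'D_xi ('D_eta f) X + 'D_(second_form xi eta) f X.

Let fd Y : differentiable f Y. Proof. by have /nbhs_singleton[] := fC Y. Qed.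
Let fd2 Y w : differentiable ('D_w f) Y. Proof. by have /nbhs_singleton[] := fC Y. Qed.

(** What remains of zeta after removing its normal part is tangent, and [f] is critical along
    tangent vectors. *)
Lemma derive_normal_part zeta : 'D_zeta f X = 'D_(PU *m zeta *m PV) f X.
Proof.
have PU2 : PU *m PU = PU.
  by rewrite /PU mulmxBr mulmx1 mulmxBl mul1mx !mulmxA -(mulmxA U U^T) U1 mulmx1 subrr subr0.
have PV2 : PV *m PV = PV.
  by rewrite /PV mulmxBr mulmx1 mulmxBl mul1mx !mulmxA -(mulmxA V V^T) V1 mulmx1 subrr subr0.
have z : PU *m (zeta - PU *m zeta *m PV) *m PV = 0.
  move: PU PV PU2 PV2 => a b a2 b2.
  by rewrite mulmxBr mulmxBl !mulmxA a2 -[X in _ - X]mulmxA b2 subrr.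
have := derive_lin_dir 1 (PU *m zeta *m PV) (zeta - PU *m zeta *m PV) (fd X).
by rewrite (crit z) addr0 !scale1r addrC subrK.
Qed.

Lemma is_derive2_rank_curve (E : normedModType R) (phi : E -> 'M[R]_(p1, p2)) x u v :
  C2_at phi x -> phi x = X -> (\forall y \near x, fixed_rank r (phi y)) ->
  is_derive x u ('D_v (f \o phi)) (hess_val ('D_u phi x) ('D_v phi x)).
Proof.
move=> pC px pr; have [A [Ao Ax pCk]] := C2_at_Ck_on pC.
have H := derive2_comp u v fC Ao Ax pCk.
apply: (is_derive_eq H); rewrite px /hess_val; congr (_ + _).
by rewrite derive_normal_part second_derivative_normal.
Qed.

Lemma hess_val_sym xi eta : hess_val xi eta = hess_val eta xi.
Proof.
have [A [Ao Ax fCk]] := C2_at_Ck_on (fC X).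
have e1 := derive2_sym xi eta Ao Ax fCk.
have e2 : second_form xi eta = second_form eta xi by rewrite /second_form addrC.
by rewrite /hess_val e2; exact: (congr1 (fun t => t + 'D_(second_form eta xi) f X) e1).
Qed.

Lemma hess_val_linear xi a eta zeta :
  hess_val xi (a *: eta + zeta) = a * hess_val xi eta + hess_val xi zeta.
Proof.
have e1 : 'D_xi ('D_(a *: eta + zeta) f) X = a * 'D_xi ('D_eta f) X + 'D_xi ('D_zeta f) X.
  have -> : 'D_(a *: eta + zeta) f = a \*: 'D_eta f + 'D_zeta f.
    by apply/funext => Y; rewrite derive_lin_dir.
  by have [_ ->] := is_deriveD (is_deriveZ a (differentiable_is_derive xi (fd2 X eta)))
    (differentiable_is_derive xi (fd2 X zeta)).
have e2 : second_form xi (a *: eta + zeta) = a *: second_form xi eta + second_form xi zeta.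
  rewrite /second_form; move: PU PV (invmx B) => b c iB.
  by rewrite !(mulmxDl, mulmxDr) -!scalemxAl -!scalemxAr -!scalemxAl scalerDr addrACA.
rewrite /hess_val e1 e2 derive_lin_dir// mulrDr; exact: addrACA.
Qed.

Lemma hess_val_sum xi (I : Type) (s : seq I) (c : I -> R) (w : I -> 'M[R]_(p1, p2)) :
  hess_val xi (\sum_(i <- s) c i *: w i) = \sum_(i <- s) c i * hess_val xi (w i).
Proof.
have h0 : hess_val xi 0 = 0.
  have := hess_val_linear xi 0 0 0; rewrite scaler0 addr0 mul0r add0r.
  have := hess_val_linear xi 1 0 0; rewrite scaler0 addr0 mul1r => /eqP.
  by rewrite eq_sym -subr_eq0 addrK => /eqP.
elim: s => [|i s IH]; first by rewrite !big_nil.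
by rewrite !big_cons hess_val_linear IH.
Qed.

End SecondFundamentalForm.

Section BilinearForms.
Context {R : realType} {E : lmodType R}.
Variable g : E -> E -> R.
Hypotheses (g_linear : forall a x y z, g (a *: x + y) z = a * g x z + g y z)
  (g_sym : forall x y, g x y = g y x).

Lemma bilin0l z : g 0 z = 0.
Proof.
have := g_linear 1 0 0 z; rewrite scaler0 addr0 mul1r => /eqP.
by rewrite eq_sym -subr_eq0 addrK => /eqP.
Qed.

Lemma bilin_suml (I : Type) (s : seq I) (c : I -> R) (w : I -> E) z :
  g (\sum_(i <- s) c i *: w i) z = \sum_(i <- s) c i * g (w i) z.
Proof.
elim: s => [|i s IH]; first by rewrite !big_nil bilin0l.
by rewrite !big_cons g_linear IH.
Qed.

Lemma bilin_sumr (I : Type) (s : seq I) (c : I -> R) (w : I -> E) z :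
  g z (\sum_(i <- s) c i *: w i) = \sum_(i <- s) c i * g z (w i).
Proof. by rewrite g_sym bilin_suml; apply: eq_bigr => i _; rewrite g_sym. Qed.

Lemma bilin_mulmx n (w : 'I_n -> E) (c e : 'rV[R]_n) :
  (c *m (\matrix_(i, j) g (w i) (w j)) *m e^T) 0 0 =
  g (\sum_i c 0 i *: w i) (\sum_j e 0 j *: w j).
Proof.
rewrite bilin_sumr mxE; apply: eq_bigr => j _; rewrite bilin_suml !mxE mulrC.
by congr (_ * _); apply: eq_bigr => i _; rewrite !mxE.
Qed.

Lemma gram_unit n (w : 'I_n -> E) :
  (forall c : 'rV[R]_n, g (\sum_i c 0 i *: w i) (\sum_i c 0 i *: w i) = 0 -> c = 0) ->
  \matrix_(i, j) g (w i) (w j) \in unitmx.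
Proof.
move=> q0; rewrite -row_free_unit -kermx_eq0; apply/negPn/negP.
move=> /rowV0Pn[c /sub_kermxP cG /eqP]; apply; apply: q0.
by rewrite -bilin_mulmx cG mul0mx mxE.
Qed.

End BilinearForms.

Lemma inner_linear {R : realType} m n a (x y z : 'M[R]_(m, n)) :
  inner (a *: x + y) z = a * inner x z + inner y z.
Proof. by rewrite innerDl innerZl. Qed.

(** * The Hessian on the embedded side *)

Section HessValues.
Context {R : realType} {p1 p2 r : nat}.
Hypotheses (rp1 : (r <= p1)%N) (rp2 : (r <= p2)%N).
Variables (U : 'M[R]_(p1, r)) (B : 'M[R]_r) (V : 'M[R]_(p2, r)).
Hypotheses (U1 : stiefel U) (B_spd : spd B) (V1 : stiefel V).
Let X := U *m B *m V^T.
Let P : triple R p1 p2 r := (U, B, V).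
Let d := dimM p1 p2 r.
Variable (f : 'M[R]_(p1, p2) -> R).
Hypotheses (fC : C2 f)
  (crit : forall xi, (1%:M - U *m U^T) *m xi *m (1%:M - V *m V^T) = 0 -> 'D_xi f X = 0).

Let fd Y : differentiable f Y. Proof. by have /nbhs_singleton[] := fC Y. Qed.

Lemma dimM_split : d = ((p1 - r + (r + (p2 - r))) * r)%N.
Proof. by rewrite /d /dimM subnKC// addnC -addnBA// addnC. Qed.

Lemma Ck_on_inner (E : normedModType R) k (A : set E) m n (M N : E -> 'M[R]_(m, n)) : open A ->
  Ck_on k A M -> Ck_on k A N -> Ck_on k A (fun x => inner (M x) (N x)).
Proof.
move=> Ao /(Ck_on_mx Ao) MC /(Ck_on_mx Ao) NC.
apply: (@Ck_on_eq _ _ _ Ao _ _ (fun x => \sum_i \sum_j M x i j * N x i j)).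
  by move=> x _; rewrite innerE.
by apply: Ck_on_sum => // i; apply: Ck_on_sum => // j; apply: Ck_onM.
Qed.

(** Every chart yields [hess_val], and [chart_e_exists] provides one whose velocities reach xi and
    eta; the set of candidates is therefore a singleton. *)
Lemma hess_eE xi eta : TMe r X xi -> TMe r X eta ->
  hess_e r f X xi eta = hess_val U B V f xi eta.
Proof.
move=> Txi Teta.
have key (phi : 'rV[R]_d -> 'M[R]_(p1, p2)) u v : chart_e X phi -> 'D_u phi 0 = xi -> 'D_v phi 0 = eta ->
    hess_coord (fun=> @inner R p1 p2) f phi u v 0 = hess_val U B V f xi eta.
  move=> [px pC pr pinj] <- <-.
  have [A [Ao Ax pCk]] := C2_at_Ck_on pC; have pd := pCk.1 0 Ax.
  have gE x i j : gram (fun=> @inner R p1 p2) phi x i j = inner ('D_(dvec R i) phi x) ('D_(dvec R j) phi x).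
    by rewrite mxE.
  have H1 : {for 0, continuous (gram (fun=> @inner R p1 p2) phi)}.
    suff H : Ck_on 0 A (gram (fun=> @inner R p1 p2) phi) by exact: H.
    apply/Ck_on_mx => // i j.
    apply: (@Ck_on_eq _ _ _ Ao _ _ (fun x => inner ('D_(dvec R i) phi x) ('D_(dvec R j) phi x))).
      by move=> y _; rewrite gE.
    have D1C w : Ck_on 0 A ('D_w phi) := Ck_onS (k := 0) (pCk.2 w).
    exact: (Ck_on_inner Ao (D1C _) (D1C _)).
  have H2 : gram (fun=> @inner R p1 p2) phi 0 \in unitmx.
    apply: (gram_unit (@inner_linear R p1 p2) (@innerC R p1 p2)) => c /inner_eq0.
    by rewrite -derive_sum_dir// => /pinj; rewrite -row_sum_delta.
  have H3 : (gram (fun=> @inner R p1 p2) phi 0)^T = gram (fun=> @inner R p1 p2) phi 0.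
    by apply/matrixP => i j; rewrite [LHS]mxE (gE 0 j i) (gE 0 i j); exact: innerC.
  have H4 l : 'D_(dvec R l) (f \o phi) 0 = 0.
    have [_ ->] := is_derive_comp_diff (dvec R l) pd (fd (phi 0)).
    rewrite px; apply: crit; apply: (TMe_sub U1 B_spd V1).
    by rewrite -/X -px; apply: tangent_of_map.
  have H5 l := is_derive2_rank_curve U1 B_spd V1 fC crit u (dvec R l) pC px pr.
  rewrite (hess_coord_crit v H1 H2 H3 H4 H5).
  rewrite {2}(row_sum_delta v) derive_sum_dir// hess_val_sum//.
  by apply: eq_bigr => l _; rewrite mulrC.
have [f1 [f2 [f3 [f_inj f_surj]]]] := @stacked_coordinates R d (p1 - r) r (p2 - r) r dimM_split.
have [phi [pC pD]] := chart_e_exists rp1 rp2 U1 B_spd V1 f_inj.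
have [u xiE] := (TMe_tpar rp1 rp2 U1 B_spd V1 f_surj xi).1 Txi.
have [v etaE] := (TMe_tpar rp1 rp2 U1 B_spd V1 f_surj eta).1 Teta.
apply: xget_unique.
  exists phi, u, v; split=> //; rewrite ?pD//.
  by apply/esym/key; rewrite ?pD.
by move=> h [phi' [u' [v' [pC' h1 h2 ->]]]]; exact: key.
Qed.

End HessValues.

(** * The quotient metric and the Hessian on the quotient side *)

Section QuotientMetric.
Context {R : realType} {p1 p2 r : nat}.
Hypotheses (r_ge1 : (1 <= r)%N) (rp1 : (r <= p1)%N) (rp2 : (r <= p2)%N).
Implicit Types (P theta eta : triple R p1 p2 r).

Lemma spd_sigma (U : 'M[R]_(p1, r)) (B : 'M[R]_r) (V : 'M[R]_(p2, r)) :
  total_space (U, B, V) -> let X := U *m B *m V^T in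
  exists (Q : 'M[R]_r) (d : 'rV[R]_r), [/\ Q *m Q^T = 1%:M, Q *m B *m Q^T = diag_mx d,
    0 < sigma r X, forall i, sigma r X <= d 0 i & forall i, d 0 i <= sigma 1 X].
Proof.
move=> [/= U1 pB V1]; have [Q [d [Q1 QB ds d0]]] := spd_spectral pB.
have s := sigma_diag U1 pB V1 rp2 Q1 QB ds d0; have /sorted_diagP dm := ds.
exists Q, d; have rr : (r.-1 < r)%N by rewrite prednK.
have sr : sigma r (U *m B *m V^T) = d 0 (Ordinal rr) by rewrite -s /= prednK.
have s1 : sigma 1 (U *m B *m V^T) = d 0 (Ordinal r_ge1) by rewrite -s.
split=> // [|i|i]; rewrite ?sr ?s1 ?d0//; apply: dm => //=.
by rewrite -ltnS prednK.
Qed.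

(** The hypothesis [<= 0] packs nonnegativity and definiteness into one implication, the form that
    [form_mx_spd] asks for. *)
Lemma gbar_eq0 P theta : total_space P -> theta.1.2^T = theta.1.2 ->
  gbar P theta theta <= 0 -> theta = 0.
Proof.
move: P theta => [[U B] V] [[tU tB] tV] tP /= sB.
have [Q [d [Q1 QB lo0 dlo dhi]]] := spd_sigma tP.
have /andP[_ Hhi] := affine_metric_bounds Q1 QB lo0 dlo dhi sB.
have hi0 : 0 < sigma 1 (U *m B *m V^T).
  exact: (lt_le_trans lo0 (le_trans (dlo (Ordinal r_ge1)) (dhi (Ordinal r_ge1)))).
rewrite /gbar /=; set g := \tr (invmx B *m _ *m _ *m _) in Hhi *.
have g0 : 0 <= g.
  have : 0 <= sigma 1 (U *m B *m V^T) ^+ 2 * g by apply: le_trans Hhi; exact: inner_ge0.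
  by rewrite pmulr_rge0// exprn_gt0.
rewrite -!/(inner _ _) => H.
have := inner_ge0 tU; have := inner_ge0 tV => iV iU.
have hU : inner tU tU = 0 by lra.
have hV : inner tV tV = 0 by lra.
have hg : g <= 0 by lra.
rewrite (inner_eq0 hU) (inner_eq0 hV).
by rewrite (affine_metric_eq0 Q1 QB lo0 dlo dhi sB hg).
Qed.

Lemma gbar_sym P theta eta : gbar P theta eta = gbar P eta theta.
Proof.
rewrite /gbar -!/(inner _ _) (innerC theta.1.1) (innerC theta.2); congr (_ + _ + _).
by rewrite -(mulmxA (_ *m theta.1.2)) mxtrace_mulC !mulmxA.
Qed.

Lemma gbar_linear P a x y z : gbar P (a *: x + y) z = a * gbar P x z + gbar P y z.
Proof.
rewrite /gbar /= -!/(inner _ _) !inner_linear !(mulmxDl, mulmxDr) -!(scalemxAl, scalemxAr).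
rewrite mxtraceD mxtraceZ; ring.
Qed.

(** Closed form of [hlift], meaningful for every eta: it is linear in eta and its regularity in P
    can be checked term by term. *)
Definition hlift_form P eta := eta + vert P (vertical_correction P eta).

Lemma hlift_form_linear P a x y : hlift_form P (a *: x + y) = a *: hlift_form P x + hlift_form P y.
Proof.
have hc : vertical_correction P (a *: x + y) = a *: vertical_correction P x + vertical_correction P y.
  rewrite /vertical_correction /= !mulmxDr -!scalemxAr.
  by move: (_ *m x.1.1) (_ *m x.2) (_ *m y.1.1) (_ *m y.2) => b c e k;
     apply/matrixP => i j; rewrite !mxE; ring.
have vl : vert P (a *: vertical_correction P x + vertical_correction P y) = a *: vert P (vertical_correction P x) + vert P (vertical_correction P y).
  move: (vertical_correction P x) (vertical_correction P y) => b c; rewrite /vert !(mulmxDr, mulmxDl) -!scalemxAr -!scalemxAl.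
  by congr (_, _, _); rewrite /= scalerBr opprD addrACA.
by rewrite /hlift_form hc vl scalerDr addrACA.
Qed.

Lemma near_total_tangent (E : normedModType R) (psi : E -> triple R p1 p2 r) x u eta :
  (\forall y \near x, total_space (psi y)) -> is_derive x u psi eta ->
  tangent_total (psi x) eta.
Proof.
move=> nT /is_derive_triple[d1 d2 d3].
have n1 : \forall y \near x, (psi y).1.1^T *m (psi y).1.1 = cst 1%:M y.
  by move: nT; apply: filterS => y [].
have n2 : \forall y \near x, (psi y).1.2^T = (psi y).1.2.
  by move: nT; apply: filterS => y [_ []].
have n3 : \forall y \near x, (psi y).2^T *m (psi y).2 = cst 1%:M y.
  by move: nT; apply: filterS => y [].
split.
- have := near_is_derive_eq n1 (is_derive_mulmx (is_derive_trmx d1) d1) (is_derive_cst _ _ _).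
  by rewrite trmx_mul trmxK => /eqP; rewrite addr_eq0 => /eqP.
- exact: (near_is_derive_eq n2 (is_derive_trmx d2) d2).
- have := near_is_derive_eq n3 (is_derive_mulmx (is_derive_trmx d3) d3) (is_derive_cst _ _ _).
  by rewrite trmx_mul trmxK => /eqP; rewrite addr_eq0 => /eqP.
Qed.

Lemma is_derive_product (E : normedModType R) (psi : E -> triple R p1 p2 r) x u eta :
  is_derive x u psi eta ->
  is_derive x u (fun y => (psi y).1.1 *m (psi y).1.2 *m (psi y).2^T) (Lmap (psi x) eta).
Proof.
move=> /is_derive_triple[d1 d2 d3].
apply: (is_derive_eq (is_derive_mulmx (is_derive_mulmx d1 d2) (is_derive_trmx d3))).
by rewrite mulmxDl.
Qed.

Section Regularity.
Context {E : normedModType R} (A : set E) (k : nat).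
Hypothesis Ao : open A.

Lemma Ck_onZ m n a (M : E -> 'M[R]_(m, n)) : Ck_on k A M -> Ck_on k A (fun y => a *: M y).
Proof.
move=> /(Ck_on_mx Ao) MC; apply/(Ck_on_mx Ao) => i j.
apply: (@Ck_on_eq _ _ _ Ao _ _ (fun y => cst a y * M y i j)); last first.
  by apply: (Ck_onM Ao) => //; exact: Ck_on_cst.
by move=> y _; rewrite [RHS]mxE.
Qed.

Lemma Ck_onN m n (M : E -> 'M[R]_(m, n)) : Ck_on k A M -> Ck_on k A (fun y => - M y).
Proof. by move=> /(Ck_onZ (-1)); apply: (Ck_on_eq Ao) => y _; rewrite scaleN1r. Qed.

Lemma Ck_on_tr n (M : E -> 'M[R]_n) : Ck_on k A M -> Ck_on k A (fun y => \tr (M y)).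
Proof. by move=> /(Ck_on_mx Ao) MC; apply: (Ck_on_sum Ao) => i. Qed.

Lemma Ck_on_triple (psi : E -> triple R p1 p2 r) : Ck_on k A psi ->
  [/\ Ck_on k A (fun y => (psi y).1.1), Ck_on k A (fun y => (psi y).1.2)
    & Ck_on k A (fun y => (psi y).2)].
Proof.
move=> pC; have c1 := Ck_on_linear Ao (L := fst) (@fst_is_cont R _ _) pC.
split; last exact: (Ck_on_linear Ao (L := snd) (@snd_is_cont R _ _) pC).
  exact: (Ck_on_linear Ao (L := fst) (@fst_is_cont R _ _) c1).
exact: (Ck_on_linear Ao (L := snd) (@snd_is_cont R _ _) c1).
Qed.

Lemma Ck_on_gbar_hlift_form (psi xi eta : E -> triple R p1 p2 r) :
  (forall y, A y -> (psi y).1.2 \in unitmx) ->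
  Ck_on k A psi -> Ck_on k A xi -> Ck_on k A eta ->
  Ck_on k A (fun y => gbar (psi y) (hlift_form (psi y) (xi y)) (hlift_form (psi y) (eta y))).
Proof.
move=> Bu /Ck_on_triple[UC BC VC] xC eC.
have mul m n p (F : _ -> 'M[R]_(m, n)) (G : _ -> 'M[R]_(n, p)) := @Ck_on_mulmx _ _ _ Ao k m n p F G.
have tr m n (F : _ -> 'M[R]_(m, n)) := @Ck_on_trmx _ _ _ Ao k m n F.
have iC := Ck_on_invmx Ao Bu BC.
have hlC z : Ck_on k A z -> [/\ Ck_on k A (fun y => (hlift_form (psi y) (z y)).1.1),
    Ck_on k A (fun y => (hlift_form (psi y) (z y)).1.2) & Ck_on k A (fun y => (hlift_form (psi y) (z y)).2)].
  move=> /Ck_on_triple[z1 z2 z3].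
  have hC : Ck_on k A (fun y => vertical_correction (psi y) (z y)).
    apply: Ck_onN; apply: Ck_onZ; apply: (Ck_onD Ao).
      exact: (mul _ _ _ _ _ (tr _ _ _ UC) z1).
    exact: (mul _ _ _ _ _ (tr _ _ _ VC) z3).
  split; apply: (Ck_onD Ao) => //; [exact: (mul _ _ _ _ _ UC hC)| |exact: (mul _ _ _ _ _ VC hC)].
  apply: (Ck_onD Ao); first exact: (mul _ _ _ _ _ BC hC).
  by apply: Ck_onN; exact: (mul _ _ _ _ _ hC BC).
have [x1 x2 x3] := hlC _ xC; have [e1 e2 e3] := hlC _ eC.
apply: (Ck_onD Ao); last exact: (Ck_on_inner Ao x3 e3).
apply: (Ck_onD Ao); first exact: (Ck_on_inner Ao x1 e1).
by apply: Ck_on_tr; exact: (mul _ _ _ _ _ (mul _ _ _ _ _ (mul _ _ _ _ _ iC x2) iC) e2).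
Qed.

End Regularity.

Variables (U : 'M[R]_(p1, r)) (B : 'M[R]_r) (V : 'M[R]_(p2, r)).
Hypotheses (U1 : stiefel U) (B_spd : spd B) (V1 : stiefel V).
Let X := U *m B *m V^T.
Let P : triple R p1 p2 r := (U, B, V).
Let d := dimM p1 p2 r.
Variable (f : 'M[R]_(p1, p2) -> R).
Hypotheses (fC : C2 f)
  (crit : forall xi, (1%:M - U *m U^T) *m xi *m (1%:M - V *m V^T) = 0 -> 'D_xi f X = 0).

Let fd Y : differentiable f Y. Proof. by have /nbhs_singleton[] := fC Y. Qed.
Let tP : total_space P. Proof. by split. Qed.

Lemma Lmap_normal eta : (1%:M - U *m U^T) *m Lmap P eta *m (1%:M - V *m V^T) = 0.
Proof.
have UP : (1%:M - U *m U^T) *m U = 0 by rewrite mulmxBl mul1mx -mulmxA U1 mulmx1 subrr.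
have VP : V^T *m (1%:M - V *m V^T) = 0 by rewrite mulmxBr mulmx1 mulmxA V1 mul1mx subrr.
rewrite /Lmap /=; move: (1%:M - U *m U^T) (1%:M - V *m V^T) UP VP => a b UP VP.
by rewrite !mulmxDr !mulmxDl -!mulmxA VP !mulmx0 !(mulmxA a U) UP !mul0mx !addr0.
Qed.

(** The product Phi of the components of psi maps into rank r matrices and [hfun f \o psi] is
    [f \o Phi], so the second derivatives are those of the embedded side. Of the quotient metric it
    remains to know that its Gram matrix is continuous, symmetric and invertible. *)
Lemma hess_coord_q (psi : 'rV[R]_d -> triple R p1 p2 r) u v : chart_q P psi ->
  hess_coord (@gquot R p1 p2 r) (hfun f) psi u v 0 =
  hess_val U B V f (Lmap P ('D_u psi 0)) (Lmap P ('D_v psi 0)).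
Proof.
move=> [px pC pT pinj].
have [A0 [A0o A0x pCk0]] := C2_at_Ck_on pC; have pd := pCk0.1 0 A0x.
pose A := A0 `&` interior [set y | total_space (psi y)].
have Ao : open A by apply: openI => //; exact: open_interior.
have Ax : A 0 by split.
have AT y : A y -> total_space (psi y) by move=> [_ /interior_subset].
have pCk : Ck_on 2 A psi.
  move: pCk0 => [h1 h2]; split=> [y [] /h1//|w].
  by have [h3 h4] := h2 w; split=> [y [] /h3//|w' y [Ay _]]; exact: h4.
pose Phi y := (psi y).1.1 *m (psi y).1.2 *m (psi y).2^T.
have [UC BC VC] := Ck_on_triple Ao pCk.
have PhiC : Ck_on 2 A Phi.
  exact: (Ck_on_mulmx Ao (Ck_on_mulmx Ao UC BC) (Ck_on_trmx Ao VC)).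
have Phix : Phi 0 = X by rewrite /Phi px.
have PhiD w : 'D_w Phi 0 = Lmap P ('D_w psi 0).
  by have [_ ->] := is_derive_product (differentiable_is_derive w pd); rewrite px.
have Phir : \forall y \near (0 : 'rV[R]_d), fixed_rank r (Phi y).
  move: pT; apply: filterS => y [y1 y2 y3]; apply/eqP; rewrite eqn_leq.
  rewrite (leq_trans (mxrankM_maxl _ _) (rank_leq_col _)) /=.
  by apply: (@rank_unit_ge _ _ _ _ (psi y).1.1 (psi y).2); rewrite compress_product// spd_unit.
have tw y w : A y -> tangent_total (psi y) ('D_w psi y).
  move=> Ay; apply: (near_total_tangent _ (differentiable_is_derive w (pCk.1 y Ay))).
  by case: Ay.
have gE y i j : A y -> gram (@gquot R p1 p2 r) psi y i j =
    gbar (psi y) (hlift_form (psi y) ('D_(dvec R i) psi y)) (hlift_form (psi y) ('D_(dvec R j) psi y)).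
  move=> Ay; rewrite mxE /gquot.
  exact: (congr2 (gbar (psi y)) (hliftE rp1 rp2 (AT y Ay) (tw y (dvec R i) Ay))
    (hliftE rp1 rp2 (AT y Ay) (tw y (dvec R j) Ay))).
have H1 : {for 0, continuous (gram (@gquot R p1 p2 r) psi)}.
  suff H : Ck_on 0 A (gram (@gquot R p1 p2 r) psi) by exact: H.
  apply/Ck_on_mx => // i j.
  apply: (@Ck_on_eq _ _ _ Ao _ _ _ _ (fun y Ay => esym (gE y i j Ay))).
  have D1C w : Ck_on 0 A ('D_w psi) := Ck_onS (k := 0) (pCk.2 w).
  have Bu y : A y -> (psi y).1.2 \in unitmx by move=> /AT[_ /spd_unit].
  exact: (Ck_on_gbar_hlift_form Ao Bu (Ck_onS (Ck_onS pCk)) (D1C _) (D1C _)).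
pose g a b := gbar P (hlift_form P a) (hlift_form P b).
have gl a x y z : g (a *: x + y) z = a * g x z + g y z.
  by rewrite /g hlift_form_linear gbar_linear.
have gs x y : g x y = g y x by exact: gbar_sym.
have gramE : gram (@gquot R p1 p2 r) psi 0 =
    \matrix_(i, j) g ('D_(dvec R i) psi 0) ('D_(dvec R j) psi 0).
  by apply/matrixP => i j; rewrite gE// [RHS]mxE /g px.
(* A combination of chart velocities whose lift has length 0 is vertical, hence trivial by the
   injectivity of the chart modulo the fiber. *)
have H2 : gram (@gquot R p1 p2 r) psi 0 \in unitmx.
  rewrite gramE; apply: (gram_unit gl gs) => c; rewrite -derive_sum_dir// -row_sum_delta.
  have Tc := tw 0 c Ax; rewrite px in Tc.
  rewrite /g /hlift_form -!(hliftE rp1 rp2 tP Tc) => g0; apply: pinj.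
  apply: (hlift_eq0 rp1 rp2 tP Tc).
  have [/= hs _ _] := (horizontalP rp1 rp2 _ tP).1 (hlift_horizontal rp1 rp2 tP Tc).
  by apply: (gbar_eq0 tP hs); rewrite g0.
have H3 : (gram (@gquot R p1 p2 r) psi 0)^T = gram (@gquot R p1 p2 r) psi 0.
  by rewrite gramE; apply/matrixP => i j; rewrite !mxE; exact: gs.
have FE : hfun f \o psi = f \o Phi by [].
have Phid := PhiC.1 0 Ax.
have H4 l : 'D_(dvec R l) (hfun f \o psi) 0 = 0.
  rewrite FE; have [_ ->] := is_derive_comp_diff (dvec R l) Phid (fd (Phi 0)).
  by rewrite Phix; apply: crit; rewrite PhiD; exact: Lmap_normal.
have H5 l : is_derive 0 u ('D_(dvec R l) (hfun f \o psi))
    (hess_val U B V f ('D_u Phi 0) ('D_(dvec R l) Phi 0)).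
  by rewrite FE; apply: is_derive2_rank_curve => //; exact: (Ck_on_C2_at Ao Ax PhiC).
have E1 := congr2 (hess_val U B V f) (PhiD u) (PhiD v).
apply: etrans E1; apply: (etrans (hess_coord_crit v H1 H2 H3 H4 H5)).
rewrite {2}(row_sum_delta v) derive_sum_dir// hess_val_sum//.
by apply: eq_bigr => l _; rewrite mulrC.
Qed.

Lemma hess_qE theta eta : horizontal P theta -> horizontal P eta ->
  hess_q f P theta eta = hess_val U B V f (Lmap P theta) (Lmap P eta).
Proof.
move=> Ht He.
(* An arbitrary chart prescribes only the lifts of its velocities; L does not see the vertical
   difference. *)
have key (psi : 'rV[R]_d -> triple R p1 p2 r) u : chart_q P psi ->
    Lmap P (hlift P ('D_u psi 0)) = Lmap P ('D_u psi 0).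
  move=> [px pC pT _]; apply: (Lmap_hlift rp1 rp2 tP).
  have /nbhs_singleton[pd _ _] := pC.
  by have := near_total_tangent pT (differentiable_is_derive u pd); rewrite px.
have [f1 [f2 [f3 [f_inj f_surj]]]] := @stacked_coordinates R d (p1 - r) r (p2 - r) r (dimM_split rp1 rp2).
have [psi [pC pD]] := chart_q_exists rp1 rp2 U1 B_spd V1 f_inj.
have [u tE] := (horizontal_hpar U B V f_surj theta).1 Ht.
have [v eE] := (horizontal_hpar U B V f_surj eta).1 He.
apply: xget_unique.
  exists psi, u, v; rewrite !pD -tE -eE; split=> //; try exact: hlift_id.
  have Lu : Lmap P ('D_u psi 0) = Lmap P theta by rewrite pD -tE.
  have Lv : Lmap P ('D_v psi 0) = Lmap P eta by rewrite pD -eE.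
  exact: esym (etrans (hess_coord_q u v pC) (congr2 (hess_val U B V f) Lu Lv)).
move=> h [psi' [u' [v' [pC' h1 h2 ->]]]].
have Lu := etrans (esym (key _ u' pC')) (congr1 (Lmap P) h1).
have Lv := etrans (esym (key _ v' pC')) (congr1 (Lmap P) h2).
have E := hess_coord_q u' v' pC'.
have E2 := congr2 (hess_val U B V f) Lu Lv.
have E3 := etrans E E2.
exact E3.
Qed.

End QuotientMetric.

(** * Gradients *)

Section Gradients.
Context {R : realType} {p1 p2 r : nat}.
Hypotheses (r_ge1 : (1 <= r)%N) (rp1 : (r <= p1)%N) (rp2 : (r <= p2)%N).
Variables (U : 'M[R]_(p1, r)) (B : 'M[R]_r) (V : 'M[R]_(p2, r)).
Hypotheses (U1 : stiefel U) (B_spd : spd B) (V1 : stiefel V).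
Let X := U *m B *m V^T.
Let P : triple R p1 p2 r := (U, B, V).
Variable (f : 'M[R]_(p1, p2) -> R).
Hypotheses (fC : C2 f).

Let fd Y : differentiable f Y. Proof. by have /nbhs_singleton[] := fC Y. Qed.
Let tP : total_space P. Proof. by split. Qed.
Let Bu : B \in unitmx. Proof. exact: spd_unit. Qed.
Let sB : B^T = B. Proof. by case: B_spd. Qed.
Let g := grad_e r f X.
Let PU : 'M[R]_p1 := 1%:M - U *m U^T.
Let PV : 'M[R]_p2 := 1%:M - V *m V^T.

Lemma proj_idem p (W : 'M[R]_(p, r)) : stiefel W ->
  [/\ (1%:M - W *m W^T) *m (1%:M - W *m W^T) = 1%:M - W *m W^T,
     (1%:M - W *m W^T)^T = 1%:M - W *m W^T, (1%:M - W *m W^T) *m W = 0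
    & W^T *m (1%:M - W *m W^T) = 0].
Proof.
move=> W1; have z : (1%:M - W *m W^T) *m W = 0.
  by rewrite mulmxBl mul1mx -mulmxA W1 mulmx1 subrr.
split=> //; last by rewrite mulmxBr mulmx1 mulmxA W1 mul1mx subrr.
  by rewrite mulmxBr mulmx1 mulmxA z mul0mx subr0.
by rewrite trmxD trmxN trmx1 trmx_mul trmxK.
Qed.

Lemma idem_kill m n (a : 'M[R]_m) (b : 'M[R]_n) (G : 'M[R]_(m, n)) : a *m a = a -> b *m b = b ->
  a *m (G - a *m G *m b) *m b = 0.
Proof. by move=> a2 b2; rewrite mulmxBr mulmxBl !mulmxA a2 -[X in _ - X]mulmxA b2 subrr. Qed.

Lemma derive_inner : exists G : 'M[R]_(p1, p2), forall eta, 'D_eta f X = inner G eta.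
Proof.
exists (\matrix_(i, j) 'D_(delta_mx i j) f X) => eta.
rewrite derive_dir_delta// innerE pair_bigA; apply: eq_bigr => -[i j] _ /=.
by rewrite mxE; exact: mulrC.
Qed.

(** The witness is the Euclidean gradient [G] minus its normal part PU G PV, which is orthogonal to
    all tangent vectors. *)
Lemma grad_e_spec : TMe r X g /\ forall eta, TMe r X eta -> inner g eta = 'D_eta f X.
Proof.
have [U2 U3 _ _] := proj_idem U1; have [V2 V3 _ _] := proj_idem V1.
have [G GE] := derive_inner.
apply: (@xgetPex _ 0 [set xi | TMe r X xi /\ forall eta, TMe r X eta -> inner xi eta = 'D_eta f X]).
exists (G - PU *m G *m PV); split=> [|eta /(TMe_sub U1 B_spd V1) Teta].
  by apply: (TMe_sup U1 B_spd V1); exact: idem_kill.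
rewrite GE innerDl innerNl inner_mulR inner_mulL U3 V3.
by rewrite mulmxA Teta (innerC G 0) inner0l subr0.
Qed.

Lemma derive_hfun eta : 'D_eta (hfun f) P = 'D_(Lmap P eta) f X.
Proof.
pose Phi (Q : triple R p1 p2 r) := Q.1.1 *m Q.1.2 *m Q.2^T.
have [UC BC VC] := Ck_on_triple openT (Ck_on_id openT 1 : Ck_on 1 setT (fun Q : triple R p1 p2 r => Q)).
have PC : Ck_on 1 setT Phi.
  exact: (Ck_on_mulmx openT (Ck_on_mulmx openT UC BC) (Ck_on_trmx openT VC)).
have Pd := PC.1 P I.
have [_ H1] := is_derive_comp_diff eta Pd (fd (Phi P)).
have [_ H2] := is_derive_product (is_derive_id P eta).
exact (etrans H1 (congr1 (fun z => 'D_z f X) H2)).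
Qed.

Let Delta2 := U^T *m g *m V.
Let K := skew_part Delta2.
Let S := sym_part Delta2.
Definition grad_q_form : triple R p1 p2 r :=
  (proj_perp U *m g *m V *m B + U *m (2^-1 *: (K *m B + B *m K)),
   B *m S *m B,
   (B *m U^T *m g *m proj_perp V)^T - V *m (2^-1 *: (K *m B + B *m K))).

Let Om := 2^-1 *: (K *m B + B *m K).

Let Om_skew : Om^T = - Om.
Proof.
have sK : K^T = - K by exact: skew_part_tr.
by rewrite /Om trmxZ trmxD !trmx_mul sB sK mulmxN mulNmx -opprD scalerN addrC.
Qed.

Let candE : grad_q_form = (PU *m g *m V *m B + U *m Om, B *m S *m B, PV *m g^T *m U *m B - V *m Om).
Proof.
rewrite /grad_q_form !proj_perpE// -/PU -/PV -/Om; congr (_, _, _).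
have [_ V3 _ _] := proj_idem V1.
by rewrite !trmx_mul V3 trmxK sB !mulmxA.
Qed.

Lemma grad_q_form_horizontal : horizontal P grad_q_form.
Proof.
have [_ _ _ U4] := proj_idem U1; have [_ _ _ V4] := proj_idem V1.
apply/(horizontalP rp1 rp2 _ tP); rewrite candE /=.
have h1 : U^T *m (PU *m g *m V *m B + U *m Om) = Om.
  by rewrite mulmxDr !mulmxA U4 U1 !mul0mx mul1mx add0r.
have h2 : V^T *m (PV *m g^T *m U *m B - V *m Om) = - Om.
  by rewrite mulmxBr !mulmxA V4 V1 !mul0mx mul1mx sub0r.
rewrite h1 h2; split=> //.
by rewrite !trmx_mul sB sym_part_tr mulmxA.
Qed.

Lemma grad_q_form_spec eta : horizontal P eta -> gbar P grad_q_form eta = 'D_eta (hfun f) P.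
Proof.
have [_ _ U3 U4] := proj_idem U1; have [_ _ V3 V4] := proj_idem V1.
move=> He; rewrite derive_hfun -(grad_e_spec).2; last first.
  by apply: (TMe_sup U1 B_spd V1); exact: Lmap_normal.
have [/= eS eO _] := (horizontalP rp1 rp2 _ tP).1 He.
rewrite (gbarE rp1 rp2 tP grad_q_form_horizontal He) (LmapE rp1 rp2 tP He).
rewrite (tangent_decomp (TMe_sub U1 B_spd V1 grad_e_spec.1)).
have h1 : U^T *m (PU *m g *m V *m B + U *m Om) = Om.
  by rewrite mulmxDr !mulmxA U4 U1 !mul0mx mul1mx add0r.
have h2 : V^T *m (PV *m g^T *m U *m B - V *m Om) = - Om.
  by rewrite mulmxBr !mulmxA V4 V1 !mul0mx mul1mx sub0r.
rewrite candE /= h1 h2 mulmxN opprK addrK subrK -/g -/PU -/PV.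
have kill p (W : 'M[R]_(p, r)) (z : 'M[R]_(p, r)) : stiefel W -> W^T *m (z - W *m (W^T *m z)) = 0.
  by move=> W1; rewrite mulmxBr !mulmxA W1 mul1mx subrr.
rewrite inner_decomp//; first last.
- by rewrite mulmxA kill// mul0mx.
- by rewrite !mulmxA V4 !mul0mx.
- by rewrite mulmxA kill// mul0mx.
- by rewrite !mulmxA U4 !mul0mx.
rewrite !(inner_mulR _ B) sB -[X in X + _ = _]addrA; congr (_ + _ + _).
(* In the middle block [S] pairs only with theta_B, and [K] only with W B + B W. Moving [B] across
   the inner product leaves K B + B K against W, and the 2^-1 in [Om] cancels the 2 of [gbarE]. *)
move: (U^T *m eta.1.1) eO => W eO.
rewrite -/Delta2 -(sym_skewK Delta2) -/S -/K.
have sS : S^T = S by exact: sym_part_tr.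
have sK : K^T = - K by exact: skew_part_tr.
have sWB : (W *m B + B *m W)^T = - (W *m B + B *m W).
  by rewrite trmxD !trmx_mul sB eO mulmxN mulNmx -opprD addrC.
rewrite innerDl !innerDr (innerC S (W *m B)) (innerC S (B *m W)).
have -> : inner K eta.1.2 = 0 by exact: inner_sym_skew.
have z : inner (W *m B) S + inner (B *m W) S = 0 by rewrite -innerDl; exact: inner_sym_skew.
have -> : \tr (invmx B *m (B *m S *m B) *m invmx B *m eta.1.2) = inner S eta.1.2.
  by rewrite /inner sS !mulmxA mulVmx// mul1mx mulmxK.
have k1 : inner K (W *m B) = inner (K *m B) W by rewrite [RHS]inner_mulR sB.
have k2 : inner K (B *m W) = inner (B *m K) W by rewrite [RHS]inner_mulL sB.
rewrite k1 k2 /Om innerZl innerDl mulrA mulfV ?pnatr_eq0// mul1r.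
by lra.
Qed.

(** Two candidates pair equally with all horizontal vectors, so their difference, itself horizontal,
    has length 0. *)
Lemma grad_qE : grad_q f P = grad_q_form.
Proof.
apply: xget_unique => [|y [Hy yE]].
  by split; [exact: grad_q_form_horizontal|exact: grad_q_form_spec].
apply/eqP; rewrite -subr_eq0; apply/eqP.
have Hd := horizontalB rp1 rp2 tP Hy grad_q_form_horizontal.
have [ds _ _] := (horizontalP rp1 rp2 _ tP).1 Hd.
apply: (gbar_eq0 r_ge1 rp2 tP ds).
have : gbar P y (y - grad_q_form) = gbar P grad_q_form (y - grad_q_form).
  by rewrite yE// grad_q_form_spec.
move=> e; have := gbar_linear P (-1) grad_q_form y (y - grad_q_form).
by rewrite scaleN1r addrC e mulN1r addNr => ->.
Qed.

(** The lower bound 4 sigma_r(X)^2 is positive because [B] is positive definite. *)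
Lemma anticomm_eq0 (A : 'M[R]_r) : B *m A + A *m B = 0 -> A = 0.
Proof.
move=> A0; have [Q [d [Q1 QB lo0 dlo dhi]]] := spd_sigma r_ge1 rp2 tP.
have /andP[H _] := skew_anticomm_bounds Q1 QB lo0 dlo dhi A.
apply: inner_eq0; apply/eqP; rewrite eq_le inner_ge0 andbT.
move: H; rewrite [_ *m B + _]addrC A0 inner0l pmulr_rle0// mulr_gt0// exprn_gt0//.
Qed.

Definition is_Delta1 (D : 'M[R]_r) :=
  B *m (skew_part D)^T + (skew_part D)^T *m B = 2 *: (grad_q_form.1.1^T *m U) /\
  sym_part D = invmx B *m grad_q_form.1.2 *m invmx B.

(** U^T grad_U is half of K B + B K, so the first equation says that the skew parts of D and
    [Delta2] have the same image under the injective map Z |-> Z B + B Z; the second equation says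
    that the symmetric parts agree. *)
Lemma is_Delta1P D : is_Delta1 D <-> D = Delta2.
Proof.
have [_ _ _ U4] := proj_idem U1.
have h1 : 2 *: (grad_q_form.1.1^T *m U) = - (K *m B + B *m K).
  have -> : grad_q_form.1.1^T *m U = (U^T *m grad_q_form.1.1)^T by rewrite trmx_mul trmxK.
  rewrite candE /= mulmxDr !mulmxA U4 U1 !mul0mx mul1mx add0r Om_skew scalerN.
  by rewrite scalerA mulfV ?pnatr_eq0// scale1r.
have h2 : invmx B *m grad_q_form.1.2 *m invmx B = S.
  by rewrite candE /= !mulmxA mulVmx// mul1mx mulmxK.
rewrite /is_Delta1 h1 h2 skew_part_tr; split=> [[e1 e2]|->].
  rewrite -(sym_skewK D) e2 -[RHS]sym_skewK -/S; congr (_ + _).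
  apply/eqP; rewrite -subr_eq0; apply/eqP; apply: anticomm_eq0.
  move: e1; rewrite -/K; move: (skew_part D) => Z.
  rewrite mulmxN mulNmx -opprD => /oppr_inj e1.
  by rewrite mulmxBr mulmxBl addrACA e1 -opprD [B *m K + _]addrC subrr.
by split=> //; rewrite mulmxN mulNmx -opprD -/K addrC.
Qed.

Lemma grad_e_decomp : g = proj_perp U *m grad_q_form.1.1 *m invmx B *m V^T + U *m Delta2 *m V^T
  + (proj_perp V *m grad_q_form.2 *m invmx B *m U^T)^T.
Proof.
have [U2 _ U4 _] := proj_idem U1; have [V2 V3 V4 _] := proj_idem V1.
rewrite candE !proj_perpE//= -/PU -/PV mulmxDr mulmxBr !mulmxA U2 V2 U4 V4 !mul0mx addr0 subr0.
rewrite !mulmxK// {1}(tangent_decomp (TMe_sub U1 B_spd V1 grad_e_spec.1)) -/g -/PU -/PV.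
have -> : (PV *m g^T *m U *m U^T)^T = U *m (PV *m g^T *m U)^T by rewrite trmx_mul trmxK.
by rewrite !mulmxA.
Qed.

(** When the lifted gradient is 0, the matrix 0 solves the equations of Delta_1, hence [Delta2] = 0
    by uniqueness, and [grad_e_decomp] makes the gradient of [f] vanish. *)
Lemma stationary_crit : grad_q f P = 0 ->
  forall xi, (1%:M - U *m U^T) *m xi *m (1%:M - V *m V^T) = 0 -> 'D_xi f X = 0.
Proof.
rewrite grad_qE => c0 xi /(TMe_sup U1 B_spd V1) Txi.
have D0 : Delta2 = 0.
  apply/esym/is_Delta1P; rewrite /is_Delta1 c0 /=.
  have -> : skew_part (0 : 'M[R]_r) = 0 by rewrite /skew_part trmx0 subr0 scaler0.
  have -> : sym_part (0 : 'M[R]_r) = 0 by rewrite /sym_part trmx0 addr0 scaler0.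
  by rewrite !trmx0 !mulmx0 !mul0mx addr0 scaler0.
rewrite -(grad_e_spec.2 _ Txi) grad_e_decomp c0 D0 /=.
by rewrite !mulmx0 !mul0mx trmx0 !addr0 inner0l.
Qed.

End Gradients.

(** * Spectra of bilinear forms *)

Section FormEigenvalues.
Context {R : realType} {E : normedModType R}.

Lemma basis_mem (W : set E) n (b : 'I_n -> E) (c : 'I_n -> R) : is_basis W b ->
  W (\sum_i c i *: b i).
Proof. by move=> [bW _]; apply/bW; exists c. Qed.

Lemma basis_elt (W : set E) n (b : 'I_n -> E) i : is_basis W b -> W (b i).
Proof.
move=> bW; have := basis_mem (fun j => (j == i)%:R) bW.
by under eq_bigr do rewrite scaler_nat mulrb; rewrite -big_mkcond big_pred1_eq.
Qed.

Lemma basis_size_le (W : set E) m n (a : 'I_m -> E) (b : 'I_n -> E) :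
  is_basis W a -> is_basis W b -> (m <= n)%N.
Proof.
move=> aW bW.
have /choice[M ME] : forall i, exists c : 'I_n -> R, a i = \sum_j c j *: b j.
  by move=> i; exact: ((bW.1 (a i)).1 (basis_elt i aW)).
pose MM : 'M[R]_(m, n) := \matrix_(i, j) M i j.
suff : row_free MM by rewrite /row_free => /eqP <-; exact: rank_leq_col.
rewrite -kermx_eq0; apply/negPn/negP => /rowV0Pn[x /sub_kermxP xM /eqP]; apply.
apply/rowP => i; rewrite mxE; apply: (aW.2 (fun i => x 0 i)).
under eq_bigr do rewrite ME scaler_sumr.
rewrite exchange_big big1// => j _.
under eq_bigr do rewrite scalerA; rewrite -scaler_suml.
move/rowP: xM => /(_ j); rewrite !mxE => xM.
have -> : \sum_i x 0 i * M i j = 0 by rewrite -[RHS]xM; apply: eq_bigr => k _; rewrite ?mxE.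
by rewrite scale0r.
Qed.

(** [form_eigvals] leaves the size of its basis free; this pins it to the dimension. *)
Lemma basis_size (W : set E) m n (a : 'I_m -> E) (b : 'I_n -> E) :
  is_basis W a -> is_basis W b -> m = n.
Proof.
by move=> aW bW; apply/eqP; rewrite eqn_leq (basis_size_le aW bW) (basis_size_le bW aW).
Qed.

Variables (W : set E) (g Q q : E -> E -> R).
Hypotheses (g_linear : forall a x y z, g (a *: x + y) z = a * g x z + g y z)
  (g_sym : forall x y, g x y = g y x) (g_pos : forall x, W x -> g x x <= 0 -> x = 0)
  (q_linear : forall a x y z, q (a *: x + y) z = a * q x z + q y z)
  (q_sym : forall x y, q x y = q y x)
  (Qq : forall x y, W x -> W y -> Q x y = q x y).

Definition form_mx n (h : E -> E -> R) (b : 'I_n -> E) : 'M[R]_n := \matrix_(i, j) h (b i) (b j).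

Lemma form_mx_spd n (b : 'I_n -> E) : is_basis W b -> spd (form_mx g b).
Proof.
move=> bW; split; first by apply/matrixP => i j; rewrite !mxE.
move=> x x0; rewrite bilin_mulmx// ltNge; apply/negP => /(g_pos (basis_mem _ bW)) s0.
by move/eqP: x0; apply; apply/rowP => i; rewrite mxE; exact: (bW.2 _ s0 i).
Qed.

(** Evaluating Q x y = g (T x) y on the chosen basis [b'] gives the matrix equation. [Q] is only
    controlled on [W], so a form [q] bilinear on the whole space stands in for it. The basis [b]
    serves to show that some operator exists. *)
Lemma form_eigvals_spec n (b : 'I_n -> E) : is_basis W b ->
  exists (b' : 'I_n -> E) (A : 'M[R]_n), [/\ is_basis W b', form_eigvals W g Q = eigvals A
    & form_mx q b' = A *m form_mx g b'].
Proof.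
move=> bW.
suff [m [b' [T [A [bW' TW QT TA sE]]]]] : exists (m : nat) (b' : 'I_m -> E) (T : {linear E -> E}) (A : 'M[R]_m),
      [/\ is_basis W b', (forall x, W x -> W (T x)),
          (forall x y, W x -> W y -> Q x y = g (T x) y),
          (forall i, T (b' i) = \sum_j A i j *: b' j)
        & form_eigvals W g Q = eigvals A].
  have e := basis_size bW' bW; subst m; exists b', A; split=> //.
  apply/matrixP => i j; have bi := basis_elt i bW'; have bj := basis_elt j bW'.
  rewrite !mxE -(Qq bi bj) (QT _ _ bi bj) TA bilin_suml//.
  by apply: eq_bigr => k _; rewrite !mxE.
pose G := form_mx g b; have Gu : G \in unitmx by apply: spd_unit; exact: form_mx_spd.
pose A := form_mx q b *m invmx G.
(* The operator must be linear on all of [E]. Pairing with the basis and applying the inverse Gram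
   matrix is defined everywhere and gives the true coordinates on [W]. *)
pose coord x : 'rV[R]_n := (\row_k g x (b k)) *m invmx G.
pose T0 x := \sum_j (coord x *m A) 0 j *: b j.
have coord_lin a x y : coord (a *: x + y) = a *: coord x + coord y.
  rewrite /coord scalemxAl -mulmxDl; congr (_ *m _).
  by apply/rowP => k; rewrite !mxE g_linear.
have T0_linear : linear T0.
  move=> a x y; rewrite /T0 coord_lin mulmxDl -scalemxAl scaler_sumr -big_split /=.
  by apply: eq_bigr => j _; rewrite !mxE scalerDl scalerA.
pose TL := GRing.isLinear.Build _ _ _ _ T0 T0_linear.
pose T : {linear E -> E} := HB.pack T0 TL.
have coordE (c : 'I_n -> R) : coord (\sum_i c i *: b i) = \row_i c i.
  rewrite /coord -[RHS](mulmxK Gu); congr (_ *m _); apply/rowP => k.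
  by rewrite !mxE bilin_suml//; apply: eq_bigr => i _; rewrite !mxE.
apply: (@xgetPex _ [::] [set s : seq R |
    exists (n : nat) (b : 'I_n -> E) (T : {linear E -> E}) (A : 'M[R]_n),
      [/\ is_basis W b,
          (forall x, W x -> W (T x)),
          (forall x y, W x -> W y -> Q x y = g (T x) y),
          (forall i, T (b i) = \sum_j A i j *: b j)
        & s = eigvals A]]).
exists (eigvals A), n, b, T, A; split=> //.
- by move=> x _; exact: basis_mem.
- move=> x y Wx Wy; rewrite Qq//.
  have [c xE] := (bW.1 x).1 Wx; have [e yE] := (bW.1 y).1 Wy.
  have TE : T x = \sum_j ((\row_i c i) *m A) 0 j *: b j by rewrite /= /T0 {1}xE coordE.
  rewrite TE xE yE.
  have rowE (h : 'I_n -> R) : \sum_i h i *: b i = \sum_i (\row_j h j) 0 i *: b i.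
    by apply: eq_bigr => i _; rewrite mxE.
  rewrite (rowE c) (rowE e) -!bilin_mulmx//.
  by rewrite -/(form_mx q b) -/(form_mx g b) /A -/G mulmxA mulmxKV.
- move=> i; have bE : b i = \sum_j (i == j)%:R *: b j.
    by under eq_bigr do rewrite scaler_nat mulrb; rewrite -big_mkcond (eq_bigl (pred1 i)) ?big_pred1_eq// => j; rewrite eq_sym.
  rewrite {1}bE /= /T0 coordE; apply: eq_bigr => j _; congr (_ *: _).
  rewrite (_ : \row__ _ = delta_mx 0 i) -?rowE ?mxE//.
  by apply/rowP => k; rewrite !mxE eqxx eq_sym.
Qed.

End FormEigenvalues.

(** * Comparison of the two metrics through L *)

Section LmapBounds.
Context {R : realType} {p1 p2 r : nat}.
Hypotheses (r_ge1 : (1 <= r)%N) (rp1 : (r <= p1)%N) (rp2 : (r <= p2)%N).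
Variables (U : 'M[R]_(p1, r)) (B : 'M[R]_r) (V : 'M[R]_(p2, r)).
Hypotheses (tP : total_space (U, B, V)).
Let X := U *m B *m V^T.

(** Both sides split into the same four blocks. The skew one lies between 4 and 4 times the squared
    extreme singular values against a weight 2 in [gbar]: the ratio 2 is kept above, while below it
    is more than the 1 forced by the other blocks. *)
Lemma Lmap_bounds theta : horizontal (U, B, V) theta ->
  sigma r X ^+ 2 * gbar (U, B, V) theta theta <= inner (Lmap (U, B, V) theta) (Lmap (U, B, V) theta)
   <= 2 * sigma 1 X ^+ 2 * gbar (U, B, V) theta theta.
Proof.
move=> Ht; have [U1 [sB _] V1] := tP.
have [Q [d [Q1 QB lo0 dlo dhi]]] := spd_sigma r_ge1 rp2 tP.
have [/= tS tO _] := (horizontalP rp1 rp2 _ tP).1 Ht.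
have kill p (Z : 'M[R]_(p, r)) (z : 'M[R]_(p, r)) : stiefel Z -> Z^T *m (z - Z *m (Z^T *m z)) = 0.
  by move=> Z1; rewrite mulmxBr !mulmxA Z1 mul1mx subrr.
rewrite (LmapE rp1 rp2 tP Ht) (gbarE rp1 rp2 tP Ht Ht) inner_decomp//; first last.
- by rewrite mulmxA kill// mul0mx.
- by rewrite mulmxA kill// mul0mx.
- by rewrite mulmxA kill// mul0mx.
- by rewrite mulmxA kill// mul0mx.
move: (theta.1.1 - _) (theta.2 - _) => X1 X2.
move: (U^T *m _) tO => W sW; move: theta.1.2 tS => S sS.
have sWB : (W *m B + B *m W)^T = - (W *m B + B *m W).
  by rewrite trmxD !trmx_mul sB sW mulmxN mulNmx -opprD addrC.
have z := inner_sym_skew sWB sS.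
rewrite (innerDl (_ + _) S) !(innerDr (_ + _) S) (innerC S) z addr0 add0r.
have /andP[a1 a2] := fro_mul_bounds Q1 QB lo0 dlo dhi X1.
have /andP[b1 b2] := fro_mul_bounds Q1 QB lo0 dlo dhi X2.
have /andP[c1 c2] := skew_anticomm_bounds Q1 QB lo0 dlo dhi W.
have /andP[e1 e2] := affine_metric_bounds Q1 QB lo0 dlo dhi sS.
rewrite -/X in a1 a2 b1 b2 c1 c2 e1 e2 *.
have S0 := inner_ge0 S; have X10 := inner_ge0 X1; have X20 := inner_ge0 X2; have W0 := inner_ge0 W.
have lo2 : 0 <= sigma r X ^+ 2 by rewrite sqr_ge0.
have hi2 : 0 <= sigma 1 X ^+ 2 by rewrite sqr_ge0.
have x1 := mulr_ge0 hi2 X10; have x2 := mulr_ge0 hi2 X20; have w1 := mulr_ge0 lo2 W0.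
move: (sigma r X ^+ 2) (sigma 1 X ^+ 2) a1 a2 b1 b2 c1 c2 e1 e2 lo2 hi2 x1 x2 w1 => lo hi.
move: (inner (X1 *m B) _) (inner (X2 *m B) _) (inner (_ + _) _) (inner S S) S0 => i1 i2 i3 i4 S0.
move: (inner X1 X1) (inner X2 X2) (inner W W) (\tr _) X10 X20 W0 => j1 j2 j3 j4 *.
by apply/andP; split; lra.
Qed.

End LmapBounds.

Lemma eigvals_conj {R : realType} n (P A A' : 'M[R]_n) : P \in unitmx -> P *m A = A' *m P ->
  eigvals A = eigvals A'.
Proof. by move=> Pu PA; rewrite /eigvals (char_poly_conj Pu PA). Qed.

(** * Comparison of the two Hessian spectra *)

Section HessianSpectrum.
Context {R : realType} {p1 p2 r : nat}.
Hypotheses (r_ge1 : (1 <= r)%N) (rp1 : (r <= p1)%N) (rp2 : (r <= p2)%N).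
Variables (U : 'M[R]_(p1, r)) (B : 'M[R]_r) (V : 'M[R]_(p2, r)).
Hypotheses (U1 : stiefel U) (B_spd : spd B) (V1 : stiefel V).
Let X := U *m B *m V^T.
Let P : triple R p1 p2 r := (U, B, V).
Variable (f : 'M[R]_(p1, p2) -> R).
Hypotheses (fC : C2 f)
  (crit : forall xi, (1%:M - U *m U^T) *m xi *m (1%:M - V *m V^T) = 0 -> 'D_xi f X = 0).
Let tP : total_space P. Proof. by split. Qed.

Lemma TMe_Lmap theta : TMe r X (Lmap P theta).
Proof. by apply: (TMe_sup U1 B_spd V1); exact: Lmap_normal. Qed.

Lemma hess_q_hess_e theta eta : horizontal P theta -> horizontal P eta ->
  hess_q f P theta eta = hess_e r f X (Lmap P theta) (Lmap P eta).
Proof.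
move=> Ht He; rewrite (hess_qE r_ge1 rp1 rp2 U1 B_spd V1 fC crit Ht He).
by rewrite (hess_eE rp1 rp2 U1 B_spd V1 fC crit (TMe_Lmap theta) (TMe_Lmap eta)).
Qed.

Let hv := hess_val U B V f.
Let hv_linear a x y z : hv (a *: x + y) z = a * hv x z + hv y z.
Proof.
by rewrite /hv !(hess_val_sym U B V fC _ z) hess_val_linear.
Qed.
Let hv_sym x y : hv x y = hv y x. Proof. exact: (hess_val_sym U B V fC). Qed.

(** The two spectra come from unrelated bases b and c. Expanding the vectors L(b_i) in c by a matrix
    [C] replaces [A'] by its conjugate C A' C^-1, with the same eigenvalues. Both pencils then share
    the matrix [form_mx qh b], and their Gram matrices are compared by [Lmap_bounds]. *)
Lemma hess_spectrum : size (form_eigvals (horizontal P) (gbar P) (hess_q f P)) = dimM p1 p2 r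
  /\ forall i, (i < dimM p1 p2 r)%N ->
  sandwiched (form_eigvals (horizontal P) (gbar P) (hess_q f P))`_i
   (sigma r X ^+ 2 * (form_eigvals (TMe r X) (@inner R p1 p2) (hess_e r f X))`_i)
   (2 * sigma 1 X ^+ 2 * (form_eigvals (TMe r X) (@inner R p1 p2) (hess_e r f X))`_i).
Proof.
have [f1 [f2 [f3 [f_inj f_surj]]]] :=
  @stacked_coordinates R (dimM p1 p2 r) (p1 - r) r (p2 - r) r (dimM_split rp1 rp2).
have hB := hpar_basis rp1 rp2 B U1 V1 f_inj f_surj.
have eB := tpar_basis rp1 rp2 U1 B_spd V1 f_inj f_surj.
pose qh x y := hv (Lmap P x) (Lmap P y).
have qh_linear a x y z : qh (a *: x + y) z = a * qh x z + qh y z.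
  by rewrite /qh LmapD LmapZ hv_linear.
have qh_sym x y : qh x y = qh y x by exact: hv_sym.
have qhE x y : horizontal P x -> horizontal P y -> hess_q f P x y = qh x y.
  exact: (hess_qE r_ge1 rp1 rp2 U1 B_spd V1 fC crit).
have qeE x y : TMe r X x -> TMe r X y -> hess_e r f X x y = hv x y.
  exact: (hess_eE rp1 rp2 U1 B_spd V1 fC crit).
have gpos x : horizontal P x -> gbar P x x <= 0 -> x = 0.
  by move=> /(horizontalP rp1 rp2 _ tP)[xs _ _]; exact: (gbar_eq0 r_ge1 rp2 tP xs).
have ipos (x : 'M[R]_(p1, p2)) : TMe r X x -> inner x x <= 0 -> x = 0.
  by move=> _ x0; apply: inner_eq0; apply/eqP; rewrite eq_le x0 inner_ge0.
have [b [A [bW -> SA]]] := form_eigvals_spec (gbar_linear P) (gbar_sym P) gpos qh_linear qh_sym qhE hB.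
have [c [A' [cW -> SA']]] := form_eigvals_spec (@inner_linear R p1 p2) (@innerC R p1 p2) ipos hv_linear hv_sym qeE eB.
pose Lb i := Lmap P (b i).
have /choice[M ME] : forall i, exists m : 'I__ -> R, Lb i = \sum_j m j *: c j.
  by move=> i; exact: ((cW.1 (Lb i)).1 (TMe_Lmap (b i))).
pose C : 'M[R]_(dimM p1 p2 r) := \matrix_(i, j) M i j.
have CE (h : 'M[R]_(p1, p2) -> 'M[R]_(p1, p2) -> R) :
    (forall a x y z, h (a *: x + y) z = a * h x z + h y z) -> (forall x y, h x y = h y x) ->
    form_mx h Lb = C *m form_mx h c *m C^T.
  move=> hlift_form hs; apply/matrixP => i j; rewrite -row_mul_tr_row row_mul bilin_mulmx// mxE !ME.
  by congr (h _ _); apply: eq_bigr => k _; rewrite !mxE.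
pose G := form_mx (gbar P) b; pose G' := form_mx (@inner R p1 p2) Lb.
have sumL (x : 'rV[R]_(dimM p1 p2 r)) : \sum_i x 0 i *: Lb i = Lmap P (\sum_i x 0 i *: b i).
  elim/big_rec2: _ => [|i y z _ ->]; last by rewrite LmapD LmapZ.
  by rewrite -(scale0r (0 : triple R p1 p2 r)) LmapZ scale0r.
have bounds (x : 'rV[R]_(dimM p1 p2 r)) :
    sigma r X ^+ 2 * (x *m G *m x^T) 0 0 <= (x *m G' *m x^T) 0 0
     <= 2 * sigma 1 X ^+ 2 * (x *m G *m x^T) 0 0.
  rewrite /G' /G (bilin_mulmx (@inner_linear R p1 p2) (@innerC R p1 p2)) sumL.
  rewrite (bilin_mulmx (gbar_linear P) (gbar_sym P)).
  apply: (Lmap_bounds r_ge1 rp1 rp2 tP).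
  exact: (basis_mem (fun i => x 0 i) bW).
have G_spd : spd G := form_mx_spd (gbar_linear P) (gbar_sym P) gpos bW.
have [_ [_ [_ _ lo0 _ _]]] := spd_sigma r_ge1 rp2 tP.
have G'_spd : spd G'.
  split; first by apply/matrixP => i j; rewrite !mxE; exact: innerC.
  move=> x x0; have /andP[h _] := bounds x; apply: lt_le_trans h.
  by rewrite mulr_gt0 ?exprn_gt0//; exact: G_spd.2.
have G'E : G' = C *m form_mx (@inner R p1 p2) c *m C^T.
  exact: (CE _ (@inner_linear R p1 p2) (@innerC R p1 p2)).
(* The lower metric bound makes [G'] positive definite, that is, L is injective; invertibility
   passes from [G'] to its left factor [C]. *)
have Cu : C \in unitmx.
  have := spd_unit G'_spd; rewrite G'E -mulmxA unitmx_mul => /andP[//].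
have SC : form_mx qh b = C *m form_mx hv c *m C^T by exact: (CE hv hv_linear hv_sym).
rewrite (eigvals_conj (P := C) (A := A') (A' := C *m A' *m invmx C) Cu) ?mulmxKV//.
apply: (pencil_compare G_spd G'_spd _ SA _ bounds).
  by apply/matrixP => i j; rewrite !mxE.
by rewrite SC SA' G'E !mulmxA mulmxKV.
Qed.

End HessianSpectrum.

Theorem theorem6 (R : realType) (p1 p2 r : nat)
    (r_ge1 : (1 <= r)%N) (r_le : (r <= minn p1 p2)%N)
    (f : 'M[R]_(p1, p2) -> R) (f_C2 : C2 f)
    (U : 'M[R]_(p1, r)) (B : 'M[R]_r) (V : 'M[R]_(p2, r))
    (U_st : stiefel U) (B_spd : spd B) (V_st : stiefel V) :
  let X := U *m B *m V^T in
  let P := (U, B, V) in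
  let gradf := grad_e r f X in
  let gradU := (grad_q f P).1.1 in
  let gradB := (grad_q f P).1.2 in
  let gradV := (grad_q f P).2 in
  let is_Delta1 := fun Delta1 : 'M[R]_r =>
    B *m (skew_part Delta1)^T + (skew_part Delta1)^T *m B = 2 *: (gradU^T *m U) /\
    sym_part Delta1 = invmx B *m gradB *m invmx B in
  let Delta2 := U^T *m gradf *m V in
  let Om := 2^-1 *: (skew_part Delta2 *m B + B *m skew_part Delta2) in
  [/\ (exists! Delta1, is_Delta1 Delta1),
      (forall Delta1, is_Delta1 Delta1 ->
         gradf = proj_perp U *m gradU *m invmx B *m V^T + U *m Delta1 *m V^T
                 + (proj_perp V *m gradV *m invmx B *m U^T)^T),
      grad_q f P = (proj_perp U *m gradf *m V *m B + U *m Om,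
                    B *m sym_part Delta2 *m B,
                    (B *m U^T *m gradf *m proj_perp V)^T - V *m Om)
    & grad_q f P = 0 ->
        [/\ (forall theta, horizontal P theta ->
               hess_q f P theta theta =
               hess_e r f X (Lmap P theta) (Lmap P theta)),
            size (form_eigvals (horizontal P) (gbar P) (hess_q f P))
              = ((p1 + p2 - r) * r)%N
          & forall i : nat, (1 <= i <= (p1 + p2 - r) * r)%N ->
              let lam_h := lambda (horizontal P) (gbar P) (hess_q f P) i in
              let lam_f := lambda (TMe r X) (@inner R p1 p2) (hess_e r f X) i in
              sandwiched lam_h (sigma r X ^+ 2 * lam_f)
                (2 * sigma 1 X ^+ 2 * lam_f)]].
Proof.
have [rp1 rp2] : (r <= p1)%N /\ (r <= p2)%N.
  by apply/andP; rewrite -leq_min.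
have gE := grad_qE r_ge1 rp1 rp2 U_st B_spd V_st f_C2.
have DP := is_Delta1P r_ge1 rp1 rp2 U_st B_spd V_st f.
move=> X P gradf gradU gradB gradV is_D Delta2 Om.
have isDE D : is_D D <-> D = Delta2.
  by rewrite /is_D /gradU /gradB gE; exact: DP.
split.
- exists Delta2; split; first exact/isDE.
  by move=> D /isDE.
- move=> D /isDE ->; rewrite /gradU /gradV gE.
  exact: (grad_e_decomp rp1 rp2 U_st B_spd V_st f_C2).
- exact: gE.
- move=> /(stationary_crit r_ge1 rp1 rp2 U_st B_spd V_st f_C2) crit.
  have [hs hb] := hess_spectrum r_ge1 rp1 rp2 U_st B_spd V_st f_C2 crit.
  (* The theorem counts eigenvalues from 1 and the lists from 0: index 0 is excluded by hypothesis,
     and the successor of i reads entry i. *)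
  split=> // [theta Ht|[//|i] /andP[_ il]].
    exact: (hess_q_hess_e r_ge1 rp1 rp2 U_st B_spd V_st f_C2 crit).
  exact: hb.
Qed.
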